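(* Let $n\geq1$, $a>0$, and let $I\subseteq\mathbb R$ be an open interval. Consider the differential equation $$\frac{dY}{dz}=\left(\Lambda(z)+R(z)\right)Y,$$ where $\Lambda\in\mathscr O(\mathbb H_{I,a};\mathfrak h(n,\mathbb C))$ satisfies the $L$-condition on $I$, and $R\in\mathscr O(\mathbb H_{I,a};\mathfrak{gl}(n,\mathbb C))$ satisfies the good decay condition on $I$. Then there exists a unique holomorphic fundamental matrix solution $Y\colon\mathbb H_{I,a}\to GL(n,\mathbb C)$ such that, for any closed interval $J\subset I$ and $z\to\infty$ in $\mathbb H_{J,a}$, $$Y(z)=\left(I_n+o(1)\right)\exp\left(\int_{z_o}^z\Lambda(w)\,dw\right),$$ where $z_o$ is an arbitrary point of $\mathbb H_{I,a}$.
   Context: Notation. $\widetilde{\mathbb C^*}$ is the universal cover of $\mathbb C^*=\mathbb C\setminus\{0\}$; its points are written $z=\rho e^{\sqrt{-1}\theta}$ with modulus $|z|=\rho>0$ and argument $\arg z=\theta\in\mathbb R$. For $\phi\in\mathbb R$, $a>0$, $$\mathbb H_{\phi,a}:=\Big\{z\in\widetilde{\mathbb C^*}:\arg z\in\left]\phi-\tfrac\pi2;\phi+\tfrac\pi2\right[,\ |z|\ge\tfrac{a}{\cos(\phi-\arg z)}\Big\},\qquad \ell_{\phi,a}:=\partial\mathbb H_{\phi,a}.$$ The line $\ell_{\phi,a}$ is oriented as the boundary of $\mathbb H_{\phi,a}$, i.e. with direction of angle $\phi-\pi/2$; $w\le z$ for $w,z\in\ell_{\phi,a}$ means that $w$ precedes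 $z$ in this orientation. For an interval $I\subseteq\mathbb R$, $\mathbb H_{I,a}:=\bigcup_{\phi\in I}\mathbb H_{\phi,a}$. Closed intervals are of the form $J=[c,d]$. $\mathfrak h(n,\mathbb C)\subset\mathfrak{gl}(n,\mathbb C)$ denotes the diagonal matrices; $\mathfrak{gl}(n,\mathbb C)$ carries an arbitrary norm. $\mathscr O(C;V)$ is the space of $V$-valued holomorphic functions on $C$ (if $C$ is not open: holomorphic on some open set containing $C$). $\|\cdot\|_1$ is the $L^1$-norm on a line with respect to arc length. $L$-condition. For $\Lambda\in\mathscr O(\mathbb H_{I,a};\mathfrak h(n,\mathbb C))$, $J\subseteq I$ closed and $i,j\in\{1,\dots,n\}$ set $$\mathfrak S^{ij}_{J,a}:=\sup_{\phi\in J}\sup_{b\ge a}\sup_{\substack{w\le z\\ w,z\in\ell_{\phi,b}}}\operatorname{Re}\int_{w,\ell_{\phi,b}}^z(\Lambda_{ii}(t)-\Lambda_{jj}(t))dt,\quad \mathfrak I^{ij}_{J,a}:=\inf_{\phi\in J}\inf_{b\ge a}\inf_{\substack{w\le z\\ w,z\in\ell_{\phi,b}}}\operatorname{Re}\int_{w,\ell_{\phi,b}}^z(\Lambda_{ii}(t)-\Lambda_{jj}(t))dt,$$ the integrals being along $\ell_{\phi,b}$. $\Lambda$ satisfies the $L$-condition on $I$ if for any $i,j\in\{1,\dots,n\}$ and any closed interval $J\subseteq I$ there exist $K_1,K_2\in\mathbb R$, depending on $J$, such that one of the following mutually exclusive conditions holds: either ($L$-1) $\mathfrak S^{ij}_{J,a}\le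 K_1$ and $\mathfrak I^{ij}_{J,a}=-\infty$; or ($L$-2) $\mathfrak I^{ij}_{J,a}\ge K_2$. Good decay condition. $R\in\mathscr O(\mathbb H_{I,a};\mathfrak{gl}(n,\mathbb C))$ satisfies the good decay condition on $I$ if for any closed interval $J\subseteq I$ and any $b\ge a$, $R$ is $L^1$-integrable when restricted to any line $\ell_{\phi,b}$ with $\phi\in J$, and $\lim_{b\to+\infty}\sup_{\phi\in J}\|R|_{\ell_{\phi,b}}\|_1=0$. *)

(* Defs.v *)
From Stdlib Require Import Reals Factorial Lra.
From Coquelicot Require Import Coquelicot.
Open Scope R_scope.

(* Model of the universal cover: the plane [C] with covering map
   exp : C -> C \ {0}.  The point of modulus rho and argument theta is
   (ln rho, theta).  In this model the topology and the complex structure of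
   the cover are those of [C]. *)
Notation UC := C (only parsing).

Definition modulus (z : UC) : R := exp (Re z).
Definition arg (z : UC) : R := Im z.
Definition proj (z : UC) : C :=
  (modulus z * cos (arg z), modulus z * sin (arg z)).

(* df/dz = l at the point p, where "z" is the function [proj]: as
   dz = proj(zeta) dzeta in the coordinate zeta of [UC], the identity
   df = l dz reads f'(p) = l * proj p. *)
Definition is_dz_derive (f : UC -> C) (p : UC) (l : C) : Prop :=
  @is_derive C_AbsRing C_NormedModule f p (Cmult l (proj p)).

(* Functions on a subset of the cover are represented by total functions,
   whose values outside the relevant open neighbourhood are irrelevant. *)
Definition holomorphic_on (S : UC -> Prop) (f : UC -> C) : Prop :=
  exists U : UC -> Prop,
    @open C_UniformSpace U /\
    (forall p, S p -> U p) /\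
    (forall p, U p -> exists l : C, is_dz_derive f p l).

Definition half_plane (phi a : R) (z : UC) : Prop :=
  phi - PI / 2 < arg z < phi + PI / 2 /\
  modulus z >= a / cos (phi - arg z).

Definition half_planes (I : R -> Prop) (a : R) (z : UC) : Prop :=
  exists phi, I phi /\ half_plane phi a z.

Definition boundary (S : UC -> Prop) (z : UC) : Prop :=
  ~ @locally C_UniformSpace z S /\
  ~ @locally C_UniformSpace z (fun w => ~ S w).

Definition line (phi a : R) : UC -> Prop := boundary (half_plane phi a).

(* Arc-length parametrization of [line phi a] in its positive direction, of
   angle phi - PI/2: see [line_curveP] and [proj_line_curve] below.  Thus
   w <= z on the line means w = line_curve phi a s, z = line_curve phi a t
   with s <= t. *)
Definition line_curve (phi a t : R) : UC :=
  (ln (sqrt (a ^ 2 + t ^ 2)), phi - atan (t / a)).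

Definition in_open_itv (alpha beta : Rbar) (x : R) : Prop :=
  Rbar_lt alpha x /\ Rbar_lt x beta.
Definition in_closed_itv (c d x : R) : Prop := c <= x <= d.
Definition closed_subitv (c d : R) (I : R -> Prop) : Prop :=
  c <= d /\ forall x, in_closed_itv c d x -> I x.

Definition velocity (gamma : R -> UC) (t : R) : C :=
  (Derive (fun u => Re (proj (gamma u))) t,
   Derive (fun u => Im (proj (gamma u))) t).

Definition curve_int (f : UC -> C) (gamma : R -> UC) (s t : R) : C :=
  @RInt C_R_CompleteNormedModule
    (fun u => Cmult (f (gamma u)) (velocity gamma u)) s t.

Definition C1_path (S : UC -> Prop) (p q : UC) (gamma : R -> UC) : Prop :=
  gamma 0 = p /\ gamma 1 = q /\
  forall t, 0 <= t <= 1 ->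
    S (gamma t) /\
    ex_derive (fun u => Re (gamma u)) t /\
    ex_derive (fun u => Im (gamma u)) t /\
    @continuous R_UniformSpace C_UniformSpace (velocity gamma) t.

(* Rows and columns are numbered from 0 to n - 1. *)

Definition entry {n : nat} (A : @matrix C n n) (i j : nat) : C :=
  coeff_mat (zero : C) A i j.

Definition is_diagonal {n : nat} (A : @matrix C n n) : Prop :=
  forall i j, (i < n)%nat -> (j < n)%nat -> i <> j -> entry A i j = zero.

Definition invertible {n : nat} (A : @matrix C n n) : Prop :=
  exists B : @matrix C n n, mult A B = one /\ mult B A = one.

Definition mexp {n : nat} (A : @matrix C n n) : @matrix C n n :=
  mk_matrix n n (fun i j =>
    (Series (fun k => Re (entry (pow_n A k) i j) / INR (fact k)),
     Series (fun k => Im (entry (pow_n A k) i j) / INR (fact k)))).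

Definition mx_curve_int {n : nat} (F : UC -> @matrix C n n)
    (gamma : R -> UC) (s t : R) : @matrix C n n :=
  mk_matrix n n (fun i j => curve_int (fun z => entry (F z) i j) gamma s t).

Definition mscal {n : nat} (c : C) (A : @matrix C n n) : @matrix C n n :=
  mk_matrix n n (fun i j => Cmult c (entry A i j)).

Definition is_matrix_norm {n : nat} (N : @matrix C n n -> R) : Prop :=
  (forall A B, N (plus A B) <= N A + N B) /\
  (forall c A, N (mscal c A) = Cmod c * N A) /\
  (forall A, N A = 0 -> A = zero).

Definition mx_holomorphic_on {n : nat} (S : UC -> Prop)
    (F : UC -> @matrix C n n) : Prop :=
  forall i j, (i < n)%nat -> (j < n)%nat ->
    holomorphic_on S (fun z => entry (F z) i j).

Definition mx_is_dz_derive {n : nat} (F : UC -> @matrix C n n)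
    (p : UC) (A : @matrix C n n) : Prop :=
  forall i j, (i < n)%nat -> (j < n)%nat ->
    is_dz_derive (fun z => entry (F z) i j) p (entry A i j).

(* The iterated suprema (infima) over phi, b and w <= z are taken jointly. *)
Definition line_int_values {n : nat} (Lam : UC -> @matrix C n n)
    (a c d : R) (i j : nat) (x : R) : Prop :=
  exists phi b s t : R,
    in_closed_itv c d phi /\ a <= b /\ s <= t /\
    x = Re (curve_int (fun z => Cminus (entry (Lam z) i i) (entry (Lam z) j j))
              (line_curve phi b) s t).

Definition L_sup {n : nat} (Lam : UC -> @matrix C n n)
    (a c d : R) (i j : nat) : Rbar :=
  Lub_Rbar (line_int_values Lam a c d i j).
Definition L_inf {n : nat} (Lam : UC -> @matrix C n n)
    (a c d : R) (i j : nat) : Rbar :=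
  Glb_Rbar (line_int_values Lam a c d i j).

Definition L_condition {n : nat} (Lam : UC -> @matrix C n n)
    (a : R) (I : R -> Prop) : Prop :=
  forall i j, (i < n)%nat -> (j < n)%nat ->
  forall c d, closed_subitv c d I ->
  exists K1 K2 : R,
    (Rbar_le (L_sup Lam a c d i j) K1 /\ L_inf Lam a c d i j = m_infty) \/
    Rbar_le K2 (L_inf Lam a c d i j).

(* As [line_curve] is parametrized by arc length and the integrand is
   nonnegative and (for holomorphic F) continuous, integrability means
   convergence of the improper Riemann integral over the real line. *)
Definition L1_on_line {n : nat} (N : @matrix C n n -> R)
    (F : UC -> @matrix C n n) (phi b : R) : Prop :=
  ex_RInt_gen (fun t => N (F (line_curve phi b t)))
    (Rbar_locally m_infty) (Rbar_locally p_infty).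

Definition L1_norm_on_line {n : nat} (N : @matrix C n n -> R)
    (F : UC -> @matrix C n n) (phi b : R) : R :=
  RInt_gen (fun t => N (F (line_curve phi b t)))
    (Rbar_locally m_infty) (Rbar_locally p_infty).

Definition sup_L1_norm {n : nat} (N : @matrix C n n -> R)
    (F : UC -> @matrix C n n) (c d b : R) : Rbar :=
  Lub_Rbar (fun x => exists phi,
    in_closed_itv c d phi /\ x = L1_norm_on_line N F phi b).

(* The limit of [sup_L1_norm] is spelled out because it is [Rbar]-valued;
   being a supremum of norms, it is nonnegative. *)
Definition good_decay {n : nat} (N : @matrix C n n -> R)
    (F : UC -> @matrix C n n) (a : R) (I : R -> Prop) : Prop :=
  forall c d, closed_subitv c d I ->
    (forall b phi, a <= b -> in_closed_itv c d phi -> L1_on_line N F phi b) /\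
    (forall eps : posreal,
       Rbar_locally p_infty (fun b => Rbar_lt (sup_L1_norm N F c d b) eps)).

Definition little_o1 {n : nat} (N : @matrix C n n -> R)
    (S : UC -> Prop) (F : UC -> @matrix C n n) : Prop :=
  forall eps : posreal, exists M : R,
    forall z, S z -> M <= modulus z -> N (F z) < eps.

Definition fundamental_solution {n : nat} (S : UC -> Prop)
    (A Y : UC -> @matrix C n n) : Prop :=
  mx_holomorphic_on S Y /\
  (forall z, S z -> invertible (Y z)) /\
  (forall z, S z -> mx_is_dz_derive Y z (mult (A z) (Y z))).

(* The integral of Lam from z0 to z does not depend on the path in
   [half_planes I a], which is simply connected. *)
Definition has_asymptotics {n : nat} (N : @matrix C n n -> R)
    (Lam : UC -> @matrix C n n) (a : R) (I : R -> Prop) (z0 : UC)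
    (Y : UC -> @matrix C n n) : Prop :=
  forall c d, closed_subitv c d I ->
  exists E : UC -> @matrix C n n,
    little_o1 N (half_planes (in_closed_itv c d) a) E /\
    forall z, half_planes (in_closed_itv c d) a z ->
    forall gamma, C1_path (half_planes I a) z0 z gamma ->
      Y z = mult (plus one (E z)) (mexp (mx_curve_int Lam gamma 0 1)).

Lemma cos_atan_pos (x : R) : 0 < cos (atan x).
Proof. destruct (atan_bound x); apply cos_gt_0; lra. Qed.

Lemma sqrt_cos_atan (a t : R) :
  0 < a -> sqrt (a ^ 2 + t ^ 2) * cos (atan (t / a)) = a.
Proof.
intros Ha; rewrite cos_atan.
assert (H : a ^ 2 + t ^ 2 = a ^ 2 * (1 + (t / a)²)) by (unfold Rsqr; field; lra).
rewrite H, sqrt_mult_alt by apply pow2_ge_0.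
rewrite sqrt_pow2 by lra.
assert (H1 : 0 < sqrt (1 + (t / a)²))
  by (apply sqrt_lt_R0; pose proof (Rle_0_sqr (t / a)); lra).
field; lra.
Qed.

Lemma sqrt_sin_atan (a t : R) :
  0 < a -> sqrt (a ^ 2 + t ^ 2) * sin (atan (t / a)) = t.
Proof.
intros Ha.
pose proof (cos_atan_pos (t / a)) as Hc.
assert (Hs : sin (atan (t / a)) = t / a * cos (atan (t / a)))
  by (rewrite <- (tan_atan (t / a)) at 2; unfold tan; field; lra).
rewrite Hs.
transitivity (t / a * (sqrt (a ^ 2 + t ^ 2) * cos (atan (t / a)))); [ring|].
rewrite sqrt_cos_atan by assumption; field; lra.
Qed.

Lemma modulus_line_curve (phi a t : R) :
  0 < a -> modulus (line_curve phi a t) = sqrt (a ^ 2 + t ^ 2).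
Proof.
intros Ha; unfold modulus, line_curve, Re; simpl fst.
apply exp_ln, sqrt_lt_R0.
pose proof (pow_lt a 2 Ha); pose proof (pow2_ge_0 t); lra.
Qed.

Lemma proj_line_curve (phi a t : R) : 0 < a ->
  proj (line_curve phi a t) = Cmult (cos phi, sin phi) (a, - t).
Proof.
intros Ha; unfold proj; rewrite modulus_line_curve by assumption.
unfold arg, line_curve, Im, Cmult; simpl snd; simpl fst.
rewrite cos_minus, sin_minus.
pose proof (sqrt_cos_atan a t Ha) as H1; pose proof (sqrt_sin_atan a t Ha) as H2.
f_equal.
- transitivity (cos phi * (sqrt (a ^ 2 + t ^ 2) * cos (atan (t / a))) +
                sin phi * (sqrt (a ^ 2 + t ^ 2) * sin (atan (t / a)))); [ring|].
  rewrite H1, H2; ring.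
- transitivity (sin phi * (sqrt (a ^ 2 + t ^ 2) * cos (atan (t / a))) -
                cos phi * (sqrt (a ^ 2 + t ^ 2) * sin (atan (t / a)))); [ring|].
  rewrite H1, H2; ring.
Qed.

Lemma half_planeE (phi a : R) (z : UC) :
  half_plane phi a z <->
  phi - PI / 2 < arg z < phi + PI / 2 /\ a <= modulus z * cos (phi - arg z).
Proof.
unfold half_plane; split; intros [H1 H2]; split; trivial;
  assert (Hc : 0 < cos (phi - arg z)) by (apply cos_gt_0; lra).
- apply Rge_le in H2.
  apply (Rmult_le_compat_r _ _ _ (Rlt_le _ _ Hc)) in H2.
  replace (a / cos (phi - arg z) * cos (phi - arg z)) with a in H2 by (field; lra).
  exact H2.
- apply Rle_ge, (Rmult_le_reg_r _ _ _ Hc).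
  replace (a / cos (phi - arg z) * cos (phi - arg z)) with a by (field; lra).
  exact H2.
Qed.

Lemma continuous_height (phi : R) (z : UC) :
  @continuous C_UniformSpace R_UniformSpace
    (fun w => modulus w * cos (phi - arg w)) z.
Proof.
unfold modulus, arg.
apply (continuous_mult (K := R_AbsRing) (U := C_UniformSpace)).
- apply (continuous_comp (U := C_UniformSpace) Re exp).
  + destruct z; apply continuous_fst.
  + apply continuous_exp.
- apply (continuous_comp (U := C_UniformSpace) (fun w => phi - Im w) cos).
  + apply (continuous_minus (K := R_AbsRing) (V := R_NormedModule) (U := C_UniformSpace)).
    * apply continuous_const.
    * destruct z; apply continuous_snd.
  + apply continuous_cos.
Qed.

Lemma continuous_arg (z : UC) : @continuous C_UniformSpace R_UniformSpace arg z.
Proof. destruct z; apply continuous_snd. Qed.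

Lemma locally_gt (f : UC -> R) (x : R) (z : UC) :
  @continuous C_UniformSpace R_UniformSpace f z -> x < f z ->
  @locally C_UniformSpace z (fun w => x < f w).
Proof. intros Hf Hx; exact (Hf _ (open_gt x _ Hx)). Qed.

Lemma locally_lt (f : UC -> R) (x : R) (z : UC) :
  @continuous C_UniformSpace R_UniformSpace f z -> f z < x ->
  @locally C_UniformSpace z (fun w => f w < x).
Proof. intros Hf Hx; exact (Hf _ (open_lt x _ Hx)). Qed.

Lemma line_curve_height (phi a t : R) : 0 < a ->
  let z := line_curve phi a t in
  phi - PI / 2 < arg z < phi + PI / 2 /\ modulus z * cos (phi - arg z) = a.
Proof.
intros Ha z; unfold z; rewrite modulus_line_curve by assumption.
unfold arg, line_curve, Im; simpl snd.
split; [pose proof (atan_bound (t / a)); lra|].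
replace (phi - (phi - atan (t / a))) with (atan (t / a)) by ring.
apply sqrt_cos_atan; assumption.
Qed.

Lemma line_curveP (phi a : R) (z : UC) : 0 < a ->
  line phi a z <-> exists t, z = line_curve phi a t.
Proof.
intros Ha; split.
- intros [Hint Hext].
  destruct (Rlt_le_dec (modulus z * cos (phi - arg z)) a) as [Hlt|Hge].
  { exfalso; apply Hext.
    generalize (locally_lt _ a _ (continuous_height phi z) Hlt).
    apply filter_imp; intros w Hw Hh; apply half_planeE in Hh; lra. }
  destruct (Rlt_le_dec (phi + PI / 2) (arg z)) as [H1|H1].
  { exfalso; apply Hext.
    generalize (locally_gt _ (phi + PI / 2) _ (continuous_arg z) H1).
    apply filter_imp; intros w Hw Hh; apply half_planeE in Hh; lra. }
  destruct (Rlt_le_dec (arg z) (phi - PI / 2)) as [H2|H2].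
  { exfalso; apply Hext.
    generalize (locally_lt _ (phi - PI / 2) _ (continuous_arg z) H2).
    apply filter_imp; intros w Hw Hh; apply half_planeE in Hh; lra. }
  destruct (Req_dec (arg z) (phi + PI / 2)) as [E1|H1'].
  { exfalso; rewrite E1 in Hge.
    replace (phi - (phi + PI / 2)) with (- (PI / 2)) in Hge by ring.
    rewrite cos_neg, cos_PI2 in Hge; lra. }
  destruct (Req_dec (arg z) (phi - PI / 2)) as [E2|H2'].
  { exfalso; rewrite E2 in Hge.
    replace (phi - (phi - PI / 2)) with (PI / 2) in Hge by ring.
    rewrite cos_PI2 in Hge; lra. }
  destruct (Rle_lt_or_eq_dec _ _ Hge) as [Hgt|Heq].
  { exfalso; apply Hint.
    assert (G1 : phi - PI / 2 < arg z) by lra.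
    assert (G2 : arg z < phi + PI / 2) by lra.
    generalize (filter_and _ _ (locally_gt _ a _ (continuous_height phi z) Hgt)
      (filter_and _ _ (locally_gt _ _ _ (continuous_arg z) G1)
                      (locally_lt _ _ _ (continuous_arg z) G2))).
    apply filter_imp; intros w [Hw [Hw1 Hw2]]; apply half_planeE; lra. }
  set (u := phi - arg z) in *.
  assert (Hu : - (PI / 2) < u < PI / 2) by (unfold u; lra).
  assert (Hc : 0 < cos u) by (apply cos_gt_0; lra).
  exists (a * tan u).
  unfold line_curve.
  replace (a * tan u / a) with (tan u) by (field; lra).
  rewrite atan_tan by exact Hu.
  replace (a ^ 2 + (a * tan u) ^ 2) with ((modulus z) ^ 2).
  2:{ rewrite Heq; unfold tan.
      pose proof (sin2_cos2 u) as Hsc; unfold Rsqr in Hsc.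
      transitivity (modulus z ^ 2 * (sin u * sin u + cos u * cos u));
        [rewrite Hsc; ring | field; lra]. }
  assert (Hm : 0 < modulus z) by apply exp_pos.
  rewrite sqrt_pow2 by lra.
  unfold modulus; rewrite ln_exp.
  unfold u, arg; rewrite (surjective_pairing z) at 1; unfold Re, Im.
  f_equal; ring.
- intros [t ->]; destruct (line_curve_height phi a t Ha) as [Harg Hh].
  set (z := line_curve phi a t) in *; split.
  + intros [eps Heps].
    assert (He : 0 < eps) by apply cond_pos.
    set (w := (Re z - eps / 2, Im z) : UC).
    assert (Hw : half_plane phi a w).
    { apply Heps; split; simpl.
      - change (Rabs (Re z - eps / 2 - Re z) < eps).
        replace (Re z - eps / 2 - Re z) with (- (eps / 2)) by ring.
        rewrite Rabs_Ropp, Rabs_pos_eq; lra.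
      - apply ball_center. }
    apply half_planeE in Hw; destruct Hw as [_ Hw].
    assert (Hc : 0 < cos (phi - arg z)) by (apply cos_gt_0; lra).
    assert (modulus w < modulus z)
      by (unfold modulus, w; apply exp_increasing; simpl; lra).
    assert (modulus w * cos (phi - arg w) < modulus z * cos (phi - arg z))
      by (apply Rmult_lt_compat_r; assumption).
    lra.
  + intros Hl; apply locally_singleton in Hl; apply Hl, half_planeE; lra.
Qed.

(* Main.v *)
(* In the coordinate zeta = log z the domain H_I is convex, and so is simply
   connected; let L be a diagonal primitive of Lam.  Writing Y = exp(L) v turns
   the equation into dv = B v dz with B = exp(-L) R exp(L).  The j-th column of v
   is the sum of increments d_0 = e_j, d_(k+1) = int B d_k, where the integral of
   the i-th entry starts at the end at infinity of a line l_(phi,b) from which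
   exp(L_i - L_j) stays bounded: such an end exists by the L-condition.  On that
   line this makes exp(L_i - L_j) d_(k+1) smaller than exp(L_m - L_j) d_k by a
   factor O(|R|_1), so the sum converges as soon as b is large and differs from
   e_j by O(|R|_1), which is the asymptotics.  The choice of line is immaterial
   because a primitive of an integrand with bounded L1 norms has the same limit
   at the ends of all the lines (phi, b); hence each d_k is holomorphic.

   For uniqueness, two solutions differ by a constant matrix C on the right, and
   exp(L) C exp(-L) tends to 1 along every line; as Re (L_i - L_j) is bounded
   below towards one of the two ends, C = 1. *)

Require Import Defs.
From Stdlib Require Import Reals Factorial Lra Lia.
From Stdlib Require Import Classical ClassicalEpsilon FunctionalExtensionality.
From Coquelicot Require Import Coquelicot.
Open Scope R_scope.

(** * Complex derivatives and increments *)

(** The decay of R makes integrals small only along lines far from the origin, and this shapes the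
    proof. A point tending to infinity in H_(J,a) may stay on a line at distance a; so the lines are
    taken over a slightly wider interval of angles, where every point of large modulus lies on a far
    line. The increments d_k are small on far lines; elsewhere a bound 2^-k at one base point is
    carried along segments, because integrating a linear equation costs a locally bounded factor
    independent of k. The limits on two lines cannot be compared at a fixed parameter t, as nothing
    is known of integrals across the lines; averaging over t with weight 1/(1+t) turns the integral
    across into integrals along the intermediate lines. Each closed J yields a solution of its own,
    with its own far lines and constants; these solutions agree because uniqueness already holds
    with the asymptotics for a single angle. Invertibility comes from solving the adjoint equation
    dw = - w B dz too, started from the inverse of v at the base point. *)

Lemma Cmod_le_abs (z : C) : Cmod z <= Rabs (Re z) + Rabs (Im z).
Proof.
assert (E : z = Cplus (RtoC (Re z)) (Cmult Ci (RtoC (Im z)))).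
{ destruct z as [x y]; unfold Cplus, Cmult, RtoC, Ci, Re, Im; simpl; f_equal; ring. }
rewrite E at 1.
eapply Rle_trans; [apply Cmod_triangle|].
rewrite Cmod_mult, Cmod_Ci, !Cmod_R; lra.
Qed.

Lemma im_le_Cmod (z : C) : Rabs (Im z) <= Cmod z.
Proof. eapply Rle_trans; [apply Rmax_r|apply Rmax_Cmod]. Qed.

Lemma Re_minus (x y : C) : Re (x - y)%C = Re x - Re y.
Proof. reflexivity. Qed.

Lemma Im_minus (x y : C) : Im (x - y)%C = Im x - Im y.
Proof. reflexivity. Qed.

Lemma Rabs_Re_minus (x y : C) : Rabs (Re x - Re y) <= Cmod (x - y)%C.
Proof. rewrite <- Re_minus; apply re_le_Cmod. Qed.

Lemma Rabs_Im_minus (x y : C) : Rabs (Im x - Im y) <= Cmod (x - y)%C.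
Proof. rewrite <- Im_minus; apply im_le_Cmod. Qed.

Lemma Cmod_minus_le_abs (x y : C) :
  Cmod (x - y)%C <= Rabs (Re x - Re y) + Rabs (Im x - Im y).
Proof. rewrite <- Re_minus, <- Im_minus; apply Cmod_le_abs. Qed.

Lemma Cmod_sub_diag (x : C) : Cmod (x - x)%C = 0.
Proof. replace (x - x)%C with (RtoC 0) by ring; apply Cmod_0. Qed.

Lemma Cmod_sub_sym (x y : C) : Cmod (x - y)%C = Cmod (y - x)%C.
Proof. rewrite <- Cmod_opp; f_equal; ring. Qed.

Lemma Cmod_triangle_sub (x y z : C) :
  Cmod (x - z)%C <= Cmod (x - y)%C + Cmod (y - z)%C.
Proof.
replace (x - z)%C with ((x - y) + (y - z))%C by ring; apply Cmod_triangle.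
Qed.

Lemma RtoC_neq_0 (x : R) : x <> 0 -> RtoC x <> 0%C.
Proof. intros H E; apply H; exact (f_equal Re E). Qed.

Lemma Cmod_small_eq (x y : C) :
  (forall eps, 0 < eps -> Cmod (x - y)%C <= eps) -> x = y.
Proof.
intros H.
assert (E : (x - y)%C = 0%C).
{ apply Cmod_eq_0; apply Rle_antisym; [|apply Cmod_ge_0].
  apply le_epsilon; intros e He; rewrite Rplus_0_l; apply H, He. }
replace x with ((x - y) + y)%C by ring; rewrite E; ring.
Qed.

Definition Ccont (f : C -> C) (p : C) : Prop :=
  forall eps, 0 < eps -> exists d, 0 < d /\
  forall q, Cmod (q - p)%C < d -> Cmod (f q - f p)%C <= eps.

(** The derivative in the logarithmic coordinate of the cover: an identity df = l dz reads
    [Cder f p (l * proj p)]. *)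
Definition Cder (f : C -> C) (p l : C) : Prop :=
  forall eps, 0 < eps -> exists d, 0 < d /\
  forall q, Cmod (q - p)%C < d ->
    Cmod (f q - f p - l * (q - p))%C <= eps * Cmod (q - p)%C.

Lemma locally_C_AbsRing (p : C) (P : C -> Prop) :
  locally (T := AbsRing_UniformSpace C_AbsRing) p P <->
  exists d, 0 < d /\ forall q, Cmod (q - p)%C < d -> P q.
Proof.
split.
- intros [d Hd]; exists d; split; [apply cond_pos|]; intros q Hq; apply Hd; exact Hq.
- intros [d [Hd H]]; exists (mkposreal d Hd); intros q Hq; apply H; exact Hq.
Qed.

Lemma is_derive_Cder (f : C -> C) (p l : C) :
  @is_derive C_AbsRing C_NormedModule f p l <-> Cder f p l.
Proof.
split.
- intros [_ H] eps Heps.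
  specialize (H p (fun P HP => HP) (mkposreal eps Heps)).
  apply locally_C_AbsRing in H; destruct H as [d [Hd H]].
  exists d; split; trivial; intros q Hq; specialize (H q Hq).
  unfold minus, plus, opp, scal, norm in H; simpl in H.
  unfold mult, abs in H; simpl in H.
  replace (f q - f p - l * (q - p))%C with (f q + - f p + - ((q + - p) * l))%C by ring.
  exact H.
- intros H; split; [apply is_linear_scal_l|].
  intros x Hx eps.
  assert (E : p = x) by exact (is_filter_lim_locally_unique _ _ Hx).
  subst x.
  apply locally_C_AbsRing.
  destruct (H eps (cond_pos eps)) as [d [Hd H']].
  exists d; split; trivial; intros q Hq; specialize (H' q Hq).
  unfold minus, plus, opp, scal, norm; simpl.
  unfold mult, abs; simpl.
  replace (f q + - f p + - ((q + - p) * l))%C with (f q - f p - l * (q - p))%C by ring.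
  exact H'.
Qed.

Lemma Cder_cont f p l : Cder f p l -> Ccont f p.
Proof.
intros H eps Heps.
destruct (H 1 Rlt_0_1) as [d [Hd Hq]].
pose proof (Cmod_ge_0 l) as Hl.
exists (Rmin d (eps / (1 + Cmod l))); split.
{ apply Rmin_glb_lt; trivial; apply Rdiv_lt_0_compat; lra. }
intros q Hlt.
assert (H1 : Cmod (q - p)%C < d) by (eapply Rlt_le_trans; [apply Hlt|apply Rmin_l]).
assert (H2 : Cmod (q - p)%C < eps / (1 + Cmod l))
  by (eapply Rlt_le_trans; [apply Hlt|apply Rmin_r]).
specialize (Hq q H1).
replace (f q - f p)%C with ((f q - f p - l * (q - p)) + l * (q - p))%C by ring.
eapply Rle_trans; [apply Cmod_triangle|].
rewrite Cmod_mult.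
apply (Rmult_lt_compat_l (1 + Cmod l)) in H2; [|lra].
replace ((1 + Cmod l) * (eps / (1 + Cmod l))) with eps in H2 by (field; lra).
lra.
Qed.

Lemma Cder_const c p : Cder (fun _ => c) p 0%C.
Proof.
intros eps Heps; exists 1; split; [lra|]; intros q _.
replace (c - c - 0 * (q - p))%C with (RtoC 0) by ring.
rewrite Cmod_0; pose proof (Cmod_ge_0 (q - p)%C); nra.
Qed.

Lemma Cder_plus f g p l m :
  Cder f p l -> Cder g p m -> Cder (fun z => f z + g z)%C p (l + m)%C.
Proof.
intros Hf Hg eps Heps.
destruct (Hf (eps / 2)) as [d1 [Hd1 H1]]; [lra|].
destruct (Hg (eps / 2)) as [d2 [Hd2 H2]]; [lra|].
exists (Rmin d1 d2); split; [apply Rmin_glb_lt; trivial|].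
intros q Hq.
specialize (H1 q (Rlt_le_trans _ _ _ Hq (Rmin_l _ _))).
specialize (H2 q (Rlt_le_trans _ _ _ Hq (Rmin_r _ _))).
replace (f q + g q - (f p + g p) - (l + m) * (q - p))%C with
  ((f q - f p - l * (q - p)) + (g q - g p - m * (q - p)))%C by ring.
eapply Rle_trans; [apply Cmod_triangle|]; lra.
Qed.

(** The parameter enters only through its increment [inc]: with [q - p] this is the chain rule on C,
    with [RtoC (u - t)] the chain rule along a curve. *)
Lemma chain_increment {T : Type} (f : C -> C) (g inc : T -> C) (t : T) (l m : C) :
  Cder f (g t) l ->
  (forall eps, 0 < eps -> exists d, 0 < d /\ forall q, Cmod (inc q) < d ->
     Cmod (g q - g t - m * inc q)%C <= eps * Cmod (inc q)) ->
  forall eps, 0 < eps -> exists d, 0 < d /\ forall q, Cmod (inc q) < d ->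
    Cmod (f (g q) - f (g t) - l * m * inc q)%C <= eps * Cmod (inc q).
Proof.
intros Hf Hg eps Heps.
pose proof (Cmod_ge_0 l) as Hl; pose proof (Cmod_ge_0 m) as Hm.
set (e1 := eps / (2 * (1 + Cmod m))).
(* The cap 1 gives [|g q - g t| <= (1 + |m|) |inc q|], which brings [g q] into the disc of radius
   [d1]. *)
set (e2 := Rmin 1 (eps / (2 * (1 + Cmod l)))).
assert (He1 : 0 < e1) by (apply Rdiv_lt_0_compat; lra).
assert (He2 : 0 < e2)
  by (apply Rmin_glb_lt; [lra|apply Rdiv_lt_0_compat; lra]).
destruct (Hf e1 He1) as [d1 [Hd1 H1]].
destruct (Hg e2 He2) as [d2 [Hd2 H2]].
exists (Rmin d2 (d1 / (1 + Cmod m))); split.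
{ apply Rmin_glb_lt; trivial; apply Rdiv_lt_0_compat; lra. }
intros q Hq.
specialize (H2 q (Rlt_le_trans _ _ _ Hq (Rmin_l _ _))).
pose proof (Rlt_le_trans _ _ _ Hq (Rmin_r _ _)) as Hq1.
pose proof (Cmod_ge_0 (inc q)) as Hqp.
assert (Hgq : Cmod (g q - g t)%C <= (1 + Cmod m) * Cmod (inc q)).
{ replace (g q - g t)%C with ((g q - g t - m * inc q) + m * inc q)%C by ring.
  eapply Rle_trans; [apply Cmod_triangle|]; rewrite Cmod_mult.
  assert (e2 <= 1) by apply Rmin_l; nra. }
assert (Hlt : Cmod (g q - g t)%C < d1).
{ apply (Rmult_lt_compat_l (1 + Cmod m)) in Hq1; [|lra].
  replace ((1 + Cmod m) * (d1 / (1 + Cmod m))) with d1 in Hq1 by (field; lra); lra. }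
specialize (H1 (g q) Hlt).
replace (f (g q) - f (g t) - l * m * inc q)%C with
  ((f (g q) - f (g t) - l * (g q - g t)) + l * (g q - g t - m * inc q))%C by ring.
eapply Rle_trans; [apply Cmod_triangle|]; rewrite Cmod_mult.
assert (K1 : e1 * Cmod (g q - g t)%C <= eps / 2 * Cmod (inc q)).
{ eapply Rle_trans; [apply Rmult_le_compat_l; [lra|exact Hgq]|].
  unfold e1; apply Req_le; field; lra. }
assert (K2 : Cmod l * Cmod (g q - g t - m * inc q)%C <= eps / 2 * Cmod (inc q)).
{ eapply Rle_trans; [apply Rmult_le_compat_l; [lra|exact H2]|].
  assert (e2 <= eps / (2 * (1 + Cmod l))) by apply Rmin_r.
  assert (Cmod l * e2 <= eps / 2).
  { eapply Rle_trans; [apply Rmult_le_compat_l; [lra|eassumption]|].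
    apply (Rmult_le_reg_r (2 * (1 + Cmod l))); [lra|].
    replace (Cmod l * (eps / (2 * (1 + Cmod l))) * (2 * (1 + Cmod l)))
      with (Cmod l * eps) by (field; lra).
    nra. }
  nra. }
lra.
Qed.

Lemma Cder_comp f g p l m :
  Cder f (g p) l -> Cder g p m -> Cder (fun z => f (g z)) p (l * m)%C.
Proof. exact (chain_increment f g (fun q => q - p)%C p l m). Qed.

Lemma Cder_mulc c p : Cder (fun z => c * z)%C p c.
Proof.
intros eps Heps; exists 1; split; [lra|]; intros q _.
replace (c * q - c * p - c * (q - p))%C with (RtoC 0) by ring.
rewrite Cmod_0; pose proof (Cmod_ge_0 (q - p)%C); nra.
Qed.

Lemma Cder_scal c f p l : Cder f p l -> Cder (fun z => c * f z)%C p (c * l)%C.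
Proof. apply (Cder_comp (fun w => c * w)%C f), Cder_mulc. Qed.

Lemma Cder_eq f p l m : Cder f p l -> l = m -> Cder f p m.
Proof. intros H <-; exact H. Qed.

Lemma Cder_ext f g p l : (forall z, f z = g z) -> Cder f p l -> Cder g p l.
Proof.
intros E H; replace g with f; trivial; apply functional_extensionality, E.
Qed.

Lemma Cder_id p : Cder (fun z => z) p 1%C.
Proof. apply (Cder_ext (fun z => 1 * z)%C); [intros; ring|apply Cder_mulc]. Qed.

Lemma Cder_opp f p l : Cder f p l -> Cder (fun z => - f z)%C p (- l)%C.
Proof.
intros H; apply (Cder_ext (fun z => (- (1)) * f z)%C); [intros; ring|].
apply (Cder_eq _ _ ((- (1)) * l)%C); [apply Cder_scal, H|ring].
Qed.

Lemma Cder_minus f g p l m :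
  Cder f p l -> Cder g p m -> Cder (fun z => f z - g z)%C p (l - m)%C.
Proof. intros Hf Hg; apply Cder_plus; [|apply Cder_opp]; assumption. Qed.

Lemma Cder_sqr p : Cder (fun z => z * z)%C p (2 * p)%C.
Proof.
intros eps Heps; exists eps; split; trivial; intros q Hq.
replace (q * q - p * p - 2 * p * (q - p))%C with ((q - p) * (q - p))%C by ring.
rewrite Cmod_mult; pose proof (Cmod_ge_0 (q - p)%C); nra.
Qed.

(** Polarization, [f g = ((f + g)^2 - (f - g)^2) / 4], leaves only the derivative of the square and
    the chain rule. *)
Lemma Cder_mult f g p l m :
  Cder f p l -> Cder g p m ->
  Cder (fun z => f z * g z)%C p (l * g p + f p * m)%C.
Proof.
intros Hf Hg.
assert (H2 : RtoC 2 <> 0%C) by (apply RtoC_neq_0; lra).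
assert (H4 : RtoC 4 <> 0%C) by (apply RtoC_neq_0; lra).
apply (Cder_ext (fun z => / 4 * ((f z + g z) * (f z + g z) - (f z - g z) * (f z - g z)))%C).
{ intros z; field; exact H4. }
apply (Cder_eq _ _ (/ 4 * (2 * (f p + g p) * (l + m) - 2 * (f p - g p) * (l - m)))%C).
{ apply Cder_scal, Cder_minus.
  - apply (Cder_comp (fun z => z * z)%C); [apply Cder_sqr|apply Cder_plus; assumption].
  - apply (Cder_comp (fun z => z * z)%C); [apply Cder_sqr|apply Cder_minus; assumption]. }
field; exact H4.
Qed.

(** * Derivatives along a real parameter and mean value inequalities *)

Definition Rder (f : R -> C) (t : R) (l : C) : Prop :=
  is_derive (fun u => Re (f u)) t (Re l) /\ is_derive (fun u => Im (f u)) t (Im l).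

Lemma is_derive_eps (f : R -> R) (t l : R) :
  is_derive f t l <->
  forall eps, 0 < eps -> exists d, 0 < d /\ forall u, Rabs (u - t) < d ->
    Rabs (f u - f t - l * (u - t)) <= eps * Rabs (u - t).
Proof.
split.
- intros [_ H] eps Heps.
  specialize (H t (fun P HP => HP) (mkposreal eps Heps)).
  destruct H as [d H]; exists d; split; [apply cond_pos|].
  intros u Hu; specialize (H u Hu).
  unfold minus, plus, opp, scal, norm in H; simpl in H.
  unfold mult, abs in H; simpl in H.
  replace (f u - f t - l * (u - t)) with (f u + - f t + - ((u + - t) * l)) by ring.
  exact H.
- intros H; split; [apply is_linear_scal_l|].
  intros x Hx eps.
  assert (E : t = x) by exact (is_filter_lim_locally_unique _ _ Hx).
  subst x.
  destruct (H eps (cond_pos eps)) as [d [Hd H']].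
  exists (mkposreal d Hd); intros u Hu; specialize (H' u Hu).
  unfold minus, plus, opp, scal, norm; simpl.
  unfold mult, abs; simpl.
  replace (f u + - f t + - ((u + - t) * l)) with (f u - f t - l * (u - t)) by ring.
  exact H'.
Qed.

Lemma Rder_eps (f : R -> C) t l :
  Rder f t l <->
  forall eps, 0 < eps -> exists d, 0 < d /\ forall u, Rabs (u - t) < d ->
    Cmod (f u - f t - l * RtoC (u - t))%C <= eps * Rabs (u - t).
Proof.
assert (ERe : forall u, Re (f u - f t - l * RtoC (u - t))%C = Re (f u) - Re (f t) - Re l * (u - t)).
{ intros u; destruct (f u), (f t), l; unfold Re; simpl; ring. }
assert (EIm : forall u, Im (f u - f t - l * RtoC (u - t))%C = Im (f u) - Im (f t) - Im l * (u - t)).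
{ intros u; destruct (f u), (f t), l; unfold Im; simpl; ring. }
split.
- intros [H1 H2] eps Heps.
  apply is_derive_eps with (eps := eps / 2) in H1; [|lra].
  apply is_derive_eps with (eps := eps / 2) in H2; [|lra].
  destruct H1 as [d1 [Hd1 H1]]; destruct H2 as [d2 [Hd2 H2]].
  exists (Rmin d1 d2); split; [apply Rmin_glb_lt; trivial|].
  intros u Hu.
  specialize (H1 u (Rlt_le_trans _ _ _ Hu (Rmin_l _ _))).
  specialize (H2 u (Rlt_le_trans _ _ _ Hu (Rmin_r _ _))).
  eapply Rle_trans; [apply Cmod_le_abs|]; rewrite ERe, EIm; lra.
- intros H; split; apply is_derive_eps; intros eps Heps;
    destruct (H eps Heps) as [d [Hd H']]; exists d; split; trivial;
    intros u Hu; specialize (H' u Hu).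
  + rewrite <- ERe; eapply Rle_trans; [apply re_le_Cmod|exact H'].
  + rewrite <- EIm; eapply Rle_trans; [apply im_le_Cmod|exact H'].
Qed.

Lemma Rder_comp (G : C -> C) (f : R -> C) t l m :
  Cder G (f t) l -> Rder f t m -> Rder (fun u => G (f u)) t (l * m)%C.
Proof.
rewrite !Rder_eps; intros HG Hf eps Heps.
destruct (chain_increment G f (fun u => RtoC (u - t)) t l m HG) with (eps := eps) as [d [Hd H]]; trivial.
- intros e He; destruct (Hf e He) as [d [Hd H]]; exists d; split; trivial.
  intros u; rewrite Cmod_R; apply H.
- exists d; split; trivial; intros u; specialize (H u); rewrite Cmod_R in H; exact H.
Qed.

Lemma Rder_scal c f t l : Rder f t l -> Rder (fun u => c * f u)%C t (c * l)%C.
Proof. apply (Rder_comp (fun w => c * w)%C), Cder_mulc. Qed.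

Lemma Rder_plus f g t l m :
  Rder f t l -> Rder g t m -> Rder (fun u => f u + g u)%C t (l + m)%C.
Proof.
intros [H1 H2] [H3 H4]; split.
- apply (is_derive_ext (fun u => Re (f u) + Re (g u))); [intros; reflexivity|].
  apply (is_derive_plus (K := R_AbsRing) (V := R_NormedModule)); assumption.
- apply (is_derive_ext (fun u => Im (f u) + Im (g u))); [intros; reflexivity|].
  apply (is_derive_plus (K := R_AbsRing) (V := R_NormedModule)); assumption.
Qed.

Definition seg (p q : C) (t : R) : C := (p + RtoC t * (q - p))%C.

Lemma seg_0 p q : seg p q 0 = p.
Proof. unfold seg; ring. Qed.

Lemma seg_1 p q : seg p q 1 = q.
Proof. unfold seg; ring. Qed.

Lemma Rder_seg p q t : Rder (seg p q) t (q - p)%C.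
Proof.
split.
- apply (is_derive_ext (fun u => Re p + u * (Re q - Re p))).
  { intros u; unfold seg; destruct p, q; unfold Re; simpl; ring. }
  auto_derive; trivial; destruct p, q; unfold Re; simpl; ring.
- apply (is_derive_ext (fun u => Im p + u * (Im q - Im p))).
  { intros u; unfold seg; destruct p, q; unfold Im; simpl; ring. }
  auto_derive; trivial; destruct p, q; unfold Im; simpl; ring.
Qed.

Lemma real_increment_le (f b df db : R -> R) (s t : R) :
  s <= t ->
  (forall u, s <= u <= t -> is_derive f u (df u)) ->
  (forall u, s <= u <= t -> is_derive b u (db u)) ->
  (forall u, s <= u <= t -> df u <= db u) ->
  f t - f s <= b t - b s.
Proof.
intros Hst Hf Hb Hle.
destruct (MVT_gen (fun u => b u - f u) s t (fun u => db u - df u)) as [c [Hc E]].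
- intros x Hx; rewrite Rmin_left, Rmax_right in Hx by lra.
  apply (is_derive_minus (K := R_AbsRing) (V := R_NormedModule)); [apply Hb|apply Hf]; lra.
- intros x Hx; rewrite Rmin_left, Rmax_right in Hx by lra.
  apply derivable_continuous_pt; exists (db x - df x); apply is_derive_Reals.
  apply (is_derive_minus (K := R_AbsRing) (V := R_NormedModule)); [apply Hb|apply Hf]; lra.
- rewrite Rmin_left, Rmax_right in Hc by lra.
  specialize (Hle c Hc).
  assert (0 <= (db c - df c) * (t - s)) by (apply Rmult_le_pos; lra).
  lra.
Qed.

(** The mean value theorem is one for real functions; this rotation lets an estimate of [Re (c * f)]
    bound the modulus of an increment of f. *)
Lemma Cmod_projection (w : C) : exists c, Cmod c = 1 /\ Re (c * w)%C = Cmod w.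
Proof.
destruct (Req_dec (Cmod w) 0) as [E|E].
{ exists 1%C; rewrite Cmod_1; split; trivial.
  rewrite E, (Cmod_eq_0 w E); unfold Re; simpl; ring. }
pose proof (Cmod_ge_0 w) as Hw.
assert (Hn : RtoC (Cmod w) <> 0%C) by (apply RtoC_neq_0; lra).
exists (Cconj w / RtoC (Cmod w))%C; split.
- rewrite Cmod_div, Cmod_conj, Cmod_R, Rabs_pos_eq by trivial; field; lra.
- transitivity (Re (RtoC (Cmod w))); [f_equal|reflexivity].
  replace (Cconj w / RtoC (Cmod w) * w)%C with ((w * Cconj w) / RtoC (Cmod w))%C
    by (field; trivial).
  rewrite <- Cmod2_conj; simpl; unfold pow; simpl.
  rewrite !RtoC_mult; field; trivial.
Qed.

Lemma Re_scal_minus (c x y : C) : Re (c * (x - y))%C = Re (c * x)%C - Re (c * y)%C.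
Proof. destruct c, x, y; unfold Re; simpl; ring. Qed.

Lemma Re_scal_le (c z : C) : Cmod c = 1 -> Re (c * z)%C <= Cmod z.
Proof.
intros Hc; eapply Rle_trans; [apply Rle_abs|]; eapply Rle_trans; [apply re_le_Cmod|].
rewrite Cmod_mult, Hc; lra.
Qed.

Lemma increment_le (f df : R -> C) (b db : R -> R) (s t : R) :
  s <= t ->
  (forall u, s <= u <= t -> Rder f u (df u)) ->
  (forall u, s <= u <= t -> is_derive b u (db u)) ->
  (forall u, s <= u <= t -> Cmod (df u) <= db u) ->
  Cmod (f t - f s)%C <= b t - b s.
Proof.
intros Hst Hf Hb Hle.
destruct (Cmod_projection (f t - f s)%C) as [c [Hc <-]]; rewrite Re_scal_minus.
apply (real_increment_le (fun u => Re (c * f u)%C) b (fun u => Re (c * df u)%C) db); trivial.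
- intros u Hu; apply (Rder_scal c f u (df u) (Hf u Hu)).
- intros u Hu; eapply Rle_trans; [apply Re_scal_le, Hc|apply Hle, Hu].
Qed.

Lemma increment_le_const (f df : R -> C) (M : R) (s t : R) :
  s <= t ->
  (forall u, s <= u <= t -> Rder f u (df u)) ->
  (forall u, s <= u <= t -> Cmod (df u) <= M) ->
  Cmod (f t - f s)%C <= M * (t - s).
Proof.
intros Hst Hf Hle.
replace (M * (t - s)) with (M * t - M * s) by ring.
apply (increment_le f df (fun u => M * u) (fun _ => M)); trivial.
intros u _; auto_derive; trivial; ring.
Qed.

Lemma segment_increment_le (G g : C -> C) (c : C) (M : R) (p q : C) :
  (forall u, 0 <= u <= 1 -> Cder G (seg p q u) (g (seg p q u))) ->
  (forall u, 0 <= u <= 1 -> Cmod (g (seg p q u) - c)%C <= M) ->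
  Cmod (G q - G p - c * (q - p))%C <= M * Cmod (q - p)%C.
Proof.
intros HG HM.
pose proof (increment_le_const
  (fun u => G (seg p q u) + (- c) * seg p q u)%C
  (fun u => g (seg p q u) * (q - p) + (- c) * (q - p))%C (M * Cmod (q - p)%C) 0 1) as H.
cbv beta in H; rewrite !seg_0, !seg_1 in H.
replace (G q - G p - c * (q - p))%C with (G q + - c * q - (G p + - c * p))%C by ring.
replace (M * Cmod (q - p)%C) with (M * Cmod (q - p)%C * (1 - 0)) by ring.
apply H; [lra| |].
- intros u Hu; apply Rder_plus.
  + apply Rder_comp; [apply HG, Hu|apply Rder_seg].
  + apply Rder_scal, Rder_seg.
- intros u Hu.
  replace (g (seg p q u) * (q - p) + - c * (q - p))%C with ((g (seg p q u) - c) * (q - p))%C by ring.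
  rewrite Cmod_mult; apply Rmult_le_compat_r; [apply Cmod_ge_0|apply HM, Hu].
Qed.

(** * The covering map as the complex exponential *)

Lemma Rder_proj (f : R -> C) t l : Rder f t l -> Rder (fun u => proj (f u)) t (proj (f t) * l)%C.
Proof.
intros [H1 H2].
pose (x := fun u => Re (f u)); pose (y := fun u => Im (f u)).
change (is_derive x t (Re l)) in H1; change (is_derive y t (Im l)) in H2.
split.
- change (is_derive (fun u => exp (x u) * cos (y u)) t (Re (proj (f t) * l)%C)).
  auto_derive.
  + split; [eexists; apply H1|split; [eexists; apply H2|trivial]].
  + replace (Derive (fun x0 : R => x x0) t) with (Re l) by (symmetry; apply is_derive_unique, H1).
    replace (Derive (fun x0 : R => y x0) t) with (Im l) by (symmetry; apply is_derive_unique, H2).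
    unfold x, y, proj, modulus, arg, Re, Im; simpl; ring.
- change (is_derive (fun u => exp (x u) * sin (y u)) t (Im (proj (f t) * l)%C)).
  auto_derive.
  + split; [eexists; apply H1|split; [eexists; apply H2|trivial]].
  + replace (Derive (fun x0 : R => x x0) t) with (Re l) by (symmetry; apply is_derive_unique, H1).
    replace (Derive (fun x0 : R => y x0) t) with (Im l) by (symmetry; apply is_derive_unique, H2).
    unfold x, y, proj, modulus, arg, Re, Im; simpl; ring.
Qed.

Lemma proj_plus (z w : C) : proj (z + w)%C = (proj z * proj w)%C.
Proof.
unfold proj, modulus, arg, Re, Im; simpl.
rewrite exp_plus, cos_plus, sin_plus; unfold Cmult; simpl; f_equal; ring.
Qed.

Lemma proj_0 : proj 0%C = 1%C.
Proof.
unfold proj, modulus, arg, Re, Im; simpl; rewrite exp_0, cos_0, sin_0.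
unfold RtoC; f_equal; ring.
Qed.

Lemma proj_opp_l (z : C) : (proj (- z) * proj z)%C = 1%C.
Proof. rewrite <- proj_plus; replace (- z + z)%C with (RtoC 0) by ring; apply proj_0. Qed.

Lemma Cmod_proj (z : C) : Cmod (proj z) = exp (Re z).
Proof.
unfold Cmod, proj, modulus, arg; simpl.
replace (_ + _) with ((exp (Re z)) ^ 2 * ((sin (Im z))² + (cos (Im z))²)) by (unfold Rsqr; ring).
rewrite sin2_cos2, Rmult_1_r; apply sqrt_pow2, Rlt_le, exp_pos.
Qed.

Lemma proj_neq_0 (z : C) : proj z <> 0%C.
Proof.
intros E; pose proof (Cmod_proj z) as H; rewrite E, Cmod_0 in H.
pose proof (exp_pos (Re z)); lra.
Qed.

Lemma proj_cont_0 (eps : R) : 0 < eps ->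
  exists d, 0 < d /\ forall h, Cmod h < d -> Cmod (proj h - 1)%C <= eps.
Proof.
intros Heps.
(* A radius of at most 1 keeps the real part below 1 on the segment from 0 to h, so that [proj] has
   modulus at most [exp 1] there. *)
exists (Rmin 1 (eps / exp 1)); split.
{ apply Rmin_glb_lt; [lra|apply Rdiv_lt_0_compat; [lra|apply exp_pos]]. }
intros h Hh.
pose proof (Rlt_le_trans _ _ _ Hh (Rmin_l _ _)) as H1.
pose proof (Rlt_le_trans _ _ _ Hh (Rmin_r _ _)) as H2.
pose proof (increment_le_const (fun u => proj (seg 0 h u)) (fun u => proj (seg 0 h u) * (h - 0))%C
  (exp 1 * Cmod h) 0 1) as H.
cbv beta in H; rewrite seg_0, seg_1, proj_0 in H.
eapply Rle_trans; [apply H; [lra| |]|].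
- intros u _; apply Rder_proj, Rder_seg.
- intros u Hu; rewrite Cmod_mult, Cmod_proj.
  replace (h - 0)%C with h by ring.
  apply Rmult_le_compat_r; [apply Cmod_ge_0|].
  assert (E : Re (seg 0 h u) <= 1).
  { eapply Rle_trans; [apply Rle_abs|]; eapply Rle_trans; [apply re_le_Cmod|].
    unfold seg; replace (0 + RtoC u * (h - 0))%C with (RtoC u * h)%C by ring.
    rewrite Cmod_mult, Cmod_R, Rabs_pos_eq by lra.
    pose proof (Cmod_ge_0 h); nra. }
  destruct E as [E|E]; [apply Rlt_le, exp_increasing, E|rewrite E; lra].
- apply (Rmult_lt_compat_l (exp 1)) in H2; [|apply exp_pos].
  replace (exp 1 * (eps / exp 1)) with eps in H2 by (field; apply Rgt_not_eq, exp_pos).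
  lra.
Qed.

(** By the addition formula only the derivative at 0 matters; there [proj h - 1 - h] is the
    increment along the segment from 0 to h of [proj z - z], whose derivative [proj z - 1] is
    small. *)
Lemma Cder_proj (p : C) : Cder proj p (proj p).
Proof.
intros eps Heps.
pose proof (exp_pos (Re p)) as Hp.
destruct (proj_cont_0 (eps / exp (Re p))) as [d [Hd H]]; [apply Rdiv_lt_0_compat; lra|].
exists d; split; trivial; intros q Hq.
set (h := (q - p)%C) in *.
replace q with (p + h)%C by (unfold h; ring).
pose proof (increment_le_const
  (fun u => proj (seg 0 h u) + (- (1)) * seg 0 h u)%C
  (fun u => proj (seg 0 h u) * (h - 0) + (- (1)) * (h - 0))%C (eps / exp (Re p) * Cmod h) 0 1) as K.
cbv beta in K; rewrite !seg_0, !seg_1, proj_0 in K.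
replace (proj (p + h) - proj p - proj p * h)%C with
  (proj p * (proj h + - (1) * h - (1 + - (1) * 0)))%C by (rewrite proj_plus; ring).
rewrite Cmod_mult, Cmod_proj.
replace (eps * Cmod h) with (exp (Re p) * (eps / exp (Re p) * Cmod h * (1 - 0))) by (field; lra).
apply Rmult_le_compat_l; [lra|]; apply K; [lra| |].
- intros u _; apply Rder_plus; [apply Rder_proj|apply Rder_scal]; apply Rder_seg.
- intros u Hu.
  replace (proj (seg 0 h u) * (h - 0) + - (1) * (h - 0))%C with ((proj (seg 0 h u) - 1) * h)%C by ring.
  rewrite Cmod_mult; apply Rmult_le_compat_r; [apply Cmod_ge_0|].
  apply H; unfold seg; replace (0 + RtoC u * (h - 0))%C with (RtoC u * h)%C by ring.
  rewrite Cmod_mult, Cmod_R, Rabs_pos_eq by lra.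
  pose proof (Cmod_ge_0 h); nra.
Qed.

(** * Goursat's theorem and primitives on star-shaped domains *)

Lemma choice_on {T A : Type} (a : A) (P : T -> Prop) (Q : T -> A -> Prop) :
  (forall t, P t -> exists x, Q t x) -> exists f, forall t, P t -> Q t (f t).
Proof.
intros H.
assert (H' : forall t, exists x, P t -> Q t x).
{ intros t; destruct (classic (P t)) as [Ht|Ht].
  - destruct (H t Ht) as [x Hx]; exists x; trivial.
  - exists a; tauto. }
exists (fun t => proj1_sig (constructive_indefinite_description _ (H' t))).
intros t; exact (proj2_sig (constructive_indefinite_description _ (H' t))).
Qed.

Lemma dependent_choice_indexed {A : Type} (P : nat -> A -> Prop) (Q : nat -> A -> A -> Prop) (a0 : A) :
  P 0%nat a0 ->
  (forall k a, P k a -> exists b, P (S k) b /\ Q k a b) ->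
  exists f : nat -> A, f 0%nat = a0 /\ forall k, P k (f k) /\ Q k (f k) (f (S k)).
Proof.
intros H0 HS.
pose (next := fun k (a : {a | P k a}) =>
  constructive_indefinite_description _ (HS k (proj1_sig a) (proj2_sig a))).
pose (F := fix F k : {a | P k a} :=
  match k with
  | O => exist _ a0 H0
  | S k => exist _ (proj1_sig (next k (F k))) (proj1 (proj2_sig (next k (F k))))
  end).
exists (fun k => proj1_sig (F k)); split; [reflexivity|].
intros k; split; [apply proj2_sig|].
exact (proj2 (proj2_sig (next k (F k)))).
Qed.

Lemma half_pow_pos k : 0 < (/ 2) ^ k.
Proof. apply pow_lt; lra. Qed.

Lemma half_pow_small (C eps : R) : 0 < eps -> exists k, C * (/ 2) ^ k < eps.
Proof.
intros Heps.
destruct (pow_lt_1_zero (/ 2) ltac:(rewrite Rabs_pos_eq; lra) (eps / (1 + Rabs C))) as [k Hk].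
{ apply Rdiv_lt_0_compat; [lra|pose proof (Rabs_pos C); lra]. }
exists k; specialize (Hk k (Nat.le_refl k)).
rewrite Rabs_pos_eq in Hk by (apply Rlt_le, half_pow_pos).
pose proof (Rabs_pos C); pose proof (half_pow_pos k).
apply (Rmult_lt_compat_l (1 + Rabs C)) in Hk; [|lra].
replace ((1 + Rabs C) * (eps / (1 + Rabs C))) with eps in Hk by (field; lra).
pose proof (Rle_abs C); nra.
Qed.

Lemma geometric_limit (s : nat -> R) (C : R) :
  (forall k, Rabs (s (S k) - s k) <= C * (/ 2) ^ k) ->
  exists l, forall k, Rabs (s k - l) <= 2 * C * (/ 2) ^ k.
Proof.
intros H.
(* Keeping the exact geometric sum, with its subtracted term, is what lets the induction on m
   close. *)
assert (HC : forall k m, Rabs (s (k + m)%nat - s k) <= 2 * C * ((/ 2) ^ k - (/ 2) ^ (k + m))).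
{ intros k m; induction m as [|m IH].
  - rewrite Nat.add_0_r; rewrite !Rminus_diag, Rabs_R0; lra.
  - rewrite Nat.add_succ_r; specialize (H (k + m)%nat).
    replace (s (S (k + m)) - s k) with ((s (S (k + m)) - s (k + m)%nat) + (s (k + m)%nat - s k)) by ring.
    eapply Rle_trans; [apply Rabs_triang|]; simpl; lra. }
assert (C0 : 0 <= C).
{ specialize (H 0%nat); simpl in H; pose proof (Rabs_pos (s 1%nat - s 0%nat)); lra. }
destruct (Rcomplete.R_complete s) as [l Hl].
{ intros eps Heps.
  destruct (half_pow_small (4 * C) eps Heps) as [k Hk].
  exists k; intros n m Hn Hm.
  replace n with (k + (n - k))%nat by lia; replace m with (k + (m - k))%nat by lia.
  pose proof (HC k (n - k)%nat) as H1; pose proof (HC k (m - k)%nat) as H2.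
  pose proof (half_pow_pos (k + (n - k))); pose proof (half_pow_pos (k + (m - k))).
  unfold Rdist.
  replace (s (k + (n - k))%nat - s (k + (m - k))%nat) with
    ((s (k + (n - k))%nat - s k) - (s (k + (m - k))%nat - s k)) by ring.
  eapply Rle_lt_trans; [apply Rabs_triang|]; rewrite Rabs_Ropp; nra. }
exists l; intros k; apply le_epsilon; intros e He.
destruct (Hl e He) as [n0 Hn0].
specialize (Hn0 (k + n0)%nat ltac:(lia)); unfold Rdist in Hn0.
specialize (HC k n0); pose proof (half_pow_pos (k + n0)).
replace (s k - l) with ((s (k + n0)%nat - l) - (s (k + n0)%nat - s k)) by ring.
eapply Rle_trans; [apply Rabs_triang|]; rewrite Rabs_Ropp; nra.
Qed.

Lemma geometric_limit_C (s : nat -> C) (C : R) :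
  (forall k, Cmod (s (S k) - s k)%C <= C * (/ 2) ^ k) ->
  exists l, forall k, Cmod (s k - l)%C <= 4 * C * (/ 2) ^ k.
Proof.
intros H.
destruct (geometric_limit (fun k => Re (s k)) C) as [x Hx].
{ intros k; eapply Rle_trans; [apply Rabs_Re_minus|apply H]. }
destruct (geometric_limit (fun k => Im (s k)) C) as [y Hy].
{ intros k; eapply Rle_trans; [apply Rabs_Im_minus|apply H]. }
exists (x, y); intros k; specialize (Hx k); specialize (Hy k).
eapply Rle_trans; [apply Cmod_minus_le_abs|]; simpl; lra.
Qed.

Definition clamp (t : R) : R := Rmax 0 (Rmin 1 t).

Lemma clamp_range t : 0 <= clamp t <= 1.
Proof. unfold clamp, Rmax, Rmin; repeat destruct Rle_dec; lra. Qed.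

Lemma clamp_id t : 0 <= t <= 1 -> clamp t = t.
Proof. unfold clamp, Rmax, Rmin; repeat destruct Rle_dec; lra. Qed.

Lemma clamp_lipschitz s t : Rabs (clamp s - clamp t) <= Rabs (s - t).
Proof. unfold clamp, Rmax, Rmin; repeat destruct Rle_dec; split_Rabs; lra. Qed.

Definition CInt (f : R -> C) (a b : R) : C :=
  (RInt (fun t => Re (f t)) a b, RInt (fun t => Im (f t)) a b).

(* The parameter is clamped to make the integrand continuous on the whole real line. *)
Definition segint (g : C -> C) (p q : C) : C :=
  CInt (fun t => (g (seg p q (clamp t)) * (q - p))%C) 0 1.

Lemma Rder_CInt (f : R -> C) (a t : R) :
  (forall t, continuous (fun u => Re (f u)) t) ->
  (forall t, continuous (fun u => Im (f u)) t) ->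
  Rder (fun u => CInt f a u) t (f t).
Proof.
intros H1 H2; split.
- apply (is_derive_RInt (fun u => Re (f u)) (fun u => RInt (fun t => Re (f t)) a u) a t); [|apply H1].
  exists (mkposreal 1 Rlt_0_1); intros y _; apply (RInt_correct (V := R_CompleteNormedModule)), (ex_RInt_continuous (V := R_CompleteNormedModule)).
  intros z _; apply H1.
- apply (is_derive_RInt (fun u => Im (f u)) (fun u => RInt (fun t => Im (f t)) a u) a t); [|apply H2].
  exists (mkposreal 1 Rlt_0_1); intros y _; apply (RInt_correct (V := R_CompleteNormedModule)), (ex_RInt_continuous (V := R_CompleteNormedModule)).
  intros z _; apply H2.
Qed.

Lemma continuous_R_eps (f : R -> R) (t : R) :
  (forall eps, 0 < eps -> exists d, 0 < d /\ forall u, Rabs (u - t) < d -> Rabs (f u - f t) <= eps) ->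
  continuous f t.
Proof.
intros H P [e He].
destruct (H (e / 2)) as [d [Hd H']]; [pose proof (cond_pos e); lra|].
exists (mkposreal d Hd); intros u Hu; apply He.
specialize (H' u Hu).
change (Rabs (f u - f t) < e); pose proof (cond_pos e); lra.
Qed.

Section SegmentIntegral.
Variables (g : C -> C) (p q : C).
Hypothesis Hg : forall u, 0 <= u <= 1 -> Ccont g (seg p q u).

Lemma clamped_integrand_cont (t eps : R) : 0 < eps ->
  exists d, 0 < d /\ forall u, Rabs (u - t) < d ->
  Cmod (g (seg p q (clamp u)) * (q - p) - g (seg p q (clamp t)) * (q - p))%C <= eps.
Proof.
intros Heps.
pose proof (Cmod_ge_0 (q - p)%C) as Hm.
destruct (Hg (clamp t) (clamp_range t) (eps / (1 + Cmod (q - p)%C))) as [d [Hd H]].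
{ apply Rdiv_lt_0_compat; lra. }
exists (d / (1 + Cmod (q - p)%C)); split; [apply Rdiv_lt_0_compat; lra|].
intros u Hu.
replace (g (seg p q (clamp u)) * (q - p) - g (seg p q (clamp t)) * (q - p))%C with
  ((g (seg p q (clamp u)) - g (seg p q (clamp t))) * (q - p))%C by ring.
rewrite Cmod_mult.
assert (K : Cmod (g (seg p q (clamp u)) - g (seg p q (clamp t)))%C <= eps / (1 + Cmod (q - p)%C)).
{ apply H; unfold seg.
  replace (p + RtoC (clamp u) * (q - p) - (p + RtoC (clamp t) * (q - p)))%C with
    (RtoC (clamp u - clamp t) * (q - p))%C by (rewrite RtoC_minus; ring).
  rewrite Cmod_mult, Cmod_R.
  apply (Rmult_lt_compat_r (1 + Cmod (q - p)%C)) in Hu; [|lra].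
  replace (d / (1 + Cmod (q - p)%C) * (1 + Cmod (q - p)%C)) with d in Hu by (field; lra).
  pose proof (clamp_lipschitz u t); pose proof (Rabs_pos (u - t)); nra. }
eapply Rle_trans; [apply Rmult_le_compat_r; [lra|exact K]|].
replace eps with (eps / (1 + Cmod (q - p)%C) * (1 + Cmod (q - p)%C)) at 2 by (field; lra).
apply Rmult_le_compat_l; [|lra].
apply Rlt_le, Rdiv_lt_0_compat; lra.
Qed.

(** It presents the integral as an increment, so that estimates of segment integrals become mean
    value inequalities. *)
Lemma segint_primitive_exists : exists K : R -> C,
  segint g p q = (K 1 - K 0)%C /\
  forall u, 0 <= u <= 1 -> Rder K u (g (seg p q u) * (q - p))%C.
Proof.
exists (fun u => CInt (fun t => (g (seg p q (clamp t)) * (q - p))%C) 0 u); split.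
- unfold segint, CInt at 3; rewrite !RInt_point.
  unfold zero; simpl; destruct (CInt _ 0 1); unfold Cminus, Cplus, Copp; simpl; f_equal; ring.
- intros u Hu.
  replace (g (seg p q u)) with (g (seg p q (clamp u))) by (rewrite clamp_id; trivial).
  apply (Rder_CInt (fun t => (g (seg p q (clamp t)) * (q - p))%C)); clear u Hu; intros t;
    apply continuous_R_eps; intros eps Heps;
    destruct (clamped_integrand_cont t eps Heps) as [d [Hd H]]; exists d; split; trivial;
    intros u Hu; (eapply Rle_trans; [|apply (H u Hu)]); [apply Rabs_Re_minus|apply Rabs_Im_minus].
Qed.

(** Comparison with a function that has a primitive: the affine approximation of g in Goursat's
    estimate, and the constant [g p] when [Prim] is differentiated. *)
Lemma segint_approx (H h : C -> C) (M : R) :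
  (forall z, Cder H z (h z)) ->
  (forall u, 0 <= u <= 1 -> Cmod (g (seg p q u) - h (seg p q u))%C <= M) ->
  Cmod (segint g p q - (H q - H p))%C <= M * Cmod (q - p)%C.
Proof.
intros HH HM.
destruct segint_primitive_exists as [K [-> HK]].
pose proof (increment_le_const (fun u => K u + (- (1)) * H (seg p q u))%C
  (fun u => g (seg p q u) * (q - p) + (- (1)) * (h (seg p q u) * (q - p)))%C
  (M * Cmod (q - p)%C) 0 1) as E.
cbv beta in E; rewrite seg_0, seg_1 in E.
replace (K 1 - K 0 - (H q - H p))%C with (K 1 + - (1) * H q - (K 0 + - (1) * H p))%C by ring.
replace (M * Cmod (q - p)%C) with (M * Cmod (q - p)%C * (1 - 0)) by ring.
apply E; [lra| |].
- intros u Hu; apply Rder_plus; [apply HK, Hu|].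
  apply Rder_scal, Rder_comp; [apply HH|apply Rder_seg].
- intros u Hu.
  replace (_ + _)%C with ((g (seg p q u) - h (seg p q u)) * (q - p))%C by ring.
  rewrite Cmod_mult; apply Rmult_le_compat_r; [apply Cmod_ge_0|apply HM, Hu].
Qed.

Lemma segint_unique (K : R -> C) :
  (forall u, 0 <= u <= 1 -> Rder K u (g (seg p q u) * (q - p))%C) ->
  segint g p q = (K 1 - K 0)%C.
Proof.
intros HK.
destruct segint_primitive_exists as [K' [-> HK']].
pose proof (increment_le_const (fun u => K' u + (- (1)) * K u)%C
  (fun u => g (seg p q u) * (q - p) + (- (1)) * (g (seg p q u) * (q - p)))%C 0 0 1) as E.
cbv beta in E.
assert (E' : Cmod (K' 1 + - (1) * K 1 - (K' 0 + - (1) * K 0))%C <= 0 * (1 - 0)).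
{ apply E; [lra| |].
  - intros u Hu; apply Rder_plus; [apply HK', Hu|apply Rder_scal, HK, Hu].
  - intros u Hu; right.
    replace (_ + _)%C with (RtoC 0) by ring; apply Cmod_0. }
apply Cmod_small_eq; intros eps Heps.
replace (K' 1 - K' 0 - (K 1 - K 0))%C with (K' 1 + - (1) * K 1 - (K' 0 + - (1) * K 0))%C by ring.
lra.
Qed.

End SegmentIntegral.

Lemma seg_seg p q s t u :
  seg (seg p q s) (seg p q t) u = seg p q (s + u * (t - s)).
Proof. unfold seg; rewrite RtoC_plus, RtoC_mult, RtoC_minus; ring. Qed.

Lemma segint_sub (g : C -> C) (p q : C) (K : R -> C) (s t : R) :
  (forall u, 0 <= u <= 1 -> Ccont g (seg p q u)) ->
  (forall u, 0 <= u <= 1 -> Rder K u (g (seg p q u) * (q - p))%C) ->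
  0 <= s <= 1 -> 0 <= t <= 1 ->
  segint g (seg p q s) (seg p q t) = (K t - K s)%C.
Proof.
intros Hc HK Hs Ht.
assert (Hr : forall u, 0 <= u <= 1 -> 0 <= s + u * (t - s) <= 1) by (intros u Hu; nra).
rewrite (segint_unique g (seg p q s) (seg p q t)) with (K := fun u => K (s + u * (t - s))).
- f_equal; [|f_equal]; f_equal; ring.
- intros u Hu; rewrite seg_seg; apply Hc, Hr, Hu.
- intros u Hu; rewrite seg_seg.
  assert (Hl : is_derive (fun u => s + u * (t - s)) u (t - s)) by (auto_derive; trivial; ring).
  destruct (HK _ (Hr u Hu)) as [H1 H2].
  set (l := (g (seg p q (s + u * (t - s))) * (q - p))%C) in *.
  assert (E : (g (seg p q (s + u * (t - s))) * (seg p q t - seg p q s))%C = (RtoC (t - s) * l)%C).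
  { unfold l, seg; rewrite RtoC_minus; ring. }
  rewrite E; split.
  + replace (Re (RtoC (t - s) * l)%C) with ((t - s) * Re l) by (destruct l; unfold Re; simpl; ring).
    apply (is_derive_comp (K := R_AbsRing) (fun v => Re (K v)) (fun u => s + u * (t - s)) u _ _ H1 Hl).
  + replace (Im (RtoC (t - s) * l)%C) with ((t - s) * Im l) by (destruct l; unfold Im; simpl; ring).
    apply (is_derive_comp (K := R_AbsRing) (fun v => Im (K v)) (fun u => s + u * (t - s)) u _ _ H2 Hl).
Qed.

Lemma segint_rev (g : C -> C) (p q : C) :
  (forall u, 0 <= u <= 1 -> Ccont g (seg p q u)) ->
  segint g q p = (- segint g p q)%C.
Proof.
intros Hc; destruct (segint_primitive_exists g p q Hc) as [K [E HK]].
rewrite E.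
pose proof (segint_sub g p q K 1 0 Hc HK ltac:(lra) ltac:(lra)) as H.
rewrite seg_0, seg_1 in H; rewrite H; ring.
Qed.

Lemma segint_split (g : C -> C) (p q : C) :
  (forall u, 0 <= u <= 1 -> Ccont g (seg p q u)) ->
  segint g p q = (segint g p (seg p q (/ 2)) + segint g (seg p q (/ 2)) q)%C.
Proof.
intros Hc; destruct (segint_primitive_exists g p q Hc) as [K [E HK]].
rewrite E.
pose proof (segint_sub g p q K 0 (/ 2) Hc HK ltac:(lra) ltac:(lra)) as H1.
pose proof (segint_sub g p q K (/ 2) 1 Hc HK ltac:(lra) ltac:(lra)) as H2.
rewrite seg_0 in H1; rewrite seg_1 in H2; rewrite H1, H2; ring.
Qed.

Section Goursat.
Variables (g : C -> C) (p u v : C).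

(** Affine coordinates on the triangle with vertices p, p + u, p + v, which may be degenerate. *)
Definition tri_pt (s t : R) : C := (p + RtoC s * u + RtoC t * v)%C.
Definition in_simplex (s t : R) : Prop := 0 <= s /\ 0 <= t /\ s + t <= 1.

Hypothesis Hg : forall s t, in_simplex s t -> exists l, Cder g (tri_pt s t) l.

Lemma seg_tri_pt s t s' t' r :
  seg (tri_pt s t) (tri_pt s' t') r = tri_pt (s + r * (s' - s)) (t + r * (t' - t)).
Proof. unfold seg, tri_pt; rewrite !RtoC_plus, !RtoC_mult, !RtoC_minus; ring. Qed.

Lemma simplex_seg_cont s t s' t' : in_simplex s t -> in_simplex s' t' ->
  forall r, 0 <= r <= 1 -> Ccont g (seg (tri_pt s t) (tri_pt s' t') r).
Proof.
intros [H1 [H2 H3]] [H4 [H5 H6]] r Hr; rewrite seg_tri_pt.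
destruct (Hg (s + r * (s' - s)) (t + r * (t' - t))) as [l Hl].
- split; [nra|split; nra].
- apply (Cder_cont _ _ _ Hl).
Qed.

(* The triangle with vertices [tri_pt s t], [tri_pt (s + h) t], [tri_pt s (t + h)] is
   encoded by [(s, t, h)].  Joining the midpoints cuts it into four triangles homothetic
   to it, the middle one with the negative ratio [- 1 / 2]. *)
Definition tri_int (x : R * R * R) : C :=
  let '(s, t, h) := x in
  (segint g (tri_pt s t) (tri_pt (s + h) t)
   + segint g (tri_pt (s + h) t) (tri_pt s (t + h))
   + segint g (tri_pt s (t + h)) (tri_pt s t))%C.

Definition tri_in (x : R * R * R) : Prop :=
  let '(s, t, h) := x in in_simplex s t /\ in_simplex (s + h) t /\ in_simplex s (t + h).

Definition subtriangle (s t h : R) (i : nat) : R * R * R :=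
  match i with
  | O => (s, t, h / 2)
  | S O => (s + h / 2, t, h / 2)
  | S (S O) => (s, t + h / 2, h / 2)
  | _ => (s + h / 2, t + h / 2, - (h / 2))
  end.

Lemma tri_in_sub s t h i : tri_in (s, t, h) -> tri_in (subtriangle s t h i).
Proof.
intros [H1 [H2 H3]]; unfold in_simplex in *.
destruct i as [|[|[|i]]]; simpl; unfold in_simplex; lra.
Qed.

Lemma tri_int_sub s t h : tri_in (s, t, h) ->
  tri_int (s, t, h) =
  (tri_int (subtriangle s t h 0) + tri_int (subtriangle s t h 1)
   + tri_int (subtriangle s t h 2) + tri_int (subtriangle s t h 3))%C.
Proof.
intros [H1 [H2 H3]].
assert (D : in_simplex (s + h / 2) t) by (unfold in_simplex in *; lra).
assert (E : in_simplex (s + h / 2) (t + h / 2)) by (unfold in_simplex in *; lra).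
assert (F : in_simplex s (t + h / 2)) by (unfold in_simplex in *; lra).
unfold tri_int, subtriangle.
rewrite (segint_split g (tri_pt s t) (tri_pt (s + h) t)) by (apply simplex_seg_cont; trivial).
rewrite (segint_split g (tri_pt (s + h) t) (tri_pt s (t + h))) by (apply simplex_seg_cont; trivial).
rewrite (segint_split g (tri_pt s (t + h)) (tri_pt s t)) by (apply simplex_seg_cont; trivial).
rewrite !seg_tri_pt.
replace (s + / 2 * (s + h - s)) with (s + h / 2) by field.
replace (t + / 2 * (t - t)) with t by field.
replace (s + h + / 2 * (s - (s + h))) with (s + h / 2) by field.
replace (t + / 2 * (t + h - t)) with (t + h / 2) by field.
replace (s + / 2 * (s - s)) with s by field.
replace (t + h + / 2 * (t - (t + h))) with (t + h / 2) by field.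
replace (s + h / 2 + h / 2) with (s + h) by field.
replace (t + h / 2 + h / 2) with (t + h) by field.
replace (s + h / 2 + - (h / 2)) with s by field.
replace (t + h / 2 + - (h / 2)) with t by field.
(* The three inner sides are traversed once in each direction and cancel. *)
rewrite (segint_rev g (tri_pt (s + h / 2) t) (tri_pt s (t + h / 2))) by (apply simplex_seg_cont; trivial).
rewrite (segint_rev g (tri_pt (s + h / 2) t) (tri_pt (s + h / 2) (t + h / 2))) by (apply simplex_seg_cont; trivial).
rewrite (segint_rev g (tri_pt s (t + h / 2)) (tri_pt (s + h / 2) (t + h / 2))) by (apply simplex_seg_cont; trivial).
ring.
Qed.

Lemma tri_large_sub s t h (eta : R) : tri_in (s, t, h) -> eta <= Cmod (tri_int (s, t, h)) ->
  exists i, eta / 4 <= Cmod (tri_int (subtriangle s t h i)).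
Proof.
intros Hin Heta; apply NNPP; intros Hn.
assert (K : forall i, Cmod (tri_int (subtriangle s t h i)) < eta / 4).
{ intros i; apply Rnot_le_lt; intros Hi; apply Hn; exists i; exact Hi. }
rewrite (tri_int_sub s t h Hin) in Heta.
pose proof (Cmod_triangle (tri_int (subtriangle s t h 0) + tri_int (subtriangle s t h 1)
   + tri_int (subtriangle s t h 2)) (tri_int (subtriangle s t h 3))).
pose proof (Cmod_triangle (tri_int (subtriangle s t h 0) + tri_int (subtriangle s t h 1))
   (tri_int (subtriangle s t h 2))).
pose proof (Cmod_triangle (tri_int (subtriangle s t h 0)) (tri_int (subtriangle s t h 1))).
pose proof (K 0%nat); pose proof (K 1%nat); pose proof (K 2%nat); pose proof (K 3%nat).
lra.
Qed.

Let W : R := Cmod u + Cmod v.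

Lemma tri_pt_dist s t s' t' r :
  Rabs (s - s') <= r -> Rabs (t - t') <= r -> Cmod (tri_pt s t - tri_pt s' t')%C <= r * W.
Proof.
intros H1 H2; unfold tri_pt.
replace (_ - _)%C with (RtoC (s - s') * u + RtoC (t - t') * v)%C by (rewrite !RtoC_minus; ring).
eapply Rle_trans; [apply Cmod_triangle|]; rewrite !Cmod_mult, !Cmod_R.
pose proof (Cmod_ge_0 u); pose proof (Cmod_ge_0 v); unfold W; nra.
Qed.

(** Up to [eps |z - z0|], g is affine near z0, and an affine function has a primitive. The 18 counts
    3 sides, times 3 for the distance to z0, times 2 for the length of a side, the last two in units
    of [|h| W]. *)
Lemma tri_int_small s t h s0 t0 l d eps :
  tri_in (s, t, h) -> 0 <= eps ->
  (forall q, Cmod (q - tri_pt s0 t0)%C < d ->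
    Cmod (g q - g (tri_pt s0 t0) - l * (q - tri_pt s0 t0))%C <= eps * Cmod (q - tri_pt s0 t0)%C) ->
  Rabs (s - s0) <= 2 * Rabs h -> Rabs (t - t0) <= 2 * Rabs h -> 3 * Rabs h * W < d ->
  Cmod (tri_int (s, t, h)) <= 18 * eps * W ^ 2 * Rabs h ^ 2.
Proof.
intros [H1 [H2 H3]] Heps Hl Hs Ht Hd.
set (z0 := tri_pt s0 t0) in *.
pose proof (Rabs_pos h) as Hh.
assert (HW : 0 <= W) by (unfold W; pose proof (Cmod_ge_0 u); pose proof (Cmod_ge_0 v); lra).
(* A primitive of the affine approximation [g z0 + l * (z - z0)]. *)
set (H := fun z : C => ((g z0 - l * z0) * z + l * / 2 * (z * z))%C).
assert (HH : forall z, Cder H z (g z0 + l * (z - z0))%C).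
{ intros z; apply (Cder_eq _ _ ((g z0 - l * z0) * 1 + l * / 2 * (2 * z))%C).
  - apply Cder_plus.
    + apply Cder_scal, Cder_id.
    + apply Cder_scal, Cder_sqr.
  - field; apply RtoC_neq_0; lra. }
assert (Side : forall a b a' b', in_simplex a b -> in_simplex a' b' ->
  Rabs (a - s) <= Rabs h -> Rabs (b - t) <= Rabs h ->
  Rabs (a' - s) <= Rabs h -> Rabs (b' - t) <= Rabs h ->
  Cmod (segint g (tri_pt a b) (tri_pt a' b') - (H (tri_pt a' b') - H (tri_pt a b)))%C
   <= eps * (3 * Rabs h * W) * (2 * Rabs h * W)).
{ intros a b a' b' Hab Hab' K1 K2 K3 K4.
  eapply Rle_trans.
  - apply (segint_approx g _ _ (simplex_seg_cont a b a' b' Hab Hab') H _ (eps * (3 * Rabs h * W)) HH).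
    intros r Hr; rewrite seg_tri_pt.
    set (z := tri_pt _ _).
    assert (Hz : Cmod (z - z0)%C <= 3 * Rabs h * W).
    { apply tri_pt_dist.
      - replace (a + r * (a' - a) - s0) with ((1 - r) * (a - s) + r * (a' - s) + (s - s0)) by ring.
        clear - K1 K3 Hs Hr; split_Rabs; nra.
      - replace (b + r * (b' - b) - t0) with ((1 - r) * (b - t) + r * (b' - t) + (t - t0)) by ring.
        clear - K2 K4 Ht Hr; split_Rabs; nra. }
    specialize (Hl z (Rle_lt_trans _ _ _ Hz Hd)).
    replace (g z - (g z0 + l * (z - z0)))%C with (g z - g z0 - l * (z - z0))%C by ring.
    eapply Rle_trans; [exact Hl|]; apply Rmult_le_compat_l; trivial.
  - apply Rmult_le_compat_l.
    + apply Rmult_le_pos; trivial; apply Rmult_le_pos; lra.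
    + apply tri_pt_dist; clear - K1 K2 K3 K4; split_Rabs; lra. }
unfold tri_int.
set (A := tri_pt s t); set (B := tri_pt (s + h) t); set (D := tri_pt s (t + h)).
replace (segint g A B + segint g B D + segint g D A)%C with
  ((segint g A B - (H B - H A)) + (segint g B D - (H D - H B)) + (segint g D A - (H A - H D)))%C by ring.
assert (z1 : Rabs (s - s) <= Rabs h) by (rewrite Rminus_diag, Rabs_R0; lra).
assert (z2 : Rabs (t - t) <= Rabs h) by (rewrite Rminus_diag, Rabs_R0; lra).
assert (z3 : Rabs (s + h - s) <= Rabs h) by (right; f_equal; ring).
assert (z4 : Rabs (t + h - t) <= Rabs h) by (right; f_equal; ring).
pose proof (Side s t (s + h) t H1 H2 z1 z2 z3 z2).
pose proof (Side (s + h) t s (t + h) H2 H3 z3 z2 z1 z4).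
pose proof (Side s (t + h) s t H3 H1 z1 z4 z1 z2).
eapply Rle_trans; [apply Cmod_triangle|].
eapply Rle_trans; [apply Rplus_le_compat_r, Cmod_triangle|].
fold A B D in H0, H4, H5; lra.
Qed.

(** Repeated quartering keeps an integral of size at least [eta 4^-k] on a triangle of scale 2^-k,
    whereas differentiability at the limit point makes such integrals o(4^-k). *)
Lemma goursat : tri_int (0, 0, 1) = 0%C.
Proof.
apply NNPP; intros Hne.
set (eta := Cmod (tri_int (0, 0, 1))).
assert (Heta : 0 < eta) by (apply Cmod_gt_0; exact Hne).
destruct (dependent_choice_indexed
  (fun k (x : R * R * R) => tri_in x /\ Rabs (snd x) = (/ 2) ^ k /\
     eta * ((/ 2) ^ k) ^ 2 <= Cmod (tri_int x))
  (fun k x y => Rabs (fst (fst y) - fst (fst x)) <= 1 * (/ 2) ^ k /\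
     Rabs (snd (fst y) - snd (fst x)) <= 1 * (/ 2) ^ k) (0, 0, 1)) as [f [_ Hf]].
- split; [|split].
  + unfold tri_in, in_simplex; lra.
  + simpl; rewrite Rabs_R1; reflexivity.
  + unfold eta; simpl pow; lra.
- intros k [[s t] h] [Hin [Hh Hbig]]; simpl in Hh.
  destruct (tri_large_sub s t h _ Hin Hbig) as [i Hi].
  exists (subtriangle s t h i); split; [split; [|split]|].
  + apply tri_in_sub, Hin.
  + simpl pow; rewrite <- Hh.
    destruct i as [|[|[|i]]]; simpl; clear; split_Rabs; lra.
  + eapply Rle_trans; [|exact Hi]; simpl; right; field.
  + rewrite Rmult_1_l, <- Hh.
    destruct i as [|[|[|i]]]; simpl; clear; split_Rabs; lra.
- destruct (geometric_limit (fun k => fst (fst (f k))) 1) as [s0 Hs]; [intros k; apply (Hf k)|].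
  destruct (geometric_limit (fun k => snd (fst (f k))) 1) as [t0 Ht]; [intros k; apply (Hf k)|].
  assert (Hin : in_simplex s0 t0).
  { assert (Hk : forall k, in_simplex (fst (fst (f k))) (snd (fst (f k)))).
    { intros k; destruct (Hf k) as [[Hin _] _].
      destruct (f k) as [[s t] h]; apply Hin. }
    repeat split; apply le_epsilon; intros e He;
      destruct (half_pow_small 4 e He) as [k Hk'];
      specialize (Hs k); specialize (Ht k); destruct (Hk k) as [K1 [K2 K3]];
      apply Rabs_le_between in Hs; apply Rabs_le_between in Ht; lra. }
  destruct (Hg s0 t0 Hin) as [l Hl].
  assert (HW : 0 <= W) by (unfold W; pose proof (Cmod_ge_0 u); pose proof (Cmod_ge_0 v); lra).
  (* 36 is twice the constant of [tri_int_small]: the upper bound becomes at most half of what the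
     subdivision keeps. *)
  set (eps := eta / (36 * (1 + W ^ 2))).
  assert (HW2 : 0 <= W ^ 2) by apply pow2_ge_0.
  assert (Heps : 0 < eps) by (apply Rdiv_lt_0_compat; lra).
  destruct (Hl eps Heps) as [d [Hd Hq]].
  destruct (half_pow_small (3 * W) d Hd) as [k Hk].
  specialize (Hs k); specialize (Ht k).
  destruct (Hf k) as [[Hink [Hhk Hbig]] _].
  destruct (f k) as [[s t] h]; simpl fst in *; simpl snd in *.
  pose proof (tri_int_small s t h s0 t0 l d eps Hink (Rlt_le _ _ Heps) Hq) as E.
  rewrite Hhk in E.
  assert (E' := E ltac:(lra) ltac:(lra) ltac:(lra)).
  pose proof (pow_lt _ 2 (half_pow_pos k)) as Hp.
  assert (K : eta <= 18 * eps * W ^ 2).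
  { apply (Rmult_le_reg_r (((/ 2) ^ k) ^ 2)); trivial; lra. }
  assert (K' : 36 * eps * (1 + W ^ 2) = eta) by (unfold eps; field; lra).
  nra.
Qed.

End Goursat.

Definition copen (V : C -> Prop) : Prop :=
  forall p, V p -> exists r, 0 < r /\ forall q, Cmod (q - p)%C < r -> V q.

Definition star_shaped (V : C -> Prop) (p0 : C) : Prop :=
  forall p s, V p -> 0 <= s <= 1 -> V (seg p0 p s).

Lemma Cmod_seg_lt (c p q : C) (r s : R) :
  0 <= s <= 1 -> Cmod (p - c)%C < r -> Cmod (q - c)%C < r -> Cmod (seg p q s - c)%C < r.
Proof.
intros Hs Hp Hq; unfold seg.
replace (p + RtoC s * (q - p) - c)%C with (RtoC (1 - s) * (p - c) + RtoC s * (q - c))%C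
  by (rewrite RtoC_minus; ring).
eapply Rle_lt_trans; [apply Cmod_triangle|]; rewrite !Cmod_mult, !Cmod_R, !Rabs_pos_eq by lra.
destruct (Req_dec s 0) as [->|Hs0]; [lra|nra].
Qed.

Definition Prim (g : C -> C) (p0 p : C) : C := segint g p0 p.

Lemma Cder_Prim (V : C -> Prop) (p0 : C) (g : C -> C) :
  copen V -> star_shaped V p0 ->
  (forall p, V p -> exists l, Cder g p l) ->
  forall p, V p -> Cder (Prim g p0) p (g p).
Proof.
intros Ho Hst Hg p Hp eps Heps.
assert (Hc : forall z, V z -> Ccont g z).
{ intros z Hz; destruct (Hg z Hz) as [l Hl]; apply (Cder_cont _ _ _ Hl). }
destruct (Ho p Hp) as [r [Hr HV]].
destruct (Hc p Hp eps Heps) as [d [Hd Hcp]].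
exists (Rmin r d); split; [apply Rmin_glb_lt; trivial|].
intros q Hq.
pose proof (Rlt_le_trans _ _ _ Hq (Rmin_l _ _)) as Hq1.
pose proof (Rlt_le_trans _ _ _ Hq (Rmin_r _ _)) as Hq2.
assert (Hpp : forall e, 0 < e -> Cmod (p - p)%C < e).
{ intros e He; rewrite Cmod_sub_diag; exact He. }
assert (Hpq : forall s, 0 <= s <= 1 -> V (seg p q s)).
{ intros s Hs; apply HV, Cmod_seg_lt; trivial; apply Hpp, Hr. }
assert (V0q : forall s, 0 <= s <= 1 -> V (seg p0 q s)).
{ intros s Hs; apply Hst; trivial; apply HV, Hq1. }
assert (T : tri_int g p0 (p - p0)%C (q - p0)%C (0, 0, 1) = 0%C).
{ apply goursat; intros s t [Hs [Ht Hst']].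
  apply Hg; unfold tri_pt.
  (* A point of the triangle lies at ratio [s + t] on the segment from [p0] to a point of [p, q],
     which is in V as part of a disc; [s + t = 0] is the apex [p0]. *)
  destruct (Req_dec (s + t) 0) as [E|E].
  - assert (s = 0) by lra; assert (t = 0) by lra; subst s t.
    replace (p0 + RtoC 0 * (p - p0) + RtoC 0 * (q - p0))%C with (seg p0 p 0) by (unfold seg; ring).
    apply Hst; trivial; lra.
  - replace (p0 + RtoC s * (p - p0) + RtoC t * (q - p0))%C with (seg p0 (seg p q (t / (s + t))) (s + t)).
    + apply Hst; [|lra]; apply Hpq; split.
      * apply Rdiv_le_0_compat; lra.
      * apply (Rmult_le_reg_r (s + t)); [lra|]; field_simplify; lra.
    + unfold seg; rewrite RtoC_div, !RtoC_plus by trivial; field.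
      rewrite <- RtoC_plus; apply RtoC_neq_0, E. }
unfold tri_int, tri_pt in T.
replace (p0 + RtoC 0 * (p - p0) + RtoC 0 * (q - p0))%C with p0 in T by ring.
replace (p0 + RtoC (0 + 1) * (p - p0) + RtoC 0 * (q - p0))%C with p in T by (rewrite Rplus_0_l; ring).
replace (p0 + RtoC 0 * (p - p0) + RtoC (0 + 1) * (q - p0))%C with q in T by (rewrite Rplus_0_l; ring).
rewrite (segint_rev g p0 q) in T by (intros s Hs; apply Hc, V0q, Hs).
unfold Prim.
replace (segint g p0 q - segint g p0 p - g p * (q - p))%C with
  (segint g p q - (g p * q - g p * p))%C.
2:{ replace (segint g p q) with (segint g p0 q - segint g p0 p +
      (segint g p0 p + segint g p q + - segint g p0 q))%C by ring.
    rewrite T; ring. }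
apply (segint_approx g p q ltac:(intros s Hs; apply Hc, Hpq, Hs) (fun z => g p * z)%C (fun _ => g p)).
- intros z; apply Cder_mulc.
- intros s Hs; apply Hcp, Cmod_seg_lt; trivial; apply Hpp, Hd.
Qed.

Lemma Prim_base (g : C -> C) (p0 : C) : Prim g p0 p0 = 0%C.
Proof.
unfold Prim, segint, CInt.
rewrite (RInt_ext _ (fun _ => 0)), (RInt_ext (fun t => Im _) (fun _ => 0)).
- rewrite !RInt_const; unfold scal; simpl; unfold mult; simpl.
  unfold RtoC; f_equal; ring.
- intros x _; replace (p0 - p0)%C with (RtoC 0) by ring; unfold Im; simpl; ring.
- intros x _; replace (p0 - p0)%C with (RtoC 0) by ring; unfold Re; simpl; ring.
Qed.

(** * Geometry of the half-planes *)

(** Concavity of [ln (cos x)]: its derivative [- tan x] decreases, so the graph stays below its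
    tangents. *)
Lemma ln_cos_tangent (v w : R) :
  - (PI / 2) < v < PI / 2 -> - (PI / 2) < w < PI / 2 ->
  ln (cos v) <= ln (cos w) - tan w * (v - w).
Proof.
intros Hv Hw.
assert (D : forall x, Rmin w v <= x <= Rmax w v -> - (PI / 2) < x < PI / 2).
{ intros x; unfold Rmin, Rmax; repeat destruct Rle_dec; lra. }
assert (Der : forall x, Rmin w v <= x <= Rmax w v ->
  is_derive (fun x => ln (cos x)) x (- tan x)).
{ intros x Hx; specialize (D x Hx).
  assert (0 < cos x) by (apply cos_gt_0; lra).
  auto_derive; trivial; unfold tan; field; lra. }
destruct (MVT_gen (fun x => ln (cos x)) w v (fun x => - tan x)) as [c [Hc E]].
- intros x Hx; apply Der; lra.
- intros x Hx; apply derivable_continuous_pt; exists (- tan x); apply is_derive_Reals, Der, Hx.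
- cut (- tan c * (v - w) <= - tan w * (v - w)); [lra|].
  pose proof (D c Hc) as Hc'.
  destruct (Rle_dec w v) as [Hwv|Hwv].
  + rewrite Rmin_left, Rmax_right in Hc by lra.
    assert (tan w <= tan c); [|nra].
    destruct (Req_dec w c) as [->|]; [lra|apply Rlt_le, tan_increasing; lra].
  + rewrite Rmin_right, Rmax_left in Hc by lra.
    assert (tan c <= tan w); [|nra].
    destruct (Req_dec w c) as [->|]; [lra|apply Rlt_le, tan_increasing; lra].
Qed.

Lemma height_ln (phi a : R) (z : C) : 0 < a ->
  half_plane phi a z <->
  phi - PI / 2 < arg z < phi + PI / 2 /\ ln a <= Re z + ln (cos (phi - arg z)).
Proof.
intros Ha; rewrite half_planeE; split; intros [H1 H2]; split; trivial;
  assert (Hc : 0 < cos (phi - arg z)) by (apply cos_gt_0; lra); unfold modulus in *.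
- rewrite <- (ln_exp (Re z)), <- ln_mult by (trivial; apply exp_pos).
  destruct H2 as [H2|H2]; [apply Rlt_le, ln_increasing; trivial|rewrite H2; lra].
- rewrite <- (exp_ln a Ha), <- (exp_ln _ Hc), <- exp_plus.
  destruct H2 as [H2|H2]; [apply Rlt_le, exp_increasing; trivial|rewrite H2; lra].
Qed.

Lemma convex_comb_lt (x y m s : R) : 0 <= s <= 1 -> x < m -> y < m -> x + s * (y - x) < m.
Proof.
intros Hs Hx Hy; destruct (Req_dec s 0) as [->|H]; [lra|].
assert (0 < s * (m - y)) by (apply Rmult_lt_0_compat; lra).
assert (0 <= (1 - s) * (m - x)) by (apply Rmult_le_pos; lra).
lra.
Qed.

Lemma convex_comb_gt (x y m s : R) : 0 <= s <= 1 -> m < x -> m < y -> m < x + s * (y - x).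
Proof.
intros Hs Hx Hy; pose proof (convex_comb_lt (- x) (- y) (- m) s Hs); lra.
Qed.

(* In the logarithmic coordinate the union of half-planes is the projection of
   the set [ln a <= x + ln (cos (phi - theta))], which is convex in (x, theta, phi). *)
Lemma half_planes_convex (I : R -> Prop) (a : R) (p q : C) (s : R) :
  (forall x y z, I x -> I y -> x <= z <= y -> I z) -> 0 < a ->
  half_planes I a p -> half_planes I a q -> 0 <= s <= 1 -> half_planes I a (seg p q s).
Proof.
intros HI Ha [f1 [Hf1 H1]] [f2 [Hf2 H2]] Hs.
rewrite height_ln in H1, H2 by trivial; destruct H1 as [A1 B1]; destruct H2 as [A2 B2].
exists (f1 + s * (f2 - f1)); split.
- destruct (Rle_dec f1 f2); [apply (HI f1 f2)|apply (HI f2 f1)]; trivial; split; nra.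
- rewrite height_ln by trivial.
  assert (E : arg (seg p q s) = arg p + s * (arg q - arg p))
    by (unfold arg, seg, Im; simpl; ring).
  assert (E' : Re (seg p q s) = Re p + s * (Re q - Re p))
    by (unfold seg, Re; simpl; ring).
  rewrite E, E'.
  assert (W1 : f1 - arg p + s * ((f2 - arg q) - (f1 - arg p)) < PI / 2) by (apply convex_comb_lt; lra).
  assert (W2 : - (PI / 2) < f1 - arg p + s * ((f2 - arg q) - (f1 - arg p))) by (apply convex_comb_gt; lra).
  split; [split; lra|].
  replace (f1 + s * (f2 - f1) - (arg p + s * (arg q - arg p)))
    with (f1 - arg p + s * ((f2 - arg q) - (f1 - arg p))) by ring.
  set (w := f1 - arg p + s * ((f2 - arg q) - (f1 - arg p))) in *.
  pose proof (ln_cos_tangent (f1 - arg p) w ltac:(lra) ltac:(lra)) as T1.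
  pose proof (ln_cos_tangent (f2 - arg q) w ltac:(lra) ltac:(lra)) as T2.
  (* Both tangent inequalities are taken at the barycentre w, so that the linear terms cancel in
     their weighted mean. *)
  assert (T : (1 - s) * ln (cos (f1 - arg p)) + s * ln (cos (f2 - arg q)) <= ln (cos w)).
  { replace (ln (cos w)) with ((1 - s) * (ln (cos w) - tan w * (f1 - arg p - w))
      + s * (ln (cos w) - tan w * (f2 - arg q - w))) by (unfold w; ring).
    apply Rplus_le_compat; apply Rmult_le_compat_l; lra. }
  nra.
Qed.

(** * Open neighbourhoods and uniformity along segments *)

Lemma copen_open (U : C -> Prop) : @open C_UniformSpace U <-> copen U.
Proof.
split; intros H p Hp.
- destruct (H p Hp) as [e He]; exists e; split; [apply cond_pos|].
  intros q Hq; apply He, C_NormedModule_mixin_compat1; exact Hq.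
- destruct (H p Hp) as [r [Hr He]].
  (* The balls of the uniform structure on C are squares; [sqrt 2] compares them with discs. *)
  assert (Hs : 0 < sqrt 2) by (apply sqrt_lt_R0; lra).
  assert (Hr' : 0 < r / sqrt 2) by (apply Rdiv_lt_0_compat; lra).
  exists (mkposreal _ Hr'); intros q Hq; apply He.
  apply C_NormedModule_mixin_compat2 in Hq; simpl in Hq.
  replace (sqrt 2 * (r / sqrt 2)) with r in Hq by (field; lra).
  exact Hq.
Qed.

Definition holo (V : C -> Prop) (f : C -> C) : Prop :=
  forall p, V p -> exists l, Cder f p l.

(** Since [proj] has no zero, the derivative with respect to z and the one in the logarithmic
    coordinate exist at the same points. *)
Lemma holomorphic_onE (S : C -> Prop) (f : C -> C) :
  holomorphic_on S f <->
  exists U, copen U /\ (forall p, S p -> U p) /\ holo U f.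
Proof.
split; intros [U [H1 [H2 H3]]]; exists U; (split; [apply copen_open, H1|split; trivial]);
  intros p Hp; destruct (H3 p Hp) as [l Hl].
- exists (l * proj p)%C; apply is_derive_Cder, Hl.
- exists (l / proj p)%C; apply is_derive_Cder.
  replace (l / proj p * proj p)%C with l by (field; apply proj_neq_0); exact Hl.
Qed.

(** Every entry of the coefficient matrices is holomorphic on a neighbourhood of its own; a finite
    intersection serves them all. *)
Lemma common_neighbourhood (S : C -> Prop) (F : nat -> (C -> Prop) -> Prop) (n : nat) :
  (forall i (U U' : C -> Prop), (forall p, U' p -> U p) -> F i U -> F i U') ->
  (forall i, (i < n)%nat -> exists U, copen U /\ (forall p, S p -> U p) /\ F i U) ->
  exists U, copen U /\ (forall p, S p -> U p) /\ forall i, (i < n)%nat -> F i U.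
Proof.
intros Hmon; induction n as [|n IH]; intros H.
- exists (fun _ => True); split; [|split; trivial; lia].
  intros p _; exists 1; split; trivial; lra.
- destruct IH as [U [O1 [S1 F1]]]; [intros i Hi; apply H; lia|].
  destruct (H n ltac:(lia)) as [U' [O2 [S2 F2]]].
  exists (fun p => U p /\ U' p); split; [|split].
  + intros p [Hp Hp'].
    destruct (O1 p Hp) as [r [Hr K]]; destruct (O2 p Hp') as [r' [Hr' K']].
    exists (Rmin r r'); split; [apply Rmin_glb_lt; trivial|].
    intros q Hq; split; [apply K|apply K']; (eapply Rlt_le_trans; [exact Hq|]);
      [apply Rmin_l|apply Rmin_r].
  + intros p Hp; auto.
  + intros i Hi; destruct (Nat.eq_dec i n) as [->|].
    * apply (Hmon n U'); [intros p []; trivial|exact F2].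
    * apply (Hmon i U); [intros p []; trivial|apply F1; lia].
Qed.

(** The tube lemma for [0, 1] and the point p, by the supremum argument for the compactness of
    [0, 1]. The parameter M lets one statement produce both open neighbourhoods, where M is a dummy,
    and uniform bounds. *)
Lemma tube (Q : R -> C -> R -> Prop) (p : C) :
  (forall s q M M', M <= M' -> Q s q M -> Q s q M') ->
  (forall s, 0 <= s <= 1 -> exists d M, 0 < d /\
    forall s' q, 0 <= s' <= 1 -> Rabs (s' - s) < d -> Cmod (q - p)%C < d -> Q s' q M) ->
  exists d M, 0 < d /\ forall s q, 0 <= s <= 1 -> Cmod (q - p)%C < d -> Q s q M.
Proof.
intros Hmon Hloc.
set (E := fun x => 0 <= x <= 1 /\ exists d M, 0 < d /\
  forall s q, 0 <= s <= x -> Cmod (q - p)%C < d -> Q s q M).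
assert (E0 : E 0).
{ split; [lra|]; destruct (Hloc 0) as [d [M [Hd H]]]; [lra|].
  exists d, M; split; trivial; intros s q Hs Hq; apply H; trivial; [lra|].
  replace (s - 0) with 0 by lra; rewrite Rabs_R0; exact Hd. }
destruct (completeness E) as [m [Hub Hlub]].
- exists 1; intros x [Hx _]; lra.
- exists 0; exact E0.
- assert (Hm : 0 <= m <= 1).
  { split; [apply Hub, E0|apply Hlub; intros x [Hx _]; lra]. }
  destruct (Hloc m Hm) as [d [M [Hd H]]].
  assert (Hx : exists x, E x /\ m - d < x).
  { apply NNPP; intros Hn.
    assert (m <= m - d); [|lra].
    apply Hlub; intros x Hx; apply Rnot_lt_le; intros Hlt; apply Hn; exists x; auto. }
  destruct Hx as [x [[Hx01 [d' [M' [Hd' H']]]] Hx]].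
  assert (Hy : forall y, 0 <= y <= 1 -> y < m + d -> E y).
  { intros y Hy01 Hy; split; trivial.
    exists (Rmin d d'), (Rmax M M'); split; [apply Rmin_glb_lt; trivial|].
    intros s q Hs Hq.
    destruct (Rle_dec s x) as [Hsx|Hsx].
    - apply (Hmon s q M'); [apply Rmax_r|apply H'; [lra|]].
      eapply Rlt_le_trans; [exact Hq|apply Rmin_r].
    - apply (Hmon s q M); [apply Rmax_l|apply H; [lra| |]].
      + apply Rabs_lt_between; lra.
      + eapply Rlt_le_trans; [exact Hq|apply Rmin_l]. }
  assert (E1 : E 1).
  { destruct (Rlt_dec 1 (m + d)) as [H1|H1]; [apply Hy; lra|].
    assert (E (m + d / 2)) by (apply Hy; lra).
    pose proof (Hub _ H0); lra. }
  destruct E1 as [_ K]; exact K.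
Qed.

Lemma seg_joint_dist p0 p q s s' :
  0 <= s' <= 1 ->
  Cmod (seg p0 q s' - seg p0 p s)%C <= Cmod (q - p)%C + Rabs (s' - s) * Cmod (p - p0)%C.
Proof.
intros Hs'; unfold seg.
replace (_ - _)%C with (RtoC s' * (q - p) + RtoC (s' - s) * (p - p0))%C
  by (rewrite RtoC_minus; ring).
eapply Rle_trans; [apply Cmod_triangle|]; rewrite !Cmod_mult, !Cmod_R.
rewrite (Rabs_pos_eq s') by lra.
pose proof (Cmod_ge_0 (q - p)%C); nra.
Qed.

Lemma seg_joint_cont p0 p s r : 0 < r -> exists d, 0 < d /\
  forall s' q, 0 <= s' <= 1 -> Rabs (s' - s) < d -> Cmod (q - p)%C < d ->
  Cmod (seg p0 q s' - seg p0 p s)%C < r.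
Proof.
intros Hr; pose proof (Cmod_ge_0 (p - p0)%C) as Hm.
exists (r / (1 + Cmod (p - p0)%C)); split; [apply Rdiv_lt_0_compat; lra|].
intros s' q Hs' Hs Hq.
eapply Rle_lt_trans; [apply seg_joint_dist, Hs'|].
set (d := r / (1 + Cmod (p - p0)%C)) in *.
assert (E : r = d + d * Cmod (p - p0)%C) by (unfold d; field; lra).
rewrite E; apply Rplus_lt_le_compat; trivial.
apply Rmult_le_compat_r; lra.
Qed.

(** The half-planes are not open and the neighbourhood U is arbitrary, while primitives are built on
    open star-shaped sets. The points whose whole segment from p0 lies in U form such a set, open by
    the tube lemma. *)
Lemma star_core (U S : C -> Prop) (p0 : C) :
  copen U -> (forall p, S p -> U p) ->
  (forall p s, S p -> 0 <= s <= 1 -> S (seg p0 p s)) ->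
  exists V, copen V /\ star_shaped V p0 /\ (forall p, S p -> V p) /\ forall p, V p -> U p.
Proof.
intros HU HS Hst.
exists (fun p => forall s, 0 <= s <= 1 -> U (seg p0 p s)).
split; [|split; [|split]].
- intros p Hp.
  destruct (tube (fun s q _ => U (seg p0 q s)) p) as [d [_ [Hd H]]].
  + trivial.
  + intros s Hs; destruct (HU _ (Hp s Hs)) as [r [Hr K]].
    destruct (seg_joint_cont p0 p s r Hr) as [d [Hd K']].
    exists d, 0; split; trivial; intros s' q Hs' H1 H2; apply K, K'; trivial.
  + exists d; split; trivial; intros q Hq s Hs; apply H; trivial.
- intros p s Hp Hs t Ht.
  replace (seg p0 (seg p0 p s) t) with (seg p0 p (t * s)); [apply Hp; nra|].
  unfold seg; rewrite RtoC_mult; ring.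
- intros p Hp s Hs; apply HS, Hst; trivial.
- intros p Hp; rewrite <- (seg_1 p0 p); apply Hp; lra.
Qed.

(** The bound serves at once all segments from p0 to points near p; this is the local uniformity
    required to differentiate a limit of iterations. *)
Lemma cone_bound (V : C -> Prop) (p0 p : C) (f : C -> C) :
  copen V -> star_shaped V p0 -> holo V f -> V p ->
  exists d M, 0 < d /\ forall s q, 0 <= s <= 1 -> Cmod (q - p)%C < d ->
    V (seg p0 q s) /\ Cmod (f (seg p0 q s)) <= M.
Proof.
intros Ho Hst Hf Hp.
apply (tube (fun s q M => V (seg p0 q s) /\ Cmod (f (seg p0 q s)) <= M)).
- intros s q M M' HM [H1 H2]; split; trivial; lra.
- intros s Hs; pose proof (Hst p s Hp Hs) as HV.
  destruct (Ho _ HV) as [r [Hr K]].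
  destruct (Hf _ HV) as [l Hl]; apply Cder_cont in Hl.
  destruct (Hl 1 Rlt_0_1) as [r' [Hr' K']].
  destruct (seg_joint_cont p0 p s (Rmin r r')) as [d [Hd H]]; [apply Rmin_glb_lt; trivial|].
  exists d, (1 + Cmod (f (seg p0 p s))); split; trivial.
  intros s' q Hs' H1 H2; specialize (H s' q Hs' H1 H2); split.
  + apply K; eapply Rlt_le_trans; [exact H|apply Rmin_l].
  + pose proof (K' _ (Rlt_le_trans _ _ _ H (Rmin_r _ _))) as K1.
    replace (f (seg p0 q s')) with ((f (seg p0 q s') - f (seg p0 p s)) + f (seg p0 p s))%C by ring.
    eapply Rle_trans; [apply Cmod_triangle|]; lra.
Qed.

(** * Linear systems *)

Fixpoint csum (n : nat) (f : nat -> C) : C :=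
  match n with
  | O => 0%C
  | S n => (csum n f + f n)%C
  end.

Definition delta (i j : nat) : C := if Nat.eq_dec i j then 1%C else 0%C.

Lemma csum_ext n f g : (forall i, (i < n)%nat -> f i = g i) -> csum n f = csum n g.
Proof.
induction n as [|n IH]; intros H; simpl; trivial.
rewrite IH, H; trivial; intros; [lia|apply H; lia].
Qed.

Lemma csum_plus n f g : csum n (fun i => f i + g i)%C = (csum n f + csum n g)%C.
Proof. induction n as [|n IH]; simpl; [ring|rewrite IH; ring]. Qed.

Lemma csum_scal n c f : csum n (fun i => c * f i)%C = (c * csum n f)%C.
Proof. induction n as [|n IH]; simpl; [ring|rewrite IH; ring]. Qed.

Lemma csum_scal_r n c f : csum n (fun i => f i * c)%C = (csum n f * c)%C.
Proof. induction n as [|n IH]; simpl; [ring|rewrite IH; ring]. Qed.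

Lemma csum_opp n f : csum n (fun i => - f i)%C = (- csum n f)%C.
Proof. induction n as [|n IH]; simpl; [ring|rewrite IH; ring]. Qed.

Lemma csum_minus n f g : csum n (fun i => f i - g i)%C = (csum n f - csum n g)%C.
Proof. induction n as [|n IH]; simpl; [ring|rewrite IH; ring]. Qed.

Lemma csum_0 n (f : nat -> C) : (forall i, (i < n)%nat -> f i = 0%C) -> csum n f = 0%C.
Proof.
intros H; rewrite (csum_ext n f (fun _ => 0%C) H).
clear H; induction n as [|n IH]; simpl; trivial; rewrite IH; ring.
Qed.

Lemma csum_swap n m (f : nat -> nat -> C) :
  csum n (fun i => csum m (fun j => f i j)) = csum m (fun j => csum n (fun i => f i j)).
Proof.
induction n as [|n IH]; simpl.
- symmetry; apply csum_0; trivial.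
- rewrite IH, <- csum_plus; reflexivity.
Qed.

Lemma Cmod_csum_le n f M : (forall i, (i < n)%nat -> Cmod (f i) <= M) -> Cmod (csum n f) <= INR n * M.
Proof.
induction n as [|n IH]; intros H.
- simpl; rewrite Cmod_0; lra.
- rewrite S_INR; simpl; eapply Rle_trans; [apply Cmod_triangle|].
  pose proof (H n ltac:(lia)); assert (Cmod (csum n f) <= INR n * M) by (apply IH; intros; apply H; lia).
  lra.
Qed.

Lemma csum_delta_l n i f : (i < n)%nat -> csum n (fun k => delta i k * f k)%C = f i.
Proof.
induction n as [|n IH]; intros H; [lia|]; simpl.
unfold delta at 2; destruct (Nat.eq_dec i n) as [->|E].
- rewrite csum_0; [ring|]; intros k Hk; unfold delta; destruct (Nat.eq_dec n k); [lia|ring].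
- rewrite IH by lia; ring.
Qed.

Lemma delta_sym i j : delta i j = delta j i.
Proof. unfold delta; destruct (Nat.eq_dec i j), (Nat.eq_dec j i); congruence. Qed.

Lemma csum_delta_r n i f : (i < n)%nat -> csum n (fun k => f k * delta k i)%C = f i.
Proof.
intros H; rewrite <- (csum_delta_l n i f H); apply csum_ext; intros k _.
rewrite delta_sym; ring.
Qed.

Lemma Cder_csum n (f : nat -> C -> C) (l : nat -> C) p :
  (forall i, (i < n)%nat -> Cder (f i) p (l i)) ->
  Cder (fun z => csum n (fun i => f i z)) p (csum n l).
Proof.
induction n as [|n IH]; intros H; simpl; [apply Cder_const|].
apply Cder_plus; [apply IH; intros; apply H; lia|apply H; lia].
Qed.

Lemma common_radius (n : nat) (F : nat -> R -> R -> Prop) :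
  (forall i d d' M M', d' <= d -> M <= M' -> F i d M -> F i d' M') ->
  (forall i, (i < n)%nat -> exists d M, 0 < d /\ F i d M) ->
  exists d M, 0 < d /\ 0 <= M /\ forall i, (i < n)%nat -> F i d M.
Proof.
intros Hm; induction n as [|n IH]; intros H.
- exists 1, 0; split; [lra|split; [lra|lia]].
- destruct IH as [d [M [Hd [HM K]]]]; [intros; apply H; lia|].
  destruct (H n ltac:(lia)) as [d' [M' [Hd' K']]].
  exists (Rmin d d'), (Rmax M M'); split; [apply Rmin_glb_lt; trivial|].
  split; [eapply Rle_trans; [exact HM|apply Rmax_l]|].
  intros i Hi; destruct (Nat.eq_dec i n) as [->|E].
  + apply (Hm n d' _ M'); [apply Rmin_r|apply Rmax_r|trivial].
  + apply (Hm i d _ M); [apply Rmin_l|apply Rmax_l|apply K; lia].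
Qed.

Lemma common_bound (n : nat) (f : nat -> R) : exists M, 0 <= M /\ forall i, (i < n)%nat -> f i <= M.
Proof.
destruct (common_radius n (fun i _ M => f i <= M)) as [_ [M [_ H]]].
- intros; lra.
- intros i _; exists 1, (f i); lra.
- exists M; exact H.
Qed.

Lemma holo_csum V n (f : nat -> C -> C) :
  (forall i, (i < n)%nat -> holo V (f i)) -> holo V (fun z => csum n (fun i => f i z)).
Proof.
induction n as [|n IH]; intros H p Hp; simpl.
- exists 0%C; apply Cder_const.
- destruct (IH ltac:(intros; apply H; lia) p Hp) as [l Hl]; destruct (H n ltac:(lia) p Hp) as [m Hm].
  exists (l + m)%C; apply Cder_plus; assumption.
Qed.

Lemma holo_mult V f g : holo V f -> holo V g -> holo V (fun z => f z * g z)%C.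
Proof.
intros Hf Hg p Hp; destruct (Hf p Hp) as [l Hl]; destruct (Hg p Hp) as [m Hm].
eexists; apply Cder_mult; eassumption.
Qed.

Lemma holo_opp V f : holo V f -> holo V (fun z => - f z)%C.
Proof. intros Hf p Hp; destruct (Hf p Hp) as [l Hl]; eexists; apply Cder_opp, Hl. Qed.

Lemma cone_bound_mx (V : C -> Prop) (p0 p : C) (n : nat) (B : nat -> nat -> C -> C) :
  copen V -> star_shaped V p0 -> V p ->
  (forall i j, (i < n)%nat -> (j < n)%nat -> holo V (B i j)) ->
  exists d M, 0 < d /\ 0 <= M /\ forall s q, 0 <= s <= 1 -> Cmod (q - p)%C < d ->
    V (seg p0 q s) /\
    forall i j, (i < n)%nat -> (j < n)%nat -> Cmod (B i j (seg p0 q s)) <= M.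
Proof.
intros Ho Hst Hp HB.
destruct (common_radius n (fun i d M => forall s q, 0 <= s <= 1 -> Cmod (q - p)%C < d ->
  V (seg p0 q s) /\ forall j, (j < n)%nat -> Cmod (B i j (seg p0 q s)) <= M)) as [d [M [Hd [HM H]]]].
- intros i d d' M M' Hd HM H s q Hs Hq; destruct (H s q Hs) as [H1 H2]; [lra|split; trivial].
  intros j Hj; specialize (H2 j Hj); lra.
- intros i Hi.
  destruct (common_radius n (fun j d M => forall s q, 0 <= s <= 1 -> Cmod (q - p)%C < d ->
    V (seg p0 q s) /\ Cmod (B i j (seg p0 q s)) <= M)) as [d [M [Hd [HM H]]]].
  + intros j d d' M M' Hd HM H s q Hs Hq; destruct (H s q Hs) as [H1 H2]; [lra|split; trivial; lra].
  + intros j Hj; apply cone_bound; auto.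
  (* Membership in V depends on no index, so it is taken from the zero function. *)
  + destruct (cone_bound V p0 p (fun _ => 0%C) Ho Hst) as [d' [M' [Hd' H']]]; trivial.
    { intros z _; exists 0%C; apply Cder_const. }
    exists (Rmin d d'), M; split; [apply Rmin_glb_lt; trivial|].
    intros s q Hs Hq; split.
    * apply (H' s q Hs); eapply Rlt_le_trans; [exact Hq|apply Rmin_r].
    * intros j Hj; apply (H j Hj s q Hs); eapply Rlt_le_trans; [exact Hq|apply Rmin_l].
- destruct (cone_bound V p0 p (fun _ => 0%C) Ho Hst) as [d' [M' [Hd' H']]]; trivial.
  { intros z _; exists 0%C; apply Cder_const. }
  exists (Rmin d d'), M; split; [apply Rmin_glb_lt; trivial|split; trivial].
  intros s q Hs Hq; split.
  + apply (H' s q Hs); eapply Rlt_le_trans; [exact Hq|apply Rmin_r].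
  + intros i j Hi Hj; apply (H i Hi s q Hs); trivial; eapply Rlt_le_trans; [exact Hq|apply Rmin_l].
Qed.

Lemma series_limit (d : nat -> C) (c : R) :
  (forall k, Cmod (d k) <= c * (/ 2) ^ k) ->
  exists l, forall k, Cmod (csum k d - l)%C <= 4 * c * (/ 2) ^ k.
Proof.
intros H; apply geometric_limit_C; intros k; simpl.
replace (csum k d + d k - csum k d)%C with (d k) by ring; apply H.
Qed.

Definition geo_limit (s : nat -> C) (l : C) : Prop :=
  exists c, forall k, Cmod (s k - l)%C <= c * (/ 2) ^ k.

Lemma geo_tail (c : R) k0 k : (k0 <= k)%nat -> c * (/ 2) ^ k <= Rabs c * (/ 2) ^ k0.
Proof.
intros Hk; replace k with (k0 + (k - k0))%nat by lia; rewrite pow_add.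
pose proof (half_pow_pos k0); pose proof (half_pow_pos (k - k0)).
assert ((/ 2) ^ (k - k0) <= 1) by (rewrite <- (pow1 (k - k0)); apply pow_incr; lra).
apply Rle_trans with (Rabs c * ((/ 2) ^ k0 * (/ 2) ^ (k - k0))).
- apply Rmult_le_compat_r; [apply Rmult_le_pos; lra|apply Rle_abs].
- apply Rmult_le_compat_l; [apply Rabs_pos|nra].
Qed.

Lemma geo_limit_le (s : nat -> C) (l a : C) (M : R) :
  geo_limit s l -> (exists k0, forall k, (k0 <= k)%nat -> Cmod (s k - a)%C <= M) -> Cmod (l - a)%C <= M.
Proof.
intros [c Hc] [k0 H]; apply le_epsilon; intros e He.
destruct (half_pow_small (Rabs c) e He) as [k Hk].
specialize (Hc (k0 + k)%nat); specialize (H (k0 + k)%nat ltac:(lia)).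
pose proof (geo_tail c k (k0 + k) ltac:(lia)).
replace (l - a)%C with ((s (k0 + k)%nat - a) - (s (k0 + k)%nat - l))%C by ring.
eapply Rle_trans; [apply Cmod_triangle|]; rewrite Cmod_opp; lra.
Qed.

Lemma geo_limit_unique s l l' : geo_limit s l -> geo_limit s l' -> l = l'.
Proof.
intros H [c Hc]; apply Cmod_small_eq; intros e He.
apply (geo_limit_le s l l' e H).
destruct (half_pow_small (Rabs c) e He) as [k0 Hk0]; exists k0; intros k Hk.
eapply Rle_trans; [apply Hc|]; pose proof (geo_tail c k0 k Hk); lra.
Qed.

(** The mean value inequality for [f m - f k] controls difference quotients uniformly in m from the
    convergence of the derivatives; the values may converge pointwise. *)
Lemma uniform_limit_Cder (f f' : nat -> C -> C) (F g : C -> C) (p : C) (r A : R) :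
  0 < r ->
  (forall k q, Cmod (q - p)%C < r -> Cder (f k) q (f' k q)) ->
  (forall q, Cmod (q - p)%C < r -> geo_limit (fun k => f k q) (F q)) ->
  (forall k q, Cmod (q - p)%C < r -> Cmod (f' k q - g q)%C <= A * (/ 2) ^ k) ->
  Cder F p (g p).
Proof.
intros Hr Hf HF Hg eps Heps.
assert (Hpp : Cmod (p - p)%C < r) by (rewrite Cmod_sub_diag; exact Hr).
assert (HA : 0 <= A).
{ pose proof (Hg 0%nat p Hpp) as H; simpl in H; pose proof (Cmod_ge_0 (f' 0%nat p - g p)%C); lra. }
(* The final error is [3 A 2^-k], from the change of increment and of derivative, plus eps / 4 from
   [f k]; the factor 8 leaves room for both. *)
destruct (half_pow_small (8 * A) eps Heps) as [k Hk].
destruct (Hf k p Hpp (eps / 4)) as [d [Hd H]]; [lra|].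
exists (Rmin d r); split; [apply Rmin_glb_lt; trivial|].
intros q Hq.
specialize (H q (Rlt_le_trans _ _ _ Hq (Rmin_l _ _))).
pose proof (Rlt_le_trans _ _ _ Hq (Rmin_r _ _)) as Hqr.
pose proof (Cmod_ge_0 (q - p)%C) as Hqp.
assert (Hm : forall m, (k <= m)%nat ->
  Cmod (f m q - f m p - (f k q - f k p))%C <= 2 * A * (/ 2) ^ k * Cmod (q - p)%C).
{ intros m Hm.
  assert (Hseg : forall u, 0 <= u <= 1 -> Cmod (seg p q u - p)%C < r)
    by (intros u Hu; apply Cmod_seg_lt; trivial).
  replace (f m q - f m p - (f k q - f k p))%C with
    ((f m q - f k q) - (f m p - f k p) - 0 * (q - p))%C by ring.
  apply (segment_increment_le (fun z => f m z - f k z)%C (fun z => f' m z - f' k z)%C).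
  - intros u Hu; apply Cder_minus; apply Hf, Hseg, Hu.
  - intros u Hu.
    replace (f' m (seg p q u) - f' k (seg p q u) - 0)%C with
      ((f' m (seg p q u) - g (seg p q u)) - (f' k (seg p q u) - g (seg p q u)))%C by ring.
    eapply Rle_trans; [apply Cmod_triangle|]; rewrite Cmod_opp.
    pose proof (Hg m _ (Hseg u Hu)); pose proof (Hg k _ (Hseg u Hu)).
    assert ((/ 2) ^ m <= (/ 2) ^ k).
    { replace m with (k + (m - k))%nat by lia; rewrite pow_add.
      assert ((/ 2) ^ (m - k) <= 1) by (rewrite <- (pow1 (m - k)); apply pow_incr; lra).
      pose proof (half_pow_pos k); nra. }
    nra. }
assert (HL : Cmod ((F q - F p) - (f k q - f k p))%C <= 2 * A * (/ 2) ^ k * Cmod (q - p)%C).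
{ apply (geo_limit_le (fun m => f m q - f m p)%C).
  - destruct (HF q Hqr) as [c Hc]; destruct (HF p Hpp) as [c' Hc'].
    exists (c + c'); intros m; specialize (Hc m); specialize (Hc' m).
    replace (f m q - f m p - (F q - F p))%C with ((f m q - F q) - (f m p - F p))%C by ring.
    eapply Rle_trans; [apply Cmod_triangle|]; rewrite Cmod_opp; lra.
  - exists k; exact Hm. }
pose proof (Hg k p Hpp) as Hgk.
replace (F q - F p - g p * (q - p))%C with
  (((F q - F p) - (f k q - f k p)) + (f k q - f k p - f' k p * (q - p))
    + (f' k p - g p) * (q - p))%C by ring.
eapply Rle_trans; [apply Cmod_triangle|].
eapply Rle_trans; [apply Rplus_le_compat_r, Cmod_triangle|].
rewrite Cmod_mult.
assert (Cmod (f' k p - g p)%C * Cmod (q - p)%C <= A * (/ 2) ^ k * Cmod (q - p)%C)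
  by (apply Rmult_le_compat_r; trivial).
assert (3 * A * (/ 2) ^ k * Cmod (q - p)%C <= eps / 2 * Cmod (q - p)%C)
  by (apply Rmult_le_compat_r; trivial; lra).
assert (0 <= eps * Cmod (q - p)%C) by (apply Rmult_le_pos; lra).
lra.
Qed.

Section LinearSystem.
Variables (V : C -> Prop) (p0 : C) (n : nat) (B : nat -> nat -> C -> C).
Hypothesis Vopen : copen V.
Hypothesis Vstar : star_shaped V p0.
Hypothesis HB : forall i j, (i < n)%nat -> (j < n)%nat -> holo V (B i j).

Definition solves (v : nat -> C -> C) : Prop :=
  forall i p, (i < n)%nat -> V p -> Cder (v i) p (csum n (fun m => B i m p * v m p)%C).

(* [c 2^-k exp (2 M s)] is reproduced, with [k] increased by one, by the
   integration [x => x(0) + M int x]; this makes the bound stable along the iteration. *)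
Lemma ray_bound_step (p : C) (x y : C -> C) (M c : R) :
  0 <= M -> 0 <= c ->
  (forall s, 0 <= s <= 1 -> Cder x (seg p0 p s) (y (seg p0 p s))) ->
  (forall s, 0 <= s <= 1 -> Cmod (y (seg p0 p s) * (p - p0))%C <= M * (2 * c * exp (2 * M * s))) ->
  Cmod (x p0) <= c ->
  forall s, 0 <= s <= 1 -> Cmod (x (seg p0 p s)) <= c * exp (2 * M * s).
Proof.
intros HM Hc Hx Hy H0 s Hs.
pose proof (increment_le (fun u => x (seg p0 p u)) (fun u => y (seg p0 p u) * (p - p0))%C
  (fun u => c * exp (2 * M * u)) (fun u => M * (2 * c * exp (2 * M * u))) 0 s) as K.
cbv beta in K; rewrite seg_0 in K.
assert (K' : Cmod (x (seg p0 p s) - x p0)%C <= c * exp (2 * M * s) - c * exp (2 * M * 0)).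
{ apply K; [lra| | |].
  - intros u Hu; apply Rder_comp; [apply Hx; lra|apply Rder_seg].
  - intros u Hu; auto_derive; trivial; ring.
  - intros u Hu; apply Hy; lra. }
rewrite Rmult_0_r, exp_0 in K'.
replace (x (seg p0 p s)) with ((x (seg p0 p s) - x p0) + x p0)%C by ring.
eapply Rle_trans; [apply Cmod_triangle|]; lra.
Qed.

Lemma local_system_bound (p : C) : V p -> exists r M, 0 < r /\ 0 <= M /\
  forall q, Cmod (q - p)%C < r -> forall s, 0 <= s <= 1 ->
  V (seg p0 q s) /\
  forall (x : nat -> C) (c : R), (forall m, (m < n)%nat -> Cmod (x m) <= c) ->
  forall i, (i < n)%nat ->
    Cmod (csum n (fun m => B i m (seg p0 q s) * x m) * (q - p0))%C <= M * c /\
    Cmod (csum n (fun m => B i m (seg p0 q s) * x m))%C <= M * c.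
Proof.
intros Hp.
destruct (cone_bound_mx V p0 p n B Vopen Vstar Hp HB) as [r [M [Hr [HM H]]]].
pose proof (Cmod_ge_0 (p - p0)%C) as Hpp.
(* The last factor dominates both 1 and [|q - p0|], so one constant covers the coefficient alone and
   the coefficient times the length of the segment. *)
exists r, (INR n * M * (1 + r + Cmod (p - p0)%C)).
pose proof (pos_INR n) as Hn.
assert (HnM : 0 <= INR n * M) by (apply Rmult_le_pos; trivial).
split; trivial; split; [apply Rmult_le_pos; lra|].
intros q Hq s Hs; destruct (H s q Hs Hq) as [H1 H2]; split; trivial.
intros x c Hx i Hi.
assert (Hc : 0 <= c) by (eapply Rle_trans; [apply Cmod_ge_0|apply (Hx i Hi)]).
assert (K : Cmod (csum n (fun m => B i m (seg p0 q s) * x m))%C <= INR n * (M * c)).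
{ apply Cmod_csum_le; intros m Hm; rewrite Cmod_mult.
  apply Rmult_le_compat; auto using Cmod_ge_0. }
assert (Hq0 : Cmod (q - p0)%C <= r + Cmod (p - p0)%C).
{ eapply Rle_trans; [apply (Cmod_triangle_sub q p p0)|]; lra. }
assert (Hnc : 0 <= INR n * M * c) by (apply Rmult_le_pos; trivial).
split.
- rewrite Cmod_mult.
  apply Rle_trans with (INR n * (M * c) * (r + Cmod (p - p0)%C)).
  2:{ replace (INR n * M * (1 + r + Cmod (p - p0)%C) * c) with
        (INR n * (M * c) * (r + Cmod (p - p0)%C) + INR n * M * c) by ring; lra. }
  apply Rmult_le_compat; auto using Cmod_ge_0.
- replace (INR n * M * (1 + r + Cmod (p - p0)%C) * c) with
    (INR n * (M * c) + INR n * M * c * (r + Cmod (p - p0)%C)) by ring.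
  assert (0 <= INR n * M * c * (r + Cmod (p - p0)%C)) by (apply Rmult_le_pos; lra).
  lra.
Qed.

(** Smallness is assumed at p0 alone; [ray_bound_step] spreads it along segments with the factor
    [exp (2 M)], where M is locally uniform. It serves for initial value problems, for the
    asymptotic solution and for the exponential series. *)
Lemma increments_sum (d : nat -> nat -> C -> C) (c : R) :
  0 <= c ->
  (forall i p, (i < n)%nat -> V p -> Cder (d 0%nat i) p 0%C) ->
  (forall k i p, (i < n)%nat -> V p ->
     Cder (d (S k) i) p (csum n (fun m => B i m p * d k m p)%C)) ->
  (forall k i, (i < n)%nat -> Cmod (d k i p0) <= c * (/ 2) ^ k) ->
  exists v, solves v /\
    forall i p, (i < n)%nat -> V p -> geo_limit (fun k => csum k (fun l => d l i p)) (v i p).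
Proof.
intros Hc H0 HS Hb.
assert (Loc : forall p, V p -> exists r A M, 0 < r /\ 0 <= A /\ 0 <= M /\
  forall q, Cmod (q - p)%C < r -> V q /\
  (forall k i, (i < n)%nat -> Cmod (d k i q) <= A * (/ 2) ^ k) /\
  forall (x : nat -> C) (e : R), (forall m, (m < n)%nat -> Cmod (x m) <= e) ->
  forall i, (i < n)%nat -> Cmod (csum n (fun m => B i m q * x m))%C <= M * e).
{ intros p Hp; destruct (local_system_bound p Hp) as [r [M [Hr [HM H]]]].
  exists r, (c * exp (2 * M)), M; split; trivial; split.
  { apply Rmult_le_pos; trivial; apply Rlt_le, exp_pos. }
  split; trivial; intros q Hq.
  split; [rewrite <- (seg_1 p0 q); apply H; trivial; lra|].
  split.
  - assert (K : forall k i, (i < n)%nat -> forall s, 0 <= s <= 1 ->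
      Cmod (d k i (seg p0 q s)) <= c * (/ 2) ^ k * exp (2 * M * s)).
    { induction k as [|k IH]; intros i Hi.
      - apply (ray_bound_step q (d 0%nat i) (fun _ => 0%C)); trivial.
        + apply Rmult_le_pos; trivial; apply Rlt_le, half_pow_pos.
        + intros s Hs; apply H0; trivial; apply (H q Hq s Hs).
        + intros s Hs; rewrite Cmult_0_l, Cmod_0; apply Rmult_le_pos; trivial.
          apply Rmult_le_pos; [simpl; lra|apply Rlt_le, exp_pos].
        + apply Hb, Hi.
      - apply (ray_bound_step q (d (S k) i) (fun z => csum n (fun m => B i m z * d k m z)%C)); trivial.
        + apply Rmult_le_pos; trivial; apply Rlt_le, half_pow_pos.
        + intros s Hs; apply HS; trivial; apply (H q Hq s Hs).
        + intros s Hs.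
          replace (2 * (c * (/ 2) ^ S k) * exp (2 * M * s)) with (c * (/ 2) ^ k * exp (2 * M * s))
            by (simpl; field).
          apply (proj2 (H q Hq s Hs) (fun m => d k m (seg p0 q s))); trivial.
          intros m Hm; apply IH; trivial.
        + apply Hb, Hi. }
    intros k i Hi; specialize (K k i Hi 1 ltac:(lra)).
    rewrite seg_1, Rmult_1_r in K; lra.
  - intros x e Hx i Hi; rewrite <- (seg_1 p0 q).
    apply (proj2 (H q Hq 1 ltac:(lra)) x e Hx i Hi). }
destruct (choice_on (RtoC 0) (fun ip : nat * C => (fst ip < n)%nat /\ V (snd ip))
  (fun ip l => geo_limit (fun k => csum k (fun l => d l (fst ip) (snd ip))) l)) as [v' Hv'].
{ intros [i p] [Hi Hp]; simpl in *.
  destruct (Loc p Hp) as [r [A [M [Hr [_ [_ H]]]]]].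
  destruct (series_limit (fun l => d l i p) A) as [l Hl].
  - intros k; apply (H p); trivial.
    rewrite Cmod_sub_diag; exact Hr.
  - exists l, (4 * A); exact Hl. }
pose (v := fun i p => v' (i, p)).
assert (Hv : forall i p, (i < n)%nat -> V p -> geo_limit (fun k => csum k (fun l => d l i p)) (v i p))
  by (intros i p Hi Hp; exact (Hv' (i, p) (conj Hi Hp))).
exists v; split; trivial.
intros i p Hi Hp.
destruct (Loc p Hp) as [r [A [M [Hr [HA [HM H]]]]]].
(* The shift is forced: differentiating the sum of k + 1 increments kills the first and gives B
   applied to the sum of k increments. *)
apply (uniform_limit_Cder (fun k q => csum (S k) (fun l => d l i q))
  (fun k q => csum n (fun m => B i m q * csum k (fun l => d l m q)))%C (v i)
  (fun q => csum n (fun m => B i m q * v m q))%C p r (M * (4 * A))); trivial.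
- intros k q Hq; destruct (H q Hq) as [Vq _].
  induction k as [|k IH].
  + simpl; apply (Cder_eq _ _ (0 + 0)%C).
    * apply Cder_plus; [apply Cder_const|apply H0; trivial].
    * rewrite csum_0; [ring|]; intros; ring.
  + apply (Cder_eq _ _ (csum n (fun m => B i m q * csum k (fun l => d l m q)) +
      csum n (fun m => B i m q * d k m q))%C).
    * apply (Cder_plus _ _ _ _ _ IH); apply HS; trivial.
    * rewrite <- csum_plus; apply csum_ext; intros m _; simpl; ring.
- intros q Hq; destruct (H q Hq) as [Vq _].
  destruct (Hv i q Hi Vq) as [a Ha]; exists (a / 2); intros k.
  specialize (Ha (S k)); simpl pow in Ha; lra.
- intros k q Hq; destruct (H q Hq) as [Vq [Hd Hx]].
  replace (_ - _)%C with (csum n (fun m => B i m q * (csum k (fun l => d l m q) - v m q)))%C.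
  + rewrite Rmult_assoc; apply Hx; trivial.
    intros m Hm.
    destruct (series_limit (fun l => d l m q) A) as [l Hl]; [intros; apply Hd, Hm|].
    replace (v m q) with l; [apply Hl|].
    apply (geo_limit_unique (fun k => csum k (fun l => d l m q))); [exists (4 * A); exact Hl|apply Hv; trivial].
  + rewrite <- csum_minus; apply csum_ext; intros; ring.
Qed.

Lemma solution_exists (x0 : nat -> C) : V p0 ->
  exists v, solves v /\ forall i, (i < n)%nat -> v i p0 = x0 i.
Proof.
intros Hp0.
pose (d := fix d k : nat -> C -> C :=
  match k with
  | O => fun i _ => x0 i
  | S k => fun i => Prim (fun z => csum n (fun m => B i m z * d k m z)%C) p0
  end).
assert (Hd : forall k i, (i < n)%nat -> holo V (d k i)).
{ induction k as [|k IH]; intros i Hi p Hp.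
  - exists 0%C; apply Cder_const.
  - eexists; apply (Cder_Prim V); trivial.
    apply holo_csum; intros m Hm; apply holo_mult; auto. }
destruct (common_bound n (fun i => Cmod (x0 i))) as [c [Hc0 Hc]].
destruct (increments_sum d c) as [v [Hv Hlim]]; trivial.
- intros; apply Cder_const.
- intros k i p Hi Hp; apply (Cder_Prim V); trivial.
  apply holo_csum; intros m Hm; apply holo_mult; auto.
- intros [|k] i Hi.
  + simpl; specialize (Hc i Hi); lra.
  + simpl d; rewrite Prim_base, Cmod_0; apply Rmult_le_pos; trivial; apply Rlt_le, half_pow_pos.
- exists v; split; trivial; intros i Hi.
  apply (geo_limit_unique _ _ _ (Hlim i p0 Hi Hp0)).
  exists (Cmod (x0 i)); intros k; induction k as [|k IH].
  + simpl; replace (0 - x0 i)%C with (- x0 i)%C by ring; rewrite Cmod_opp; lra.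
  + assert (E : csum (S k) (fun l => d l i p0) = x0 i).
    { clear IH; induction k as [|k IH]; [simpl; ring|].
      simpl csum; simpl csum in IH; rewrite IH; simpl d; rewrite Prim_base; ring. }
    rewrite E; rewrite Cmod_sub_diag.
    apply Rmult_le_pos; [apply Cmod_ge_0|apply Rlt_le, half_pow_pos].
Qed.

(** If dv = B v and dw = - w B, then x = v w satisfies dx = B x - x B, an equation also satisfied by
    the identity; the lemma is applied to the difference of the two. *)
Lemma commutator_system_unique (x : nat -> nat -> C -> C) :
  (forall i j p, (i < n)%nat -> (j < n)%nat -> V p ->
    Cder (x i j) p (csum n (fun m => B i m p * x m j p) - csum n (fun m => B m j p * x i m p))%C) ->
  (forall i j, (i < n)%nat -> (j < n)%nat -> x i j p0 = 0%C) ->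
  forall i j p, (i < n)%nat -> (j < n)%nat -> V p -> x i j p = 0%C.
Proof.
intros Hx H0.
assert (Hh : forall i j, (i < n)%nat -> (j < n)%nat -> holo V (x i j)).
{ intros i j Hi Hj p Hp; eexists; apply Hx; trivial. }
intros i j p Hi Hj Hp.
destruct (cone_bound_mx V p0 p n x Vopen Vstar Hp Hh) as [r [c [Hr [Hc Hb]]]].
destruct (cone_bound_mx V p0 p n B Vopen Vstar Hp HB) as [r' [M [Hr' [HM HBb]]]].
assert (Hpp : forall e, 0 < e -> Cmod (p - p)%C < e)
  by (intros e He; rewrite Cmod_sub_diag; exact He).
pose proof (Cmod_ge_0 (p - p0)%C) as Hq; pose proof (pos_INR n) as Hn.
set (M' := INR n * M * Cmod (p - p0)%C).
assert (HnM : 0 <= INR n * M) by (apply Rmult_le_pos; trivial).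
assert (HM' : 0 <= M') by (apply Rmult_le_pos; trivial).
(* At k = 0 the bound comes from compactness; each passage through the equation halves it. The rate
   is [2 * M'] because each of the two sums contributes [M']. *)
assert (K : forall k i j, (i < n)%nat -> (j < n)%nat -> forall s, 0 <= s <= 1 ->
  Cmod (x i j (seg p0 p s)) <= c * (/ 2) ^ k * exp (2 * (2 * M') * s)).
{ induction k as [|k IH]; clear i j Hi Hj; intros i j Hi Hj s Hs.
  - rewrite pow_O, Rmult_1_r.
    eapply Rle_trans; [apply (Hb s p Hs (Hpp r Hr)); trivial|].
    rewrite <- (Rmult_1_r c) at 1; apply Rmult_le_compat_l; trivial.
    rewrite <- exp_0; assert (0 <= 2 * (2 * M') * s) by (apply Rmult_le_pos; lra).
    destruct H as [H|H]; [apply Rlt_le, exp_increasing; exact H|rewrite <- H; lra].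
  - apply (ray_bound_step p (x i j) (fun z => csum n (fun m => B i m z * x m j z) -
      csum n (fun m => B m j z * x i m z))%C); trivial.
    + lra.
    + apply Rmult_le_pos; trivial; apply Rlt_le, half_pow_pos.
    + intros u Hu; apply Hx; trivial; apply Vstar; trivial.
    + intros u Hu; rewrite Cmod_mult.
      set (e := c * (/ 2) ^ k * exp (2 * (2 * M') * u)).
      replace (2 * M' * (2 * (c * (/ 2) ^ S k) * exp (2 * (2 * M') * u))) with
        (2 * (INR n * (M * e)) * Cmod (p - p0)%C) by (unfold e; set (X := exp _); unfold M'; simpl pow; field).
      apply Rmult_le_compat_r; trivial.
      eapply Rle_trans; [apply Cmod_triangle|]; rewrite Cmod_opp.
      assert (E1 : Cmod (csum n (fun m => B i m (seg p0 p u) * x m j (seg p0 p u))%C) <= INR n * (M * e)).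
      { apply Cmod_csum_le; intros m Hm; rewrite Cmod_mult; apply Rmult_le_compat; try apply Cmod_ge_0.
        - apply (HBb u p Hu (Hpp r' Hr')); trivial.
        - apply IH; trivial. }
      assert (E2 : Cmod (csum n (fun m => B m j (seg p0 p u) * x i m (seg p0 p u))%C) <= INR n * (M * e)).
      { apply Cmod_csum_le; intros m Hm; rewrite Cmod_mult; apply Rmult_le_compat; try apply Cmod_ge_0.
        - apply (HBb u p Hu (Hpp r' Hr')); trivial.
        - apply IH; trivial. }
      lra.
    + rewrite H0, Cmod_0 by trivial; apply Rmult_le_pos; trivial; apply Rlt_le, half_pow_pos. }
apply Cmod_small_eq; intros e He.
destruct (half_pow_small (c * exp (2 * (2 * M') * 1)) e He) as [k Hk].
specialize (K k i j Hi Hj 1 ltac:(lra)); rewrite seg_1 in K.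
replace (x i j p - 0)%C with (x i j p) by ring; lra.
Qed.

Lemma constant_on_star (f : C -> C) : (forall p, V p -> Cder f p 0%C) -> forall p, V p -> f p = f p0.
Proof.
intros Hf p Hp; apply Cmod_small_eq; intros e He.
pose proof (segment_increment_le f (fun _ => 0%C) 0%C 0 p0 p) as K.
replace (f p - f p0)%C with (f p - f p0 - 0 * (p - p0))%C by ring.
eapply Rle_trans; [apply K|].
- intros u Hu; apply Hf, Vstar; trivial.
- intros u Hu; rewrite Cmod_sub_diag; lra.
- lra.
Qed.

End LinearSystem.

(** The inverse is the solution of the adjoint equation with the inverse b of v(p0) as initial
    value. The product w v has derivative 0; v w is treated through its commutator equation. *)
Lemma inverse_solution (V : C -> Prop) (p0 : C) (n : nat) (B v : nat -> nat -> C -> C)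
    (b : nat -> nat -> C) :
  copen V -> star_shaped V p0 -> V p0 ->
  (forall i j, (i < n)%nat -> (j < n)%nat -> holo V (B i j)) ->
  (forall j, (j < n)%nat -> solves V n B (fun i => v i j)) ->
  (forall i j, (i < n)%nat -> (j < n)%nat -> csum n (fun m => b i m * v m j p0)%C = delta i j) ->
  (forall i j, (i < n)%nat -> (j < n)%nat -> csum n (fun m => v i m p0 * b m j)%C = delta i j) ->
  exists w : nat -> nat -> C -> C,
    (forall i j, (i < n)%nat -> (j < n)%nat -> forall p, V p ->
       Cder (w i j) p (- csum n (fun m => w i m p * B m j p))%C) /\
    (forall i j, (i < n)%nat -> (j < n)%nat -> forall p, V p ->
       csum n (fun m => w i m p * v m j p)%C = delta i j) /\
    (forall i j, (i < n)%nat -> (j < n)%nat -> forall p, V p ->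
       csum n (fun m => v i m p * w m j p)%C = delta i j).
Proof.
intros Ho Hst Hp0 HB Hv Hbv Hvb.
(* Row i of w, read as a column, solves the system with the transposed and negated coefficients. *)
destruct (choice_on (fun _ _ => RtoC 0) (fun _ : nat => True) (fun i x =>
  solves V n (fun j m p => - B m j p)%C x /\ forall j, (j < n)%nat -> x j p0 = b i j)) as [w Hw'].
{ intros i _.
  apply solution_exists; trivial; intros; apply holo_opp; auto. }
assert (Hw := fun i => Hw' i Logic.I).
assert (Dw : forall i j, (j < n)%nat -> forall p, V p ->
       Cder (w i j) p (- csum n (fun m => w i m p * B m j p))%C).
{ intros i j Hj p Hp; apply (Cder_eq _ _ _ _ (proj1 (Hw i) j p Hj Hp)).
  rewrite <- csum_opp; apply csum_ext; intros; ring. }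
exists w; split; [|split].
- intros; apply Dw; trivial.
- intros i j Hi Hj p Hp.
  rewrite (constant_on_star V p0 Hst (fun z => csum n (fun m => w i m z * v m j z)%C)); trivial.
  + rewrite <- (Hbv i j Hi Hj); apply csum_ext; intros m Hm; rewrite (proj2 (Hw i)); trivial.
  + clear p Hp; intros p Hp.
    apply (Cder_eq _ _ (csum n (fun m => (- csum n (fun l => w i l p * B l m p)) * v m j p +
      w i m p * csum n (fun l => B m l p * v l j p)))%C).
    * apply Cder_csum; intros m Hm; apply Cder_mult; [apply Dw|apply (Hv j Hj)]; trivial.
    * rewrite csum_plus.
      rewrite (csum_ext n (fun m => w i m p * csum n (fun l => B m l p * v l j p))%C
        (fun m => csum n (fun l => w i m p * B m l p * v l j p))%C).
      2:{ intros m _; rewrite <- csum_scal; apply csum_ext; intros; ring. }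
      rewrite csum_swap, <- csum_plus; apply csum_0; intros m Hm.
      rewrite csum_scal_r; ring.
- intros i j Hi Hj p Hp.
  cut ((csum n (fun m => v i m p * w m j p) - delta i j)%C = 0%C).
  { intros E; replace (csum n (fun m => v i m p * w m j p)%C) with
      ((csum n (fun m => v i m p * w m j p) - delta i j) + delta i j)%C by ring; rewrite E; ring. }
  apply (commutator_system_unique V p0 n B Ho Hst HB
    (fun i j p => csum n (fun m => v i m p * w m j p) - delta i j)%C); trivial.
  + clear i j p Hi Hj Hp; intros i j p Hi Hj Hp.
    apply (Cder_eq _ _ (csum n (fun m => csum n (fun l => B i l p * v l m p) * w m j p +
      v i m p * (- csum n (fun l => w m l p * B l j p))) - 0)%C).
    * apply Cder_minus; [|apply Cder_const].
      apply Cder_csum; intros m Hm; apply Cder_mult; [apply (Hv m Hm)|apply Dw]; trivial.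
    * rewrite csum_plus.
      rewrite (csum_ext n (fun m => csum n (fun l => B i l p * v l m p) * w m j p)%C
        (fun m => csum n (fun l => B i l p * v l m p * w m j p))%C)
        by (intros; rewrite csum_scal_r; reflexivity).
      rewrite (csum_ext n (fun m => v i m p * - csum n (fun l => w m l p * B l j p))%C
        (fun m => csum n (fun l => - (B l j p * (v i m p * w m l p))))%C).
      2:{ intros m _; rewrite csum_opp.
          rewrite (csum_ext n (fun l => B l j p * (v i m p * w m l p))%C
            (fun l => v i m p * (w m l p * B l j p))%C) by (intros; ring).
          rewrite csum_scal; ring. }
      rewrite csum_swap, (csum_swap n n (fun m l => - (B l j p * (v i m p * w m l p)))%C).
      rewrite (csum_ext n (fun l => csum n (fun m => B i l p * v l m p * w m j p))%C
        (fun l => B i l p * csum n (fun m => v l m p * w m j p))%C).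
      2:{ intros l _; rewrite <- csum_scal; apply csum_ext; intros; ring. }
      rewrite (csum_ext n (fun l => csum n (fun m => - (B l j p * (v i m p * w m l p))))%C
        (fun l => - (B l j p * csum n (fun m => v i m p * w m l p)))%C).
      2:{ intros l _; rewrite csum_opp, csum_scal; reflexivity. }
      rewrite csum_opp.
      rewrite (csum_ext n (fun m => B i m p * (csum n (fun l => v m l p * w l j p) - delta m j))%C
        (fun m => B i m p * csum n (fun l => v m l p * w l j p) - B i m p * delta m j)%C) by (intros; ring).
      rewrite (csum_ext n (fun m => B m j p * (csum n (fun l => v i l p * w l m p) - delta i m))%C
        (fun m => B m j p * csum n (fun l => v i l p * w l m p) - delta i m * B m j p)%C) by (intros; ring).
      rewrite !csum_minus, csum_delta_l, csum_delta_r by trivial; ring.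
  + clear i j p Hi Hj Hp; intros i j Hi Hj; rewrite <- (Hvb i j Hi Hj).
    rewrite (csum_ext n (fun m => v i m p0 * b m j)%C (fun m => v i m p0 * w m j p0)%C).
    * ring.
    * intros m Hm; rewrite (proj2 (Hw m)); trivial.
Qed.

(** * Matrices close to the identity *)

Section Neumann.
Variables (n : nat) (E : nat -> nat -> C) (eps : R).
Hypothesis HE : forall i j, (i < n)%nat -> (j < n)%nat -> Cmod (E i j) <= eps.
Hypothesis Heps : INR n * eps <= / 2.

Lemma small_mx_bound (x : nat -> C) (c : R) i :
  (forall m, (m < n)%nat -> Cmod (x m) <= c) -> (i < n)%nat ->
  Cmod (csum n (fun m => E i m * x m)%C) <= / 2 * c.
Proof.
intros Hx Hi.
assert (Hc : 0 <= c) by (eapply Rle_trans; [apply Cmod_ge_0|apply (Hx i Hi)]).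
apply Rle_trans with (INR n * (eps * c)); [|rewrite <- Rmult_assoc; apply Rmult_le_compat_r; trivial].
apply Cmod_csum_le; intros m Hm; rewrite Cmod_mult; apply Rmult_le_compat; auto using Cmod_ge_0.
Qed.

(** Rewriting the equation as x = r - E x halves the excess over [2 * c] of any given bound on x;
    iterating removes it. *)
Lemma near_identity_bound (x r : nat -> C) (c : R) :
  (forall i, (i < n)%nat -> (x i + csum n (fun m => E i m * x m))%C = r i) ->
  (forall i, (i < n)%nat -> Cmod (r i) <= c) ->
  forall i, (i < n)%nat -> Cmod (x i) <= 2 * c.
Proof.
intros Hx Hr.
destruct (common_bound n (fun i => Cmod (x i))) as [A [HA0 HA]].
assert (K : forall k i, (i < n)%nat -> Cmod (x i) <= 2 * c + A * (/ 2) ^ k).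
{ induction k as [|k IH]; intros i Hi.
  - pose proof (HA i Hi); pose proof (Hr i Hi); pose proof (Cmod_ge_0 (r i)); simpl; lra.
  - pose proof (small_mx_bound x _ i IH Hi) as H.
    replace (x i) with (r i - csum n (fun m => E i m * x m))%C by (rewrite <- Hx by trivial; ring).
    eapply Rle_trans; [apply Cmod_triangle|]; rewrite Cmod_opp; pose proof (Hr i Hi); simpl; lra. }
intros i Hi; apply le_epsilon; intros e He.
destruct (half_pow_small A e He) as [k Hk]; specialize (K k i Hi); lra.
Qed.

(** The Neumann series, the sum of (- E)^k r. *)
Lemma near_identity_solve (r : nat -> C) :
  exists x, forall i, (i < n)%nat -> (x i + csum n (fun m => E i m * x m))%C = r i.
Proof.
pose (d := fix d k : nat -> C :=
  match k with
  | O => r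
  | S k => fun i => (- csum n (fun m => E i m * d k m))%C
  end).
destruct (common_bound n (fun i => Cmod (r i))) as [c [Hc0 Hc]].
assert (Hd : forall k i, (i < n)%nat -> Cmod (d k i) <= c * (/ 2) ^ k).
{ induction k as [|k IH]; intros i Hi.
  - simpl; specialize (Hc i Hi); lra.
  - simpl d; rewrite Cmod_opp; pose proof (small_mx_bound (d k) _ i IH Hi); simpl; lra. }
destruct (choice_on (RtoC 0) (fun i => (i < n)%nat)
  (fun i l => forall k, Cmod (csum k (fun l => d l i) - l)%C <= 4 * c * (/ 2) ^ k)) as [x Hx].
{ intros i Hi; apply series_limit; intros; apply Hd, Hi. }
exists x; intros i Hi; apply Cmod_small_eq; intros e He.
destruct (half_pow_small (8 * c) e He) as [k Hk].
assert (HS : forall k, csum (S k) (fun l => d l i) = (r i - csum n (fun m => E i m * csum k (fun l => d l m)))%C).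
{ clear k Hk; induction k as [|k IH].
  - simpl; rewrite csum_0; [ring|intros; ring].
  - change (csum (S (S k)) (fun l => d l i)) with (csum (S k) (fun l => d l i) + d (S k) i)%C.
    rewrite IH; simpl.
    rewrite (csum_ext n (fun m => E i m * (csum k (fun l => d l m) + d k m))%C
      (fun m => E i m * csum k (fun l => d l m) + E i m * d k m)%C) by (intros; ring).
    rewrite csum_plus; ring. }
replace (x i + csum n (fun m => E i m * x m) - r i)%C with
  (- (csum (S k) (fun l => d l i) - x i) - csum n (fun m => E i m * (csum k (fun l => d l m) - x m)))%C.
- eapply Rle_trans; [apply Cmod_triangle|]; rewrite !Cmod_opp.
  pose proof (Hx i Hi (S k)) as H1.
  pose proof (small_mx_bound (fun m => csum k (fun l => d l m) - x m)%C _ i (fun m Hm => Hx m Hm k) Hi) as H2.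
  simpl pow in H1; cbv beta in H2; lra.
- rewrite HS.
  rewrite (csum_ext n (fun m => E i m * (csum k (fun l => d l m) - x m))%C
      (fun m => E i m * csum k (fun l => d l m) - E i m * x m)%C) by (intros; ring).
  rewrite csum_minus; ring.
Qed.

(** Solving column by column gives a right inverse b. From a b a = a follows a (b a - 1) = 0, and
    [near_identity_bound] with a zero right-hand side shows that a has no kernel. *)
Lemma near_identity_inverse (a : nat -> nat -> C) :
  (forall i j, (i < n)%nat -> (j < n)%nat -> a i j = (delta i j + E i j)%C) ->
  exists b : nat -> nat -> C,
  (forall i j, (i < n)%nat -> (j < n)%nat -> csum n (fun m => b i m * a m j)%C = delta i j) /\
  (forall i j, (i < n)%nat -> (j < n)%nat -> csum n (fun m => a i m * b m j)%C = delta i j).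
Proof.
intros Ha.
destruct (choice_on (fun _ => RtoC 0) (fun _ : nat => True)
  (fun j x => forall i, (i < n)%nat -> (x i + csum n (fun m => E i m * x m))%C = delta i j)) as [c Hc'].
{ intros j _; apply near_identity_solve. }
assert (Hc := fun j => Hc' j Logic.I).
assert (Hax : forall x i, (i < n)%nat -> csum n (fun m => a i m * x m)%C = (x i + csum n (fun m => E i m * x m))%C).
{ intros x i Hi.
  rewrite (csum_ext n _ (fun m => delta i m * x m + E i m * x m)%C)
    by (intros; rewrite Ha by trivial; ring).
  rewrite csum_plus, csum_delta_l by trivial; reflexivity. }
assert (Hr : forall i j, (i < n)%nat -> (j < n)%nat -> csum n (fun m => a i m * c j m)%C = delta i j).
{ intros i j Hi Hj; rewrite Hax by trivial; apply Hc, Hi. }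
exists (fun i j => c j i); split; trivial.
intros i j Hi Hj.
set (P := fun i => csum n (fun m => c m i * a m j)%C).
assert (HP : forall k, (k < n)%nat -> csum n (fun l => a k l * (P l - delta l j))%C = 0%C).
{ intros k Hk.
  rewrite (csum_ext n _ (fun l => a k l * P l - a k l * delta l j)%C) by (intros; ring).
  rewrite csum_minus, csum_delta_r by trivial.
  unfold P.
  rewrite (csum_ext n _ (fun l => csum n (fun m => a k l * (c m l * a m j)))%C)
    by (intros; rewrite csum_scal; reflexivity).
  rewrite csum_swap.
  rewrite (csum_ext n _ (fun m => delta k m * a m j)%C).
  2:{ intros m Hm; rewrite <- (Hr k m Hk Hm), <- csum_scal_r; apply csum_ext; intros; ring. }
  rewrite csum_delta_l by trivial; ring. }
assert (Z : Cmod (P i - delta i j)%C <= 2 * 0).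
{ apply (near_identity_bound (fun l => P l - delta l j)%C (fun _ => 0%C)); trivial.
  - intros k Hk; rewrite <- (Hax (fun l => P l - delta l j)%C k Hk); apply HP, Hk.
  - intros k Hk; rewrite Cmod_0; lra. }
change (P i = delta i j); apply Cmod_small_eq; intros; lra.
Qed.

End Neumann.

(** * Matrix norms and integrals over lines *)

Section FiniteDimensionalNorm.
Variables (nu : (nat -> C) -> R) (d : nat).
Hypothesis nu_plus : forall x y, nu (fun i => x i + y i)%C <= nu x + nu y.
Hypothesis nu_scal : forall c x, nu (fun i => c * x i)%C = Cmod c * nu x.
Hypothesis nu_ext : forall x y, (forall i, (i < d)%nat -> x i = y i) -> nu x = nu y.
Hypothesis nu_def : forall x : nat -> C, nu x = 0 -> forall i, (i < d)%nat -> x i = 0%C.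

Lemma fnorm_0 : nu (fun _ => 0%C) = 0.
Proof.
rewrite (nu_ext _ (fun i => 0 * 0)%C) by (intros; ring).
rewrite nu_scal, Cmod_0; ring.
Qed.

Lemma fnorm_opp x : nu (fun i => - x i)%C = nu x.
Proof.
rewrite (nu_ext _ (fun i => - (1) * x i)%C) by (intros; ring).
rewrite nu_scal, Cmod_opp, Cmod_1; ring.
Qed.

Lemma fnorm_pos x : 0 <= nu x.
Proof.
pose proof (nu_plus x (fun i => - x i)%C) as H.
rewrite fnorm_opp, (nu_ext _ (fun _ => 0%C)), fnorm_0 in H by (intros; ring); lra.
Qed.

Lemma fnorm_coords_upper : exists M, 0 <= M /\
  forall x e, 0 <= e -> (forall i, (i < d)%nat -> Cmod (x i) <= e) -> nu x <= M * e.
Proof.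
destruct (common_bound d (fun k => nu (fun i => delta i k))) as [M [HM0 HM]].
exists (INR d * M); split; [apply Rmult_le_pos; trivial; apply pos_INR|].
intros x e He Hx.
assert (K : forall m, (m <= d)%nat ->
  nu (fun i => csum m (fun k => x k * delta i k))%C <= INR m * (M * e)).
{ induction m as [|m IH]; intros Hm.
  - simpl; rewrite fnorm_0; lra.
  - rewrite S_INR.
    eapply Rle_trans; [apply (nu_plus (fun i => csum m (fun k => x k * delta i k))%C (fun i => x m * delta i m)%C)|].
    specialize (IH ltac:(lia)).
    rewrite nu_scal.
    assert (Cmod (x m) * nu (fun i => delta i m) <= e * M).
    { apply Rmult_le_compat; [apply Cmod_ge_0|apply fnorm_pos|apply Hx; lia|apply HM; lia]. }
    lra. }
specialize (K d (Nat.le_refl d)).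
rewrite (nu_ext _ x) in K by (intros i Hi; rewrite <- (csum_delta_l d i x Hi); apply csum_ext; intros; ring).
lra.
Qed.

(** Induction on the dimension of a coordinate subspace. The new basis vector e has positive
    distance to the previous subspace: otherwise vectors of that subspace would approach - e at rate
    2^-k, their coordinates would converge by the induction hypothesis, and the limit would
    contradict definiteness. *)
Lemma fnorm_coords_lower_aux m : (m <= d)%nat -> exists M, 0 <= M /\
  forall x : nat -> C, (forall i, (m <= i)%nat -> x i = 0%C) ->
  forall i, (i < m)%nat -> Cmod (x i) <= M * nu x.
Proof.
induction m as [|m IH]; intros Hm.
{ exists 0; split; [lra|]; intros; lia. }
destruct (IH ltac:(lia)) as [M [HM0 HM]].
destruct fnorm_coords_upper as [A [HA0 HA]].
set (e := fun i => delta i m).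
assert (em : e m = 1%C) by (unfold e, delta; destruct (Nat.eq_dec m m); congruence).
assert (ei : forall i, i <> m -> e i = 0%C)
  by (intros i Hi; unfold e, delta; destruct (Nat.eq_dec i m); congruence).
assert (Hdist : exists del, 0 < del /\
  forall x : nat -> C, (forall i, (m <= i)%nat -> x i = 0%C) -> del <= nu (fun i => e i + x i)%C).
{ apply NNPP; intros Hn.
  destruct (choice_on (fun _ => RtoC 0) (fun _ : nat => True) (fun k x => (forall i, (m <= i)%nat -> x i = 0%C) /\
    nu (fun i => e i + x i)%C < (/ 2) ^ k)) as [x Hx'].
  { intros k _; apply NNPP; intros Hk; apply Hn; exists ((/ 2) ^ k); split; [apply half_pow_pos|].
    intros x Hx; apply Rnot_lt_le; intros Hlt; apply Hk; exists x; split; [exact Hx|exact Hlt]. }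
  assert (Hx := fun k => Hx' k Logic.I).
  destruct (choice_on (RtoC 0) (fun i => (i < m)%nat)
    (fun i l => forall k, Cmod (x k i - l)%C <= 4 * (M * 2) * (/ 2) ^ k)) as [y' Hy'].
  { intros i Hi; apply (geometric_limit_C (fun k => x k i) (M * 2)); intros k; rewrite Rmult_assoc.
    eapply Rle_trans; [apply (HM (fun i => x (S k) i - x k i)%C); trivial|].
    - intros j Hj; rewrite (proj1 (Hx (S k))), (proj1 (Hx k)) by trivial; ring.
    - apply Rmult_le_compat_l; trivial.
      rewrite (nu_ext _ (fun i => (e i + x (S k) i) + - (e i + x k i))%C) by (intros; ring).
      eapply Rle_trans; [apply nu_plus|]; rewrite fnorm_opp.
      pose proof (proj2 (Hx k)); pose proof (proj2 (Hx (S k))) as HS; simpl in HS.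
      pose proof (half_pow_pos k); lra. }
  (* Beyond the first m coordinates the chosen limits are arbitrary; resetting them to 0 puts y in
     the subspace. *)
  pose (y := fun i => if Compare_dec.le_lt_dec m i then RtoC 0 else y' i).
  assert (Hy : forall i, (i < m)%nat -> forall k, Cmod (x k i - y i)%C <= 4 * (M * 2) * (/ 2) ^ k)
    by (intros i Hi; unfold y; destruct (Compare_dec.le_lt_dec m i); [lia|apply Hy', Hi]).
  assert (Hy0 : forall i, (m <= i)%nat -> y i = 0%C)
    by (intros i Hi; unfold y; destruct (Compare_dec.le_lt_dec m i); [trivial|lia]).
  assert (Z : nu (fun i => e i + y i)%C = 0).
  { apply Rle_antisym; [|apply fnorm_pos].
    apply le_epsilon; intros eps He.
    destruct (half_pow_small (1 + A * (4 * (M * 2))) eps He) as [k Hk].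
    rewrite (nu_ext _ (fun i => (e i + x k i) + - (x k i - y i))%C) by (intros; ring).
    eapply Rle_trans; [apply nu_plus|]; rewrite fnorm_opp.
    pose proof (proj2 (Hx k)).
    assert (nu (fun i => x k i - y i)%C <= A * (4 * (M * 2) * (/ 2) ^ k)).
    { apply HA.
      - apply Rmult_le_pos; [lra|apply Rlt_le, half_pow_pos].
      - intros i Hi; destruct (Compare_dec.le_lt_dec m i) as [H'|H'].
        + rewrite (proj1 (Hx k)), Hy0 by trivial.
          rewrite Cmod_sub_diag.
          apply Rmult_le_pos; [lra|apply Rlt_le, half_pow_pos].
        + apply Hy, H'. }
    lra. }
  pose proof (nu_def _ Z m ltac:(lia)) as E; cbv beta in E.
  rewrite em, Hy0 in E by lia.
  apply (RtoC_neq_0 1); [lra|rewrite <- E; ring]. }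
destruct Hdist as [del [Hdel Hdist]].
(* The last coordinate is at most [nu x / del]; removing it leaves a vector of the previous
   subspace, of norm at most [(1 + nu e / del) * nu x]. *)
exists (Rmax (/ del) (M * (1 + nu e / del))); split.
{ eapply Rle_trans; [|apply Rmax_l]; apply Rlt_le, Rinv_0_lt_compat, Hdel. }
intros x Hx i Hi.
pose proof (fnorm_pos x) as Hp; pose proof (fnorm_pos e) as Hpe.
assert (Hxm : Cmod (x m) <= / del * nu x).
{ apply (Rmult_le_reg_l del); trivial.
  rewrite <- Rmult_assoc, Rinv_r, Rmult_1_l by lra.
  destruct (Ceq_dec (x m) 0%C) as [E0|E0]; [rewrite E0, Cmod_0; lra|].
  rewrite (nu_ext x (fun i => x m * (e i + (x i / x m - e i)))%C)
    by (intros; field; trivial).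
  rewrite nu_scal, Rmult_comm; apply Rmult_le_compat_l; [apply Cmod_ge_0|].
  apply Hdist; intros j Hj; destruct (Nat.eq_dec j m) as [->|E].
  - rewrite em; field; trivial.
  - rewrite ei, Hx by (trivial; lia); field; trivial. }
destruct (Nat.eq_dec i m) as [->|E].
- eapply Rle_trans; [exact Hxm|]; apply Rmult_le_compat_r; [trivial|apply Rmax_l].
- eapply Rle_trans; [|apply Rmult_le_compat_r; [trivial|apply Rmax_r]].
  replace (x i) with (x i - x m * e i)%C by (rewrite ei by trivial; ring).
  eapply Rle_trans; [apply (HM (fun i => x i - x m * e i)%C); [|lia]|].
  + intros j Hj; destruct (Nat.eq_dec j m) as [->|E'].
    * rewrite em; ring.
    * rewrite ei, Hx by (trivial; lia); ring.
  + rewrite Rmult_assoc; apply Rmult_le_compat_l; trivial.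
    eapply Rle_trans; [apply nu_plus|]; rewrite fnorm_opp, nu_scal.
    apply (Rmult_le_compat_r (nu e)) in Hxm; trivial.
    unfold Rdiv; lra.
Qed.

Lemma fnorm_coords_lower : exists M, 0 <= M /\
  forall x i, (i < d)%nat -> Cmod (x i) <= M * nu x.
Proof.
destruct (fnorm_coords_lower_aux d (Nat.le_refl d)) as [M [HM0 HM]].
exists M; split; trivial; intros x i Hi.
pose (y := fun i => if Compare_dec.le_lt_dec d i then RtoC 0 else x i).
assert (E : forall i, (i < d)%nat -> y i = x i)
  by (intros j Hj; unfold y; destruct (Compare_dec.le_lt_dec d j); [lia|trivial]).
rewrite <- (E i Hi), <- (nu_ext y x E); apply HM; trivial.
intros j Hj; unfold y; destruct (Compare_dec.le_lt_dec d j); [trivial|lia].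
Qed.

End FiniteDimensionalNorm.

Lemma entry_mk {n : nat} (f : nat -> nat -> C) i j :
  (i < n)%nat -> (j < n)%nat -> entry (mk_matrix n n f) i j = f i j.
Proof. intros Hi Hj; apply coeff_mat_bij; trivial. Qed.

Lemma matrix_ext {n : nat} (A B : @matrix C n n) :
  (forall i j, (i < n)%nat -> (j < n)%nat -> entry A i j = entry B i j) -> A = B.
Proof. intros H; apply (coeff_mat_ext_aux (zero : C) (zero : C)); exact H. Qed.

Lemma entry_plus {n : nat} (A B : @matrix C n n) i j :
  (i < n)%nat -> (j < n)%nat -> entry (plus A B) i j = (entry A i j + entry B i j)%C.
Proof. intros Hi Hj; unfold plus; simpl; unfold Mplus; rewrite entry_mk; trivial. Qed.

Section MatrixNorm.
Variables (n : nat) (N : @matrix C n n -> R).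
Hypothesis HN : is_matrix_norm N.

Let unflat (x : nat -> C) : @matrix C n n := mk_matrix n n (fun i j => x (i * n + j)%nat).
Let nu (x : nat -> C) : R := N (unflat x).

Lemma flat_lt i j : (i < n)%nat -> (j < n)%nat -> (i * n + j < n * n)%nat.
Proof. nia. Qed.

Lemma nu_is_norm :
  (forall x y, nu (fun i => x i + y i)%C <= nu x + nu y) /\
  (forall c x, nu (fun i => c * x i)%C = Cmod c * nu x) /\
  (forall x y, (forall i, (i < n * n)%nat -> x i = y i) -> nu x = nu y) /\
  (forall x, nu x = 0 -> forall i, (i < n * n)%nat -> x i = 0%C).
Proof.
destruct HN as [H1 [H2 H3]]; unfold nu; split; [|split; [|split]].
- intros x y; eapply Rle_trans; [right|apply H1]; f_equal.
  apply matrix_ext; intros i j Hi Hj; rewrite entry_plus by trivial.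
  unfold unflat; rewrite !entry_mk by trivial; reflexivity.
- intros c x; rewrite <- H2; f_equal.
  apply matrix_ext; intros i j Hi Hj; unfold mscal, unflat; rewrite !entry_mk by trivial; reflexivity.
- intros x y Hxy; f_equal; apply matrix_ext; intros i j Hi Hj.
  unfold unflat; rewrite !entry_mk by trivial; apply Hxy, flat_lt; trivial.
- intros x Hx k Hk; apply H3 in Hx.
  assert (n <> 0)%nat by lia.
  assert (Hi : (k / n < n)%nat) by (apply Nat.Div0.div_lt_upper_bound; trivial).
  assert (Hj : (k mod n < n)%nat) by (apply Nat.mod_upper_bound; trivial).
  assert (E : entry (unflat x) (k / n) (k mod n) = entry (zero : @matrix C n n) (k / n) (k mod n))
    by (rewrite Hx; reflexivity).
  unfold unflat in E; rewrite entry_mk in E by trivial.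
  replace (k / n * n + k mod n)%nat with k in E by (rewrite Nat.mul_comm; apply Nat.div_mod; trivial).
  rewrite E; unfold zero; simpl; unfold Mzero; rewrite entry_mk by trivial; reflexivity.
Qed.

Lemma matrix_norm_unflat (A : @matrix C n n) :
  N A = nu (fun k => entry A (k / n) (k mod n)).
Proof.
unfold nu; f_equal; apply matrix_ext; intros i j Hi Hj; unfold unflat; rewrite entry_mk by trivial.
rewrite Nat.div_add_l, Nat.div_small, Nat.add_0_r by lia.
replace ((i * n + j) mod n)%nat with j; trivial.
rewrite Nat.add_comm, Nat.Div0.mod_add, Nat.mod_small; trivial.
Qed.

Lemma matrix_norm_pos A : 0 <= N A.
Proof.
rewrite matrix_norm_unflat; destruct nu_is_norm as [H1 [H2 [H3 _]]].
apply (fnorm_pos nu (n * n)); trivial.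
Qed.

Lemma matrix_norm_upper : exists M, 0 <= M /\ forall A e, 0 <= e ->
  (forall i j, (i < n)%nat -> (j < n)%nat -> Cmod (entry A i j) <= e) -> N A <= M * e.
Proof.
destruct nu_is_norm as [H1 [H2 [H3 _]]].
destruct (fnorm_coords_upper nu (n * n)) as [M [HM0 HM]]; trivial.
exists M; split; trivial; intros A e He HA.
rewrite matrix_norm_unflat; apply HM; trivial.
intros k Hk; assert (n <> 0)%nat by lia.
apply HA; [apply Nat.Div0.div_lt_upper_bound; trivial|apply Nat.mod_upper_bound; trivial].
Qed.

Lemma matrix_norm_lower : exists M, 0 <= M /\ forall A i j, (i < n)%nat -> (j < n)%nat ->
  Cmod (entry A i j) <= M * N A.
Proof.
destruct nu_is_norm as [H1 [H2 [H3 H4]]].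
destruct (fnorm_coords_lower nu (n * n)) as [M [HM0 HM]]; trivial.
exists M; split; trivial; intros A i j Hi Hj.
rewrite matrix_norm_unflat.
eapply Rle_trans; [right|apply (HM (fun k => entry A (k / n) (k mod n)) (i * n + j)%nat (flat_lt i j Hi Hj))]; f_equal; cbv beta.
rewrite Nat.div_add_l, Nat.div_small, Nat.add_0_r by lia; f_equal.
rewrite Nat.add_comm, Nat.Div0.mod_add, Nat.mod_small; trivial.
Qed.

End MatrixNorm.

(** For a nonnegative f, [s, t] can be enlarged to an interval whose integral exceeds the limit by
    less than eps; enlarging only adds mass, and integrability passes to subintervals. *)
Lemma RInt_gen_bound (f : R -> R) :
  (forall t, 0 <= f t) ->
  ex_RInt_gen f (Rbar_locally m_infty) (Rbar_locally p_infty) ->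
  forall s t, s <= t -> ex_RInt f s t /\
    RInt f s t <= RInt_gen f (Rbar_locally m_infty) (Rbar_locally p_infty).
Proof.
intros Hpos Hex.
set (l := RInt_gen (V := R_CompleteNormedModule) f (Rbar_locally m_infty) (Rbar_locally p_infty)).
assert (Hl : is_RInt_gen f (Rbar_locally m_infty) (Rbar_locally p_infty) l)
  by (apply (RInt_gen_correct (V := R_CompleteNormedModule)), Hex).
assert (K : forall s t eps, 0 < eps -> s <= t -> exists a b y, a <= s /\ t <= b /\ is_RInt f a b y /\ y < l + eps).
{ intros s t eps He Hst.
  destruct (Hl (fun y => y < l + eps)) as [Q P HQ HP HQP].
  - exists (mkposreal eps He); intros y Hy.
    apply Rabs_lt_between' in Hy; simpl in Hy; lra.
  - destruct HQ as [A HA]; destruct HP as [B HB].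
    set (a := Rmin (A - 1) s); set (b := Rmax (B + 1) t).
    destruct (HQP a b) as [y [Hy1 Hy2]].
    + apply HA; unfold a; pose proof (Rmin_l (A - 1) s); simpl; lra.
    + apply HB; unfold b; pose proof (Rmax_l (B + 1) t); simpl; lra.
    + exists a, b, y; split; [apply Rmin_r|split; [apply Rmax_r|split; trivial]]. }
intros s t Hst.
assert (Hst' : ex_RInt f s t).
{ destruct (K s t 1 Rlt_0_1 Hst) as [a [b [y [Ha [Hb [Hy _]]]]]].
  apply (ex_RInt_Chasles_1 (V := R_CompleteNormedModule) f s t b); [lra|].
  apply (ex_RInt_Chasles_2 (V := R_CompleteNormedModule) f a s b); [lra|exists y; exact Hy]. }
split; trivial.
apply le_epsilon; intros e He.
destruct (K s t e He Hst) as [a [b [y [Ha [Hb [Hy Hlt]]]]]].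
assert (Hab : ex_RInt f a b) by (exists y; exact Hy).
assert (Hsb : ex_RInt f s b) by (apply (ex_RInt_Chasles_2 (V := R_CompleteNormedModule) f a s b); [lra|trivial]).
assert (Has : ex_RInt f a s) by (apply (ex_RInt_Chasles_1 (V := R_CompleteNormedModule) f a s b); [lra|trivial]).
assert (Htb : ex_RInt f t b) by (apply (ex_RInt_Chasles_2 (V := R_CompleteNormedModule) f s t b); [lra|trivial]).
pose proof (RInt_Chasles (V := R_CompleteNormedModule) f a s b Has Hsb) as E1.
pose proof (RInt_Chasles (V := R_CompleteNormedModule) f s t b Hst' Htb) as E2.
unfold plus in E1, E2; simpl in E1, E2.
pose proof (RInt_ge_0 f a s Ha Has (fun x _ => Hpos x)).
pose proof (RInt_ge_0 f t b Hb Htb (fun x _ => Hpos x)).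
assert (E : RInt f a b = y) by (apply is_RInt_unique, Hy).
fold l; lra.
Qed.

(** * Limits at the ends of a line *)

Definition Rcont (f : R -> C) (t : R) : Prop :=
  continuous (fun u => Re (f u)) t /\ continuous (fun u => Im (f u)) t.

Lemma continuous_eps_R (f : R -> R) (t : R) : continuous f t ->
  forall eps, 0 < eps -> exists d, 0 < d /\ forall u, Rabs (u - t) < d -> Rabs (f u - f t) <= eps.
Proof.
intros H eps He.
destruct (H (fun y => Rabs (y - f t) <= eps)) as [d Hd].
- exists (mkposreal eps He); intros y Hy; apply Rlt_le; exact Hy.
- exists d; split; [apply cond_pos|]; intros u Hu; apply Hd; exact Hu.
Qed.

Lemma Rcont_comp (g : C -> C) (f : R -> C) t : Ccont g (f t) -> Rcont f t -> Rcont (fun u => g (f u)) t.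
Proof.
intros Hg [H1 H2].
assert (K : forall eps, 0 < eps -> exists d, 0 < d /\ forall u, Rabs (u - t) < d -> Cmod (g (f u) - g (f t))%C <= eps).
{ intros eps He; destruct (Hg eps He) as [d [Hd H]].
  destruct (continuous_eps_R _ _ H1 (d / 3)) as [d1 [Hd1 K1]]; [lra|].
  destruct (continuous_eps_R _ _ H2 (d / 3)) as [d2 [Hd2 K2]]; [lra|].
  exists (Rmin d1 d2); split; [apply Rmin_glb_lt; trivial|].
  intros u Hu; apply H; eapply Rle_lt_trans; [apply Cmod_minus_le_abs|].
  specialize (K1 u (Rlt_le_trans _ _ _ Hu (Rmin_l _ _))).
  specialize (K2 u (Rlt_le_trans _ _ _ Hu (Rmin_r _ _))).
  lra. }
split; apply continuous_R_eps; intros eps He; destruct (K eps He) as [d [Hd H]];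
  exists d; split; trivial; intros u Hu; (eapply Rle_trans; [|apply (H u Hu)]);
  [apply Rabs_Re_minus|apply Rabs_Im_minus].
Qed.

Lemma is_derive_continuous (f : R -> R) t l : is_derive f t l -> continuous f t.
Proof.
intros H; apply (ex_derive_continuous (K := R_AbsRing) (V := R_NormedModule)); exists l; exact H.
Qed.

Lemma ex_RInt_cont (f : R -> R) s t : s <= t ->
  (forall u, s <= u <= t -> continuous f u) -> ex_RInt f s t.
Proof.
intros Hst Hf; apply (ex_RInt_continuous (V := R_CompleteNormedModule)).
intros u Hu; rewrite Rmin_left, Rmax_right in Hu by trivial; apply Hf, Hu.
Qed.

Lemma is_RInt_increment (f df : R -> R) s t : s <= t ->
  (forall u, s <= u <= t -> is_derive f u (df u)) ->
  (forall u, s <= u <= t -> continuous df u) -> is_RInt df s t (f t - f s).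
Proof.
intros Hst Hf Hc; apply (is_RInt_derive (V := R_CompleteNormedModule) f df);
  intros u Hu; rewrite Rmin_left, Rmax_right in Hu by trivial; auto.
Qed.

Lemma is_derive_cst (c t : R) : is_derive (fun _ => c) t 0.
Proof. apply (is_derive_const (K := R_AbsRing) (V := R_NormedModule)). Qed.

Lemma Rder_Rcont f t l : Rder f t l -> Rcont f t.
Proof.
intros [H1 H2]; split; eapply is_derive_continuous; eassumption.
Qed.

Lemma Rcont_scal_r (f : R -> C) (c : C) t : Rcont f t -> Rcont (fun u => f u * c)%C t.
Proof.
intros H; apply (Rcont_comp (fun z => z * c)%C f t); trivial.
intros eps He; exists (eps / (1 + Cmod c)); pose proof (Cmod_ge_0 c); split.
- apply Rdiv_lt_0_compat; lra.
- intros q Hq; replace (q * c - f t * c)%C with ((q - f t) * c)%C by ring; rewrite Cmod_mult.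
  apply (Rmult_lt_compat_r (1 + Cmod c)) in Hq; [|lra].
  replace (eps / (1 + Cmod c) * (1 + Cmod c)) with eps in Hq by (field; lra).
  pose proof (Cmod_ge_0 (q - f t)%C); nra.
Qed.

(** The majorant is merely integrable, so a primitive of it cannot be compared with f as in
    [increment_le]; instead the increment of f is written as an integral, by continuity of [df]. *)
Lemma increment_le_RInt (f df : R -> C) (nu : R -> R) (s t : R) : s <= t ->
  (forall u, s <= u <= t -> Rder f u (df u)) ->
  (forall u, s <= u <= t -> Rcont df u) ->
  (forall u, s <= u <= t -> Cmod (df u) <= nu u) -> ex_RInt nu s t ->
  Cmod (f t - f s)%C <= RInt nu s t.
Proof.
intros Hst Hf Hc Hle Hnu.
destruct (Cmod_projection (f t - f s)%C) as [c [Hc1 <-]]; rewrite Re_scal_minus.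
assert (H : is_RInt (fun u => Re (c * df u)%C) s t (Re (c * f t)%C - Re (c * f s)%C)).
{ apply (is_RInt_increment (fun u => Re (c * f u)%C) (fun u => Re (c * df u)%C)); trivial.
  - intros u Hu; apply (Rder_scal c f u (df u) (Hf u Hu)).
  - intros u Hu; destruct (Rcont_scal_r df c u (Hc u Hu)) as [K _].
    apply (continuous_ext (fun v => Re (df v * c)%C)); [|exact K].
    intros v; rewrite Cmult_comm; reflexivity. }
rewrite <- (is_RInt_unique (V := R_CompleteNormedModule) _ _ _ _ H).
apply RInt_le; trivial; [eexists; exact H|].
intros u Hu; eapply Rle_trans; [apply Re_scal_le, Hc1|apply Hle; lra].
Qed.

Definition tends (f : R -> C) (l : C) : Prop :=
  forall eps, 0 < eps -> exists T, forall t, T <= t -> Cmod (f t - l)%C <= eps.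

Lemma tends_exists (f : R -> C) :
  (forall eps, 0 < eps -> exists T, forall s t, T <= s -> s <= t -> Cmod (f t - f s)%C <= eps) ->
  exists l, tends f l.
Proof.
intros H.
assert (Lim : forall h : C -> R, (forall z w, Rabs (h z - h w) <= Cmod (z - w)%C) ->
  exists l, Un_cv (fun k => h (f (INR k))) l).
{ intros h Hh; destruct (Rcomplete.R_complete (fun k => h (f (INR k)))) as [l Hl].
  - intros eps He; destruct (H (eps / 2)) as [T HT]; [lra|].
    destruct (INR_unbounded T) as [k Hk]; exists k.
    assert (K : forall n m, (k <= n)%nat -> (n <= m)%nat -> Rabs (h (f (INR m)) - h (f (INR n))) < eps).
    { intros n m Hn Hm; eapply Rle_lt_trans; [apply Hh|].
      assert (Cmod (f (INR m) - f (INR n))%C <= eps / 2); [|lra].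
      apply HT; [apply le_INR in Hn; lra|apply le_INR, Hm]. }
    intros n m Hn Hm; unfold Rdist.
    destruct (Nat.le_ge_cases n m); [rewrite Rabs_minus_sym|]; apply K; lia.
  - exists l; exact Hl. }
destruct (Lim Re Rabs_Re_minus) as [x Hx]; destruct (Lim Im Rabs_Im_minus) as [y Hy].
exists (x, y); intros eps He.
destruct (H (eps / 3)) as [T HT]; [lra|].
exists T; intros t Ht.
destruct (Hx (eps / 3)) as [k1 K1]; [lra|]; destruct (Hy (eps / 3)) as [k2 K2]; [lra|].
destruct (INR_unbounded t) as [k3 K3].
set (k := (k1 + k2 + k3)%nat).
specialize (K1 k ltac:(unfold k; lia)); specialize (K2 k ltac:(unfold k; lia)).
assert (Hk : t <= INR k) by (apply Rle_trans with (INR k3); [lra|apply le_INR; unfold k; lia]).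
specialize (HT t (INR k) Ht Hk).
unfold Rdist in K1, K2.
rewrite Cmod_sub_sym in HT.
eapply Rle_trans; [apply (Cmod_triangle_sub _ (f (INR k)))|].
assert (Cmod (f (INR k) - (x, y))%C <= 2 * eps / 3); [|lra].
eapply Rle_trans; [apply Cmod_minus_le_abs|]; simpl; lra.
Qed.

Lemma tends_bound (f : R -> C) l a M : tends f l -> (exists T, forall t, T <= t -> Cmod (f t - a)%C <= M) ->
  Cmod (l - a)%C <= M.
Proof.
intros Hl [T HT]; apply le_epsilon; intros e He; destruct (Hl e He) as [T' HT'].
specialize (HT (Rmax T T') (Rmax_l _ _)); specialize (HT' (Rmax T T') (Rmax_r _ _)).
rewrite Cmod_sub_sym in HT'.
eapply Rle_trans; [apply (Cmod_triangle_sub _ (f (Rmax T T')))|]; lra.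
Qed.

(* The weight 1/(1+t) has infinite integral. *)
Lemma log_average_limit (u : R -> R) (M l : R) :
  (forall t, 0 <= t -> continuous u t) ->
  (forall T, 0 <= T -> RInt (fun t => u t / (1 + t)) 0 T <= M) ->
  (forall T, 0 <= T -> - M <= RInt (fun t => u t / (1 + t)) 0 T) ->
  (exists T, forall t, T <= t -> l <= u t) -> l <= 0.
Proof.
intros Hc HM1 HM2 [T0 HT0]; apply Rnot_lt_le; intros Hl.
set (A := Rmax 0 T0).
assert (HA0 : 0 <= A) by apply Rmax_l.
(* Between A and B the integral is at least [l (ln (1 + B) - ln (1 + A))]; this E pushes that to
   [2 * M + 1], while the two bounds leave room for [2 * M]. *)
set (E := (2 * M + 1) / l + ln (1 + A)).
set (B := Rmax A (exp E)).
assert (HAB : A <= B) by apply Rmax_l.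
assert (Hw : forall s t, 0 <= s -> s <= t -> ex_RInt (fun t => u t / (1 + t)) s t).
{ intros s t Hs Hst; apply ex_RInt_cont; trivial; intros z Hz.
  apply (continuous_mult (K := R_AbsRing)); [apply Hc; lra|].
  apply (continuous_comp (fun t => 1 + t) Rinv).
  - apply (is_derive_continuous _ _ 1); auto_derive; trivial; ring.
  - apply continuous_Rinv; lra. }
pose proof (RInt_Chasles (V := R_CompleteNormedModule) _ 0 A B (Hw 0 A (Rle_refl 0) HA0) (Hw A B HA0 HAB)) as E1.
unfold plus in E1; simpl in E1.
pose proof (HM1 B ltac:(lra)); pose proof (HM2 A HA0).
assert (HI : is_RInt (fun t => l / (1 + t)) A B (l * ln (1 + B) - l * ln (1 + A))).
{ apply (is_RInt_increment (fun t => l * ln (1 + t)) (fun t => l / (1 + t))); trivial.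
  - intros x Hx; auto_derive; [lra|field; lra].
  - intros x Hx; apply (ex_derive_continuous (K := R_AbsRing) (V := R_NormedModule)); auto_derive; lra. }
assert (K : l * ln (1 + B) - l * ln (1 + A) <= RInt (fun t => u t / (1 + t)) A B).
{ rewrite <- (is_RInt_unique (V := R_CompleteNormedModule) _ _ _ _ HI).
  apply RInt_le; trivial; [eexists; exact HI|apply Hw; trivial|].
  intros x Hx; apply Rmult_le_compat_r; [apply Rlt_le, Rinv_0_lt_compat; lra|].
  apply HT0; pose proof (Rmax_r 0 T0); unfold A in Hx; lra. }
assert (HB : E <= ln (1 + B)).
{ rewrite <- (ln_exp E); pose proof (Rmax_r A (exp E)); pose proof (exp_pos E).
  apply Rlt_le, ln_increasing; unfold B; lra. }
apply (Rmult_le_compat_l l) in HB; [|lra].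
unfold E in HB; rewrite Rmult_plus_distr_l in HB.
replace (l * ((2 * M + 1) / l)) with (2 * M + 1) in HB by (field; lra).
lra.
Qed.

Definition cis (x : R) : C := (cos x, sin x).

Lemma Cmod_cis x : Cmod (cis x) = 1.
Proof.
unfold Cmod, cis; simpl.
replace (_ + _) with ((sin x)² + (cos x)²) by (unfold Rsqr; ring).
rewrite sin2_cos2; apply sqrt_1.
Qed.

Lemma ln_sqrt_half x : 0 < x -> ln (sqrt x) = ln x / 2.
Proof.
intros Hx; assert (Hs : 0 < sqrt x) by (apply sqrt_lt_R0, Hx).
rewrite <- (sqrt_sqrt x) at 2 by lra; rewrite ln_mult by trivial; field.
Qed.

(** In the plane the point is e^(i f) (b - i t), see [proj_line_curve], and the right-hand side is
    the derivative of this product. It covers both the motion along a line and the passage from one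
    line to another. *)
Lemma Rder_line_family (f b t : R -> R) (s f' b' t' : R) :
  0 < b s -> is_derive f s f' -> is_derive b s b' -> is_derive t s t' ->
  exists l, Rder (fun u => line_curve (f u) (b u) (t u)) s l /\
    (proj (line_curve (f s) (b s) (t s)) * l)%C =
    (cis (f s) * (b' + f' * t s, f' * b s - t')%R)%C.
Proof.
intros Hb Hf Hb' Ht.
assert (Hp : 0 < b s ^ 2 + t s ^ 2) by (pose proof (pow_lt _ 2 Hb); pose proof (pow2_ge_0 (t s)); lra).
exists ((b s * b' + t s * t') / (b s ^ 2 + t s ^ 2), f' - (t' * b s - t s * b') / (b s ^ 2 + t s ^ 2)).
split; [split|].
- apply (is_derive_ext_loc (fun u => ln (b u ^ 2 + t u ^ 2) / 2)).
  + destruct (continuous_eps_R b s) with (eps := b s / 2) as [d [Hd H]].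
    * apply (is_derive_continuous _ _ _ Hb').
    * lra.
    * exists (mkposreal d Hd); intros u Hu.
      specialize (H u Hu); apply Rabs_le_between in H.
      unfold line_curve, Re; simpl fst; rewrite ln_sqrt_half; trivial.
      assert (0 < b u) by lra.
      pose proof (pow_lt _ 2 H0); pose proof (pow2_ge_0 (t u)); lra.
  + auto_derive.
    * split; [eexists; exact Hb'|split; [eexists; exact Ht|split; [simpl in Hp; lra|trivial]]].
    * replace (Derive (fun x => b x) s) with b' by (symmetry; apply is_derive_unique, Hb').
      replace (Derive (fun x => t x) s) with t' by (symmetry; apply is_derive_unique, Ht).
      unfold Re; simpl; field; simpl in Hp; lra.
- change (is_derive (fun u => f u - atan (t u / b u)) s (f' - (t' * b s - t s * b') / (b s ^ 2 + t s ^ 2))).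
  auto_derive.
  + split; [eexists; exact Hf|split; [eexists; exact Ht|split; [eexists; exact Hb'|split; [lra|trivial]]]].
  + replace (Derive (fun x => b x) s) with b' by (symmetry; apply is_derive_unique, Hb').
    replace (Derive (fun x => t x) s) with t' by (symmetry; apply is_derive_unique, Ht).
    replace (Derive (fun x => f x) s) with f' by (symmetry; apply is_derive_unique, Hf).
    field; simpl in Hp; repeat split; lra.
- rewrite proj_line_curve by trivial; fold (cis (f s)); rewrite <- Cmult_assoc; f_equal.
  unfold Cmult; simpl; simpl in Hp; f_equal; field; lra.
Qed.

(** * Independence of the line *)

Lemma continuity_2d_pt_slice f x y : continuity_2d_pt f x y -> continuous (f x) y.
Proof.
intros H; apply continuous_R_eps; intros eps He.
destruct (H (mkposreal eps He)) as [d Hd].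
exists d; split; [apply cond_pos|]; intros u Hu; apply Rlt_le, (Hd x u); trivial.
rewrite Rminus_diag, Rabs_R0; apply cond_pos.
Qed.

Definition C2cont (f : R -> R -> C) (x y : R) : Prop :=
  continuity_2d_pt (fun u v => Re (f u v)) x y /\ continuity_2d_pt (fun u v => Im (f u v)) x y.

Lemma C2cont_comp (g : C -> C) (f : R -> R -> C) x y :
  Ccont g (f x y) -> C2cont f x y -> C2cont (fun u v => g (f u v)) x y.
Proof.
intros Hg [H1 H2].
assert (K : forall eps : posreal, locally_2d (fun u v => Cmod (g (f u v) - g (f x y))%C < eps) x y).
{ intros eps; destruct (Hg (eps / 2)) as [d [Hd H]]; [pose proof (cond_pos eps); lra|].
  assert (Hd2 : 0 < d / 2) by lra.
  destruct (H1 (mkposreal _ Hd2)) as [d1 K1]; destruct (H2 (mkposreal _ Hd2)) as [d2 K2].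
  assert (Hd12 : 0 < Rmin d1 d2) by (apply Rmin_glb_lt; apply cond_pos).
  exists (mkposreal _ Hd12); simpl; intros u v Hu Hv.
  specialize (K1 u v (Rlt_le_trans _ _ _ Hu (Rmin_l _ _)) (Rlt_le_trans _ _ _ Hv (Rmin_l _ _))).
  specialize (K2 u v (Rlt_le_trans _ _ _ Hu (Rmin_r _ _)) (Rlt_le_trans _ _ _ Hv (Rmin_r _ _))).
  simpl in K1, K2.
  apply Rle_lt_trans with (eps / 2); [|pose proof (cond_pos eps); lra].
  apply H; eapply Rle_lt_trans; [apply Cmod_minus_le_abs|].
  lra. }
split; intros eps; destruct (K eps) as [d Hd]; exists d; intros u v Hu Hv; specialize (Hd u v Hu Hv);
  (eapply Rle_lt_trans; [|exact Hd]); [apply Rabs_Re_minus|apply Rabs_Im_minus].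
Qed.

Lemma C2cont_mult f g x y : C2cont f x y -> C2cont g x y -> C2cont (fun u v => f u v * g u v)%C x y.
Proof.
intros [H1 H2] [H3 H4]; split.
- apply (continuity_2d_pt_minus (fun u v => Re (f u v) * Re (g u v)) (fun u v => Im (f u v) * Im (g u v)));
    apply continuity_2d_pt_mult; assumption.
- apply (continuity_2d_pt_plus (fun u v => Re (f u v) * Im (g u v)) (fun u v => Im (f u v) * Re (g u v)));
    apply continuity_2d_pt_mult; assumption.
Qed.

Lemma C2cont_const c x y : C2cont (fun _ _ => c) x y.
Proof. split; apply continuity_2d_pt_const. Qed.

(** Differentiation under the integral sign, then the mean value theorem in s. The hypothesis is
    local around each s because two-sided derivatives are taken at 0 and 1 as well. *)
Lemma param_integral_increment (u du : R -> R -> R) (T M : R) :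
  0 <= T ->
  (forall s, 0 <= s <= 1 -> locally s (fun s' => forall t,
     is_derive (fun x => u x t) s' (du s' t) /\ (0 <= t <= T -> continuous (u s') t))) ->
  (forall s t, 0 <= s <= 1 -> 0 <= t <= T -> continuity_2d_pt du s t) ->
  (forall s, 0 <= s <= 1 -> Rabs (RInt (du s) 0 T) <= M) ->
  Rabs (RInt (u 1) 0 T - RInt (u 0) 0 T) <= M.
Proof.
intros HT Hloc H2 HM.
assert (D : forall s, 0 <= s <= 1 -> is_derive (fun x => RInt (u x) 0 T) s (RInt (du s) 0 T)).
{ intros s Hs.
  destruct (Hloc s Hs) as [d Hd].
  assert (E : RInt (fun t => Derive (fun x => u x t) s) 0 T = RInt (du s) 0 T).
  { apply (RInt_ext (V := R_CompleteNormedModule)); intros t Ht.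
    apply is_derive_unique, (Hd s (ball_center s d)). }
  rewrite <- E.
  apply (is_derive_RInt_param u 0 T s).
  - exists d; intros s' Hs' t Ht.
    exists (du s' t); apply (Hd s' Hs').
  - intros t Ht; rewrite Rmin_left, Rmax_right in Ht by trivial.
    apply (continuity_2d_pt_ext_loc du); [|apply H2; trivial].
    exists d; intros s' t' Hs' _; symmetry; apply is_derive_unique, (Hd s' Hs').
  - exists d; intros s' Hs'; apply ex_RInt_cont; trivial.
    intros t Ht; apply (Hd s' Hs'); trivial. }
destruct (MVT_gen (fun x => RInt (u x) 0 T) 0 1 (fun s => RInt (du s) 0 T)) as [c [Hc E]];
  rewrite ?Rmin_left, ?Rmax_right in * by lra.
- intros x Hx; apply D; lra.
- intros x Hx; apply derivable_continuous_pt; exists (RInt (du x) 0 T); apply is_derive_Reals, D, Hx.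
- rewrite E, Rminus_0_r, Rmult_1_r; apply HM, Hc.
Qed.

Lemma RInt_Rscal (f : R -> R) (a b k : R) : ex_RInt f a b ->
  RInt (fun t => k * f t) a b = k * RInt f a b.
Proof. exact (RInt_scal (V := R_CompleteNormedModule) f a b k). Qed.

Section LineEnds.
Variables (V : C -> Prop) (g G F : C -> C) (sg c d b0 eta K kappa : R) (nu : R -> R -> R -> R) (rho : R -> R -> R).
Hypothesis Hsg : sg = 1 \/ sg = -1.
Hypothesis Heta : 0 < eta < b0.
Hypothesis HV : forall phi b t, c - eta < phi < d + eta -> b0 - eta < b -> V (line_curve phi b t).
Hypothesis HG : forall p, V p -> Cder G p (g p * proj p)%C.
Hypothesis Hg : forall p, V p -> Ccont g p.
Hypothesis HF : forall p, V p -> Ccont F p.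
Hypothesis Hkappa : 0 <= kappa.

(** The sign [sg] moves the end at infinity where the integral starts to t = +infinity, so that both
    alternatives of the L-condition are treated at once. There F stands for L_i - L_j, and [HK]
    below bounds [exp (- Re F)] on the rest of the line by its value at any earlier point, up to
    [exp K]. *)
Let Z (phi b t : R) : C := line_curve phi b (sg * t).

Hypothesis Hnu0 : forall phi b t, 0 <= nu phi b t.
Hypothesis Hnu : forall phi b s t, c <= phi <= d -> b0 <= b -> s <= t ->
  ex_RInt (nu phi b) s t /\ RInt (nu phi b) s t <= rho phi b.
Hypothesis Hrho : forall phi b, c <= phi <= d -> b0 <= b -> rho phi b <= 1.
Hypothesis Hgnu : forall phi b t, c <= phi <= d -> b0 <= b ->
  Cmod (g (Z phi b t)) <= exp (- Re (F (Z phi b t))) * (kappa * nu phi b t).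
Hypothesis HK : forall phi b s t, c <= phi <= d -> b0 <= b -> s <= t ->
  Re (F (Z phi b s)) - Re (F (Z phi b t)) <= K.

Lemma HVZ phi b t : c <= phi <= d -> b0 <= b -> V (Z phi b t).
Proof. intros H1 H2; apply HV; lra. Qed.

Lemma is_derive_sg t : is_derive (fun u => sg * u) t sg.
Proof. auto_derive; trivial; ring. Qed.

Lemma Rder_Z phi b t : 0 < b -> exists l, Rder (Z phi b) t l /\
  (proj (Z phi b t) * l)%C = (cis phi * (0, - sg)%R)%C.
Proof.
intros Hb.
destruct (Rder_line_family (fun _ => phi) (fun _ => b) (fun u => sg * u) t 0 0 sg Hb) as [l [Hl E]].
- apply is_derive_cst.
- apply is_derive_cst.
- apply is_derive_sg.
- exists l; split; [exact Hl|]; unfold Z; rewrite E; f_equal; f_equal; ring.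
Qed.

Lemma Rder_G_Z phi b t : c <= phi <= d -> b0 <= b ->
  Rder (fun u => G (Z phi b u)) t (g (Z phi b t) * (cis phi * (0, - sg)%R))%C.
Proof.
intros Hp Hb; destruct (Rder_Z phi b t) as [l [Hl E]]; [lra|].
rewrite <- E, Cmult_assoc.
apply (Rder_comp G); [apply HG, HVZ; trivial|exact Hl].
Qed.

Lemma Cmod_dir phi : Cmod (cis phi * (0, - sg)%R)%C = 1.
Proof.
rewrite Cmod_mult, Cmod_cis, Rmult_1_l.
unfold Cmod; simpl; replace (_ + _) with 1 by (destruct Hsg as [->| ->]; ring); apply sqrt_1.
Qed.

Lemma g_tail_bound phi b s t : c <= phi <= d -> b0 <= b -> s <= t ->
  Cmod (g (Z phi b t)) <= exp (K - Re (F (Z phi b s))) * kappa * nu phi b t.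
Proof.
intros Hp Hb Hst; eapply Rle_trans; [apply Hgnu; trivial|].
rewrite Rmult_assoc; apply Rmult_le_compat_r; [apply Rmult_le_pos; auto|].
specialize (HK phi b s t Hp Hb Hst).
assert (H : - Re (F (Z phi b t)) <= K - Re (F (Z phi b s))) by lra.
destruct H as [H|H]; [apply Rlt_le, exp_increasing, H|rewrite H; lra].
Qed.

Lemma G_tail_increment phi b s t1 t2 : c <= phi <= d -> b0 <= b -> s <= t1 -> t1 <= t2 ->
  Cmod (G (Z phi b t2) - G (Z phi b t1))%C
    <= exp (K - Re (F (Z phi b s))) * kappa * RInt (nu phi b) t1 t2.
Proof.
intros Hp Hb Hs Ht.
set (A := exp (K - Re (F (Z phi b s))) * kappa).
destruct (Hnu phi b t1 t2 Hp Hb Ht) as [Hex _].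
rewrite <- (RInt_Rscal (nu phi b) t1 t2 A Hex).
apply (increment_le_RInt (fun u => G (Z phi b u)) (fun u => g (Z phi b u) * (cis phi * (0, - sg)%R))%C); trivial.
- intros u _; apply Rder_G_Z; trivial.
- intros u _; apply Rcont_scal_r, (Rcont_comp g (Z phi b)).
  + apply Hg, HVZ; trivial.
  + destruct (Rder_Z phi b u) as [l [Hl _]]; [lra|]; apply (Rder_Rcont _ _ _ Hl).
- intros u Hu; rewrite Cmod_mult, Cmod_dir, Rmult_1_r.
  apply g_tail_bound; trivial; lra.
- apply (ex_RInt_scal (V := R_NormedModule)); exact Hex.
Qed.

Lemma line_limit phi b : c <= phi <= d -> b0 <= b -> exists l, tends (fun t => G (Z phi b t)) l.
Proof.
intros Hp Hb; apply tends_exists; intros eps He.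
set (A := exp (K - Re (F (Z phi b 0))) * kappa).
assert (HA : 0 <= A) by (apply Rmult_le_pos; trivial; apply Rlt_le, exp_pos).
(* The integrals from 0 to t increase and are bounded by rho; once they are close to their supremum,
   the remaining mass is small and the Cauchy criterion holds. *)
destruct (completeness (fun x => exists t, 0 <= t /\ x = RInt (nu phi b) 0 t)) as [m [Hub Hlub]].
- exists (rho phi b); intros x [t [Ht ->]]; apply Hnu; trivial.
- exists (RInt (nu phi b) 0 0), 0; split; [lra|trivial].
- assert (Hd : 0 < eps / (1 + A)) by (apply Rdiv_lt_0_compat; lra).
  assert (HT : exists T, 0 <= T /\ m - eps / (1 + A) < RInt (nu phi b) 0 T).
  { apply NNPP; intros Hn.
    assert (m <= m - eps / (1 + A)); [|lra].
    apply Hlub; intros x [t [Ht ->]]; apply Rnot_lt_le; intros Hlt; apply Hn; exists t; split; trivial. }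
  destruct HT as [T [HT0 HT]]; exists T; intros s t Hs Hst.
  eapply Rle_trans; [apply (G_tail_increment phi b 0); trivial; lra|]; fold A.
  assert (E1 := RInt_Chasles (V := R_CompleteNormedModule) _ 0 T s
    (proj1 (Hnu phi b 0 T Hp Hb HT0)) (proj1 (Hnu phi b T s Hp Hb Hs))).
  assert (E2 := RInt_Chasles (V := R_CompleteNormedModule) _ 0 s t
    (proj1 (Hnu phi b 0 s Hp Hb ltac:(lra))) (proj1 (Hnu phi b s t Hp Hb Hst))).
  unfold plus in E1, E2; simpl in E1, E2.
  assert (Hm : RInt (nu phi b) 0 t <= m) by (apply Hub; exists t; split; [lra|trivial]).
  assert (H0 : 0 <= RInt (nu phi b) T s)
    by (apply RInt_ge_0; [trivial|apply Hnu; trivial|intros; apply Hnu0]).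
  assert (H1 : 0 <= RInt (nu phi b) s t)
    by (apply RInt_ge_0; [trivial|apply Hnu; trivial|intros; apply Hnu0]).
  assert (H2 : RInt (nu phi b) s t <= eps / (1 + A)) by lra.
  apply Rle_trans with ((1 + A) * (eps / (1 + A))).
  + apply Rmult_le_compat; lra.
  + right; field; lra.
Qed.

Section TwoLines.
Variables (f1 b1 f2 b2 : R).
Hypothesis Hf1 : c <= f1 <= d.
Hypothesis Hf2 : c <= f2 <= d.
Hypothesis Hb1 : b0 <= b1.
Hypothesis Hb2 : b0 <= b2.

Let fs (s : R) : R := f1 + s * (f2 - f1).
Let bs (s : R) : R := b1 + s * (b2 - b1).
Let W (s t : R) : C := Z (fs s) (bs s) t.
(** The velocity in the plane, across the lines, of the point with fixed t when s varies. *)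
Let m (s t : R) : C :=
  (cis (fs s) * ((b2 - b1) + (f2 - f1) * (sg * t), (f2 - f1) * bs s - 0)%R)%C.
Let C1 : R := Rabs (f2 - f1) * (1 + Rabs b1 + Rabs b2) + Rabs (b2 - b1).

Lemma interp_range s : 0 <= s <= 1 -> c <= fs s <= d /\ b0 <= bs s <= Rabs b1 + Rabs b2.
Proof.
intros Hs; unfold fs, bs.
assert (c <= f1 + s * (f2 - f1) <= d) by (destruct (Rle_dec f1 f2); split; nra).
assert (b0 <= b1 + s * (b2 - b1)) by (destruct (Rle_dec b1 b2); nra).
rewrite !Rabs_pos_eq by lra.
repeat split; try lra; nra.
Qed.

(** The margin [eta] lets s leave [0, 1] a little, as two-sided derivatives at the end lines
    demand. *)
Lemma interp_near s : 0 <= s <= 1 -> locally s (fun s' => c - eta < fs s' < d + eta /\ b0 - eta < bs s').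
Proof.
intros Hs; destruct (interp_range s Hs) as [H1 [H2 _]].
set (D := 1 + Rabs (f2 - f1) + Rabs (b2 - b1)).
assert (HD : 0 < eta / D) by (apply Rdiv_lt_0_compat; [lra|unfold D; pose proof (Rabs_pos (f2 - f1)); pose proof (Rabs_pos (b2 - b1)); lra]).
exists (mkposreal _ HD); intros s' Hs'.
change (Rabs (s' - s) < eta / D) in Hs'.
assert (HD0 : 0 < D) by (unfold D; pose proof (Rabs_pos (f2 - f1)); pose proof (Rabs_pos (b2 - b1)); lra).
apply (Rmult_lt_compat_r D) in Hs'; trivial.
replace (eta / D * D) with eta in Hs' by (field; lra).
assert (K1 : Rabs (fs s' - fs s) < eta).
{ replace (fs s' - fs s) with ((s' - s) * (f2 - f1)) by (unfold fs; ring); rewrite Rabs_mult.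
  eapply Rle_lt_trans; [|exact Hs']; apply Rmult_le_compat_l; [apply Rabs_pos|].
  unfold D; pose proof (Rabs_pos (b2 - b1)); lra. }
assert (K2 : Rabs (bs s' - bs s) < eta).
{ replace (bs s' - bs s) with ((s' - s) * (b2 - b1)) by (unfold bs; ring); rewrite Rabs_mult.
  eapply Rle_lt_trans; [|exact Hs']; apply Rmult_le_compat_l; [apply Rabs_pos|].
  unfold D; pose proof (Rabs_pos (f2 - f1)); lra. }
apply Rabs_lt_between in K1; apply Rabs_lt_between in K2; lra.
Qed.

Lemma Rder_W s t : 0 < bs s -> exists l, Rder (fun u => W u t) s l /\ (proj (W s t) * l)%C = m s t.
Proof.
intros Hb.
destruct (Rder_line_family fs bs (fun _ => sg * t) s (f2 - f1) (b2 - b1) 0 Hb) as [l [Hl E]].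
- unfold fs; auto_derive; trivial; ring.
- unfold bs; auto_derive; trivial; ring.
- apply is_derive_cst.
- exists l; split; [exact Hl|exact E].
Qed.

Lemma Cmod_m_le s t : 0 <= s <= 1 -> 0 <= t -> Cmod (m s t) <= C1 * (1 + t).
Proof.
intros Hs Ht; unfold m; rewrite Cmod_mult, Cmod_cis, Rmult_1_l.
eapply Rle_trans; [apply Cmod_le_abs|]; unfold Re, Im; simpl.
destruct (interp_range s Hs) as [_ Hb].
rewrite Rminus_0_r, Rabs_mult, (Rabs_pos_eq (bs s)) by lra.
pose proof (Rabs_triang (b2 - b1) ((f2 - f1) * (sg * t))) as H.
rewrite !Rabs_mult, (Rabs_pos_eq t) in H by trivial.
assert (E : Rabs sg = 1) by (destruct Hsg as [->| ->]; [apply Rabs_R1|rewrite Rabs_left; lra]).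
rewrite E in H; unfold C1.
pose proof (Rabs_pos (f2 - f1)) as P1; pose proof (Rabs_pos (b2 - b1)) as P2.
pose proof (Rabs_pos b1); pose proof (Rabs_pos b2).
assert (Rabs (f2 - f1) * bs s <= Rabs (f2 - f1) * (Rabs b1 + Rabs b2)) by (apply Rmult_le_compat_l; lra).
assert (0 <= Rabs (f2 - f1) * (Rabs b1 + Rabs b2) * t) by (apply Rmult_le_pos; trivial; apply Rmult_le_pos; lra).
assert (0 <= Rabs (b2 - b1) * t) by (apply Rmult_le_pos; trivial).
lra.
Qed.

Lemma continuity_bs s t : continuity_2d_pt (fun u _ => bs u) s t.
Proof.
apply (continuity_2d_pt_plus (fun _ _ => b1) (fun u _ => u * (b2 - b1))).
- apply continuity_2d_pt_const.
- apply (continuity_2d_pt_mult (fun u _ => u) (fun _ _ => b2 - b1));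
    [apply continuity_2d_pt_id1|apply continuity_2d_pt_const].
Qed.

Lemma continuity_fs s t : continuity_2d_pt (fun u _ => fs u) s t.
Proof.
apply (continuity_2d_pt_plus (fun _ _ => f1) (fun u _ => u * (f2 - f1))).
- apply continuity_2d_pt_const.
- apply (continuity_2d_pt_mult (fun u _ => u) (fun _ _ => f2 - f1));
    [apply continuity_2d_pt_id1|apply continuity_2d_pt_const].
Qed.

Lemma continuity_sgt s t : continuity_2d_pt (fun _ v => sg * v) s t.
Proof.
apply (continuity_2d_pt_mult (fun _ _ => sg) (fun _ v => v));
  [apply continuity_2d_pt_const|apply continuity_2d_pt_id2].
Qed.

Lemma C2cont_W s t : 0 < bs s -> C2cont W s t.
Proof.
intros Hb; split.
- change (continuity_2d_pt (fun u v => ln (sqrt (bs u ^ 2 + (sg * v) ^ 2))) s t).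
  assert (Hp : 0 < bs s ^ 2 + (sg * t) ^ 2)
    by (pose proof (pow_lt _ 2 Hb); pose proof (pow2_ge_0 (sg * t)); lra).
  apply (continuity_1d_2d_pt_comp (fun x => ln (sqrt x)) (fun u v => bs u ^ 2 + (sg * v) ^ 2)).
  + apply derivable_continuous_pt; eexists; apply is_derive_Reals.
    auto_derive; [split; [exact Hp|split; [apply sqrt_lt_R0, Hp|trivial]]|reflexivity].
  + apply (continuity_2d_pt_plus (fun u _ => bs u ^ 2) (fun _ v => (sg * v) ^ 2)).
    * apply (continuity_2d_pt_mult (fun u _ => bs u) (fun u _ => bs u * 1)); [apply continuity_bs|].
      apply (continuity_2d_pt_mult (fun u _ => bs u) (fun _ _ => 1)); [apply continuity_bs|apply continuity_2d_pt_const].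
    * apply (continuity_2d_pt_mult (fun _ v => sg * v) (fun _ v => sg * v * 1)); [apply continuity_sgt|].
      apply (continuity_2d_pt_mult (fun _ v => sg * v) (fun _ _ => 1)); [apply continuity_sgt|apply continuity_2d_pt_const].
- change (continuity_2d_pt (fun u v => fs u - atan (sg * v / bs u)) s t).
  apply (continuity_2d_pt_minus (fun u _ => fs u) (fun u v => atan (sg * v / bs u))); [apply continuity_fs|].
  apply (continuity_1d_2d_pt_comp atan (fun u v => sg * v / bs u)).
  + apply derivable_continuous_pt, derivable_pt_atan.
  + apply (continuity_2d_pt_mult (fun _ v => sg * v) (fun u _ => / bs u)); [apply continuity_sgt|].
    apply (continuity_2d_pt_inv (fun u _ => bs u)); [apply continuity_bs|lra].
Qed.

Lemma C2cont_m s t : C2cont m s t.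
Proof.
unfold m.
apply (C2cont_mult (fun u _ => cis (fs u)) (fun u v => ((b2 - b1) + (f2 - f1) * (sg * v), (f2 - f1) * bs u - 0)%R)).
- split.
  + apply (continuity_1d_2d_pt_comp cos (fun u _ => fs u)); [apply continuity_cos|apply continuity_fs].
  + apply (continuity_1d_2d_pt_comp sin (fun u _ => fs u)); [apply continuity_sin|apply continuity_fs].
- split.
  + apply (continuity_2d_pt_plus (fun _ _ => b2 - b1) (fun _ v => (f2 - f1) * (sg * v))); [apply continuity_2d_pt_const|].
    apply (continuity_2d_pt_mult (fun _ _ => f2 - f1) (fun _ v => sg * v)); [apply continuity_2d_pt_const|apply continuity_sgt].
  + apply (continuity_2d_pt_minus (fun u _ => (f2 - f1) * bs u) (fun _ _ => 0)); [|apply continuity_2d_pt_const].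
    apply (continuity_2d_pt_mult (fun _ _ => f2 - f1) (fun u _ => bs u)); [apply continuity_2d_pt_const|apply continuity_bs].
Qed.

Lemma F_lower_bound : exists M, forall s, 0 <= s <= 1 -> - Re (F (W s 0)) <= M.
Proof.
(* Compactness of [0, 1] in s; the point 0 of the tube is a dummy. *)
destruct (tube (fun s _ M => - Re (F (W s 0)) <= M) 0%C) as [r [M [Hr H]]].
- intros; lra.
- intros s Hs; destruct (interp_range s Hs) as [K1 K2].
  assert (HW : V (W s 0)) by (apply HVZ; lra).
  destruct (Rder_W s 0) as [l [Hl _]]; [lra|].
  destruct (Rcont_comp F (fun u => W u 0) s (HF _ HW) (Rder_Rcont _ _ _ Hl)) as [K3 _].
  destruct (continuous_eps_R _ _ K3 1 Rlt_0_1) as [r [Hr K4]].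
  exists r, (1 - Re (F (W s 0))); split; trivial.
  intros s' _ _ Hs' _; specialize (K4 s' Hs'); apply Rabs_le_between in K4; lra.
- exists M; intros s Hs; apply (H s 0%C Hs).
  rewrite Cmod_sub_diag; exact Hr.
Qed.

(* As [m] is [O(1 + t)], the derivative in [s] of [int G (W s t) / (1 + t) dt] is bounded
   by the L1 norm of [g] on a line, uniformly in the length of the interval. *)
Lemma weighted_increment (e : C) : Cmod e = 1 -> exists M, forall T, 0 <= T ->
  Rabs (RInt (fun t => Re (e * (G (W 1 t) - G (W 0 t)))%C / (1 + t)) 0 T) <= M.
Proof.
intros He; destruct F_lower_bound as [MF HMF].
(* [MF] bounds [- Re F] at t = 0 on all intermediate lines, so [g_tail_bound] started at 0 has the
   same constant on each of them. *)
set (A := exp (K + MF) * kappa).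
assert (HA : 0 <= A) by (apply Rmult_le_pos; trivial; apply Rlt_le, exp_pos).
assert (HC1 : 0 <= C1).
{ unfold C1; apply Rplus_le_le_0_compat; [apply Rmult_le_pos|]; try apply Rabs_pos.
  pose proof (Rabs_pos b1); pose proof (Rabs_pos b2); lra. }
exists (C1 * A); intros T HT.
set (u := fun s t => Re (e * G (W s t))%C / (1 + t)).
set (du := fun s t => Re (e * (g (W s t) * m s t))%C / (1 + t)).
assert (Hu : forall s, 0 <= s <= 1 -> locally s (fun s' => forall t,
     is_derive (fun x => u x t) s' (du s' t) /\ (0 <= t <= T -> continuous (u s') t))).
{ intros s Hs; generalize (interp_near s Hs); apply filter_imp; intros s' [K1 K2] t.
  assert (Hb : 0 < bs s') by lra.
  assert (HW : V (W s' t)) by (apply HV; trivial).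
  split.
  - destruct (Rder_W s' t Hb) as [l [Hl E]].
    pose proof (Rder_scal e _ _ _ (Rder_comp G (fun x => W x t) s' _ l (HG _ HW) Hl)) as [D _].
    rewrite <- Cmult_assoc, E in D.
    unfold u, du, Rdiv.
    apply (is_derive_ext (fun x => scal (/ (1 + t)) (Re (e * G (W x t))%C))).
    { intros x; unfold scal; simpl; unfold mult; simpl; ring. }
    rewrite Rmult_comm.
    apply (is_derive_scal (fun x => Re (e * G (W x t))%C) s' (/ (1 + t))); exact D.
  - intros Ht; unfold u.
    apply (continuous_mult (K := R_AbsRing) (fun t => Re (e * G (W s' t))%C) (fun t => / (1 + t))).
    + destruct (Rder_Z (fs s') (bs s') t Hb) as [l [Hl _]].
      destruct (Rder_scal e _ _ _ (Rder_comp G (Z (fs s') (bs s')) t _ l (HG _ HW) Hl)) as [D _].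
      apply (is_derive_continuous _ _ _ D).
    + apply (ex_derive_continuous (K := R_AbsRing) (V := R_NormedModule)); auto_derive; lra. }
assert (H2 : forall s t, 0 <= s <= 1 -> 0 <= t <= T -> continuity_2d_pt du s t).
{ intros s t Hs Ht; destruct (interp_range s Hs) as [K1 K2].
  assert (HW : V (W s t)) by (apply HVZ; lra).
  apply (continuity_2d_pt_mult (fun s t => Re (e * (g (W s t) * m s t))%C) (fun _ t => / (1 + t))).
  - apply (C2cont_mult (fun _ _ => e)); [apply C2cont_const|].
    apply C2cont_mult; [|apply C2cont_m].
    apply (C2cont_comp g W); [apply Hg, HW|apply C2cont_W; lra].
  - apply (continuity_2d_pt_inv (fun _ t => 1 + t)); [|lra].
    apply (continuity_2d_pt_plus (fun _ _ => 1) (fun _ t => t));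
      [apply continuity_2d_pt_const|apply continuity_2d_pt_id2]. }
assert (HM : forall s, 0 <= s <= 1 -> Rabs (RInt (du s) 0 T) <= C1 * A).
{ intros s Hs; destruct (interp_range s Hs) as [K1 K2].
  assert (Hex : ex_RInt (du s) 0 T).
  { apply ex_RInt_cont; trivial.
    intros t Ht; apply continuity_2d_pt_slice, H2; trivial. }
  destruct (Hnu (fs s) (bs s) 0 T K1 ltac:(lra) HT) as [Hexnu Hle].
  assert (Hr := Hrho (fs s) (bs s) K1 ltac:(lra)).
  assert (Hb : forall t, 0 <= t <= T -> Rabs (du s t) <= C1 * A * nu (fs s) (bs s) t).
  { intros t Ht; unfold du, Rdiv; rewrite Rabs_mult, (Rabs_pos_eq (/ (1 + t)))
      by (apply Rlt_le, Rinv_0_lt_compat; lra).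
    apply (Rmult_le_reg_r (1 + t)); [lra|].
    rewrite Rmult_assoc, Rinv_l, Rmult_1_r by lra.
    eapply Rle_trans; [apply re_le_Cmod|]; rewrite Cmod_mult, He, Rmult_1_l, Cmod_mult.
    pose proof (Cmod_m_le s t Hs ltac:(lra)) as E1.
    assert (E2 : Cmod (g (W s t)) <= A * nu (fs s) (bs s) t).
    { eapply Rle_trans; [apply (g_tail_bound (fs s) (bs s) 0 t); lra|].
      apply Rmult_le_compat_r; [apply Hnu0|]; apply Rmult_le_compat_r; trivial.
      assert (H : K - Re (F (W s 0)) <= K + MF) by (specialize (HMF s Hs); lra).
      destruct H as [H|H]; [apply Rlt_le, exp_increasing, H|unfold W in H; rewrite H; lra]. }
    replace (C1 * A * nu (fs s) (bs s) t * (1 + t)) with ((A * nu (fs s) (bs s) t) * (C1 * (1 + t))) by ring.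
    apply Rmult_le_compat; auto using Cmod_ge_0. }
  eapply Rle_trans; [apply (abs_RInt_le (du s) 0 T HT Hex)|].
  apply Rle_trans with (C1 * A * RInt (nu (fs s) (bs s)) 0 T).
  - rewrite <- (RInt_Rscal (nu (fs s) (bs s)) 0 T (C1 * A) Hexnu).
    apply RInt_le; trivial.
    + apply (ex_RInt_norm (du s)), Hex.
    + apply (ex_RInt_scal (V := R_NormedModule)); exact Hexnu.
    + intros t Ht; apply Hb; lra.
  - rewrite <- (Rmult_1_r (C1 * A)) at 2; apply Rmult_le_compat_l; [apply Rmult_le_pos; trivial|lra]. }
pose proof (param_integral_increment u du T (C1 * A) HT Hu H2 HM) as E.
assert (Hex : forall s, 0 <= s <= 1 -> ex_RInt (u s) 0 T).
{ intros s Hs; apply ex_RInt_cont; trivial.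
  intros t Ht; apply (locally_singleton _ _ (Hu s Hs) t), Ht. }
replace (RInt (fun t => Re (e * (G (W 1 t) - G (W 0 t)))%C / (1 + t)) 0 T) with
  (RInt (u 1) 0 T - RInt (u 0) 0 T); trivial.
symmetry; change (RInt (u 1) 0 T - RInt (u 0) 0 T) with
  (minus (G := R_AbelianGroup) (RInt (u 1) 0 T) (RInt (u 0) 0 T)).
rewrite <- (RInt_minus (V := R_CompleteNormedModule)) by (apply Hex; lra).
apply (RInt_ext (V := R_CompleteNormedModule)); intros t _.
rewrite Re_scal_minus; unfold u, minus, plus, opp; simpl; unfold Rdiv; ring.
Qed.

Lemma line_limits_agree l1 l2 :
  tends (fun t => G (Z f1 b1 t)) l1 -> tends (fun t => G (Z f2 b2 t)) l2 -> l1 = l2.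
Proof.
intros H1 H2.
assert (W0 : forall t, W 0 t = Z f1 b1 t)
  by (intros t; unfold W, fs, bs; f_equal; ring).
assert (W1 : forall t, W 1 t = Z f2 b2 t)
  by (intros t; unfold W, fs, bs; f_equal; ring).
(* The rotation by e leaves a real function of t with limit [|l2 - l1|]; as its weighted integrals
   are bounded, this limit cannot be positive. *)
destruct (Cmod_projection (l2 - l1)%C) as [e [He HL]].
destruct (weighted_increment e He) as [M HM].
assert (E : Cmod (l2 - l1)%C = 0).
{ apply Rle_antisym; [|apply Cmod_ge_0].
  apply le_epsilon; intros eps Heps; rewrite Rplus_0_l.
  assert (Cmod (l2 - l1)%C - eps <= 0); [|lra].
  apply (log_average_limit (fun t => Re (e * (G (W 1 t) - G (W 0 t)))%C) M).
  - intros t _.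
    apply (continuous_ext (fun t => Re (e * G (Z f2 b2 t))%C - Re (e * G (Z f1 b1 t))%C)).
    { intros x; rewrite W0, W1, Re_scal_minus; reflexivity. }
    apply (continuous_minus (K := R_AbsRing) (V := R_NormedModule)).
    + destruct (Rder_scal e _ _ _ (Rder_G_Z f2 b2 t Hf2 Hb2)) as [D _]; apply (is_derive_continuous _ _ _ D).
    + destruct (Rder_scal e _ _ _ (Rder_G_Z f1 b1 t Hf1 Hb1)) as [D _]; apply (is_derive_continuous _ _ _ D).
  - intros T HT; specialize (HM T HT); apply Rabs_le_between in HM; apply HM.
  - intros T HT; specialize (HM T HT); apply Rabs_le_between in HM; apply HM.
  - destruct (H1 (eps / 2)) as [T1 K1]; [lra|]; destruct (H2 (eps / 2)) as [T2 K2]; [lra|].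
    exists (Rmax T1 T2); intros t Ht.
    specialize (K1 t (Rle_trans _ _ _ (Rmax_l _ _) Ht)); specialize (K2 t (Rle_trans _ _ _ (Rmax_r _ _) Ht)).
    rewrite W0, W1, <- HL.
    assert (D : Re (e * (l2 - l1))%C - Re (e * (G (Z f2 b2 t) - G (Z f1 b1 t)))%C <= eps); [|lra].
    rewrite <- Re_scal_minus.
    eapply Rle_trans; [apply Re_scal_le, He|].
    replace (l2 - l1 - (G (Z f2 b2 t) - G (Z f1 b1 t)))%C with
      (- (G (Z f2 b2 t) - l2) + (G (Z f1 b1 t) - l1))%C by ring.
    eapply Rle_trans; [apply Cmod_triangle|]; rewrite Cmod_opp; lra. }
symmetry; apply Cmod_small_eq; intros; lra.
Qed.

End TwoLines.

(** The upper end in [G_tail_increment] tends to infinity, and every limit equals that of the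
    reference line [(c, b0)]. Multiplied by [exp (Re F)], the bound depends only on the line and no
    longer on its point. *)
Lemma common_line_limit : c <= d -> exists l, forall phi b t, c <= phi <= d -> b0 <= b ->
  Cmod (G (Z phi b t) - l)%C <= exp (K - Re (F (Z phi b t))) * kappa * rho phi b.
Proof.
intros Hcd; destruct (line_limit c b0) as [l Hl]; [lra|lra|].
exists l; intros phi b t Hp Hb.
destruct (line_limit phi b Hp Hb) as [l' Hl'].
rewrite (line_limits_agree c b0 phi b ltac:(lra) Hp ltac:(lra) Hb l l' Hl Hl').
rewrite Cmod_sub_sym; apply (tends_bound _ _ _ _ Hl').
exists t; intros s Hs.
eapply Rle_trans; [apply (G_tail_increment phi b t); trivial; lra|].
apply Rmult_le_compat_l; [apply Rmult_le_pos; trivial; apply Rlt_le, exp_pos|].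
apply Hnu; trivial.
Qed.

End LineEnds.

(** * Solutions of the conjugated system *)

Lemma RInt_flip (f : R -> R) (s t : R) : ex_RInt f (- t) (- s) ->
  ex_RInt (fun u => f (- u)) s t /\ RInt (fun u => f (- u)) s t = RInt f (- t) (- s).
Proof.
intros Hex.
assert (H : is_RInt (fun u => f (- u)) s t (RInt f (- t) (- s))).
{ pose proof (RInt_correct (V := R_CompleteNormedModule) _ _ _ Hex) as H.
  apply (is_RInt_swap (V := R_NormedModule)) in H.
  apply (is_RInt_comp_opp (V := R_NormedModule)) in H.
  apply (is_RInt_opp (V := R_NormedModule)) in H.
  replace (RInt f (- t) (- s)) with
    (opp (G := R_AbelianGroup) (opp (G := R_AbelianGroup) (RInt f (- t) (- s)))) by apply Ropp_involutive.
  eapply is_RInt_ext; [|exact H].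
  intros u _; apply Ropp_involutive. }
split; [eexists; exact H|apply (is_RInt_unique (V := R_CompleteNormedModule)), H].
Qed.

Section Construction.
Variables (n : nat) (V : C -> Prop) (p0 : C) (lam L : nat -> C -> C) (Rm : nat -> nat -> C -> C).
Variables (c d b0 eta K kap : R) (nu : R -> R -> R -> R) (rho : R -> R -> R).
Hypothesis Vopen : copen V.
Hypothesis Vstar : star_shaped V p0.
Hypothesis Hcd : c <= d.
Hypothesis Heta : 0 < eta < b0.
Hypothesis HV : forall phi b t, c - eta < phi < d + eta -> b0 - eta < b -> V (line_curve phi b t).
Hypothesis Hp0 : p0 = line_curve c b0 0.
Hypothesis HL : forall i p, (i < n)%nat -> V p -> Cder (L i) p (lam i p * proj p)%C.
Hypothesis HL0 : forall i, (i < n)%nat -> L i p0 = 0%C.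
Hypothesis HR : forall i j, (i < n)%nat -> (j < n)%nat -> holo V (Rm i j).
Hypothesis Hkap : 0 <= kap.
Hypothesis Hnu0 : forall phi b t, 0 <= nu phi b t.
Hypothesis Hnu : forall phi b s t, c <= phi <= d -> b0 <= b -> s <= t ->
  ex_RInt (nu phi b) s t /\ RInt (nu phi b) s t <= rho phi b.
Hypothesis HRnu : forall i j phi b t, (i < n)%nat -> (j < n)%nat -> c <= phi <= d -> b0 <= b ->
  Cmod (Rm i j (line_curve phi b t)) <= kap * nu phi b t.
Hypothesis HK : forall i j, (i < n)%nat -> (j < n)%nat ->
  (forall phi b s t, c <= phi <= d -> b0 <= b -> s <= t ->
     Re (L i (line_curve phi b t) - L j (line_curve phi b t))%C -
     Re (L i (line_curve phi b s) - L j (line_curve phi b s))%C <= K) \/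
  (forall phi b s t, c <= phi <= d -> b0 <= b -> s <= t ->
     - K <= Re (L i (line_curve phi b t) - L j (line_curve phi b t))%C -
     Re (L i (line_curve phi b s) - L j (line_curve phi b s))%C).

(** The bound of one integration step per unit of L1 norm: [kap] compares entries with the matrix
    norm, [n] counts the terms of a row, and [exp K] is the loss allowed by the L-condition. *)
Let kappa0 : R := exp K * (INR n * kap).

Hypothesis Hrho1 : forall phi b, c <= phi <= d -> b0 <= b -> rho phi b <= 1.
Hypothesis Hrho : forall phi b, c <= phi <= d -> b0 <= b -> INR n * (2 * kappa0 * rho phi b) <= / 2.
Hypothesis Hn : (1 <= n)%nat.

(* [Y = exp L * v] turns [dY = (Lam + R) Y dz] into [dv = conjugated v dzeta]; the last
   factor is [dz / dzeta]. *)
Definition conjugated i m (p : C) : C := (proj (- L i p) * Rm i m p * proj (L m p) * proj p)%C.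

Lemma holo_L i : (i < n)%nat -> holo V (L i).
Proof. intros Hi p Hp; eexists; apply HL; trivial. Qed.

Lemma holo_proj_comp (f : C -> C) : holo V f -> holo V (fun p => proj (f p)).
Proof. intros Hf p Hp; destruct (Hf p Hp) as [l Hl]; eexists; apply Cder_comp; [apply Cder_proj|exact Hl]. Qed.

Lemma holo_proj : holo V proj.
Proof. intros p _; eexists; apply Cder_proj. Qed.

Lemma holo_conjugated i m : (i < n)%nat -> (m < n)%nat -> holo V (conjugated i m).
Proof.
intros Hi Hm; unfold conjugated.
repeat apply holo_mult; auto using holo_proj, holo_L, holo_proj_comp, holo_opp.
Qed.

Lemma line_in_V phi b t : c <= phi <= d -> b0 <= b -> V (line_curve phi b t).
Proof. intros H1 H2; apply HV; lra. Qed.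

Lemma rho_pos phi b : c <= phi <= d -> b0 <= b -> 0 <= rho phi b.
Proof.
intros H1 H2; destruct (Hnu phi b 0 0 H1 H2 (Rle_refl 0)) as [_ H].
rewrite RInt_point in H; exact H.
Qed.

Lemma kappa0_pos : 0 <= kappa0.
Proof.
apply Rmult_le_pos; [apply Rlt_le, exp_pos|apply Rmult_le_pos; trivial; apply pos_INR].
Qed.

Lemma kappa0_rho phi b : c <= phi <= d -> b0 <= b -> kappa0 * rho phi b <= / 2.
Proof.
intros H1 H2; pose proof (Hrho phi b H1 H2) as H.
pose proof (Rmult_le_pos _ _ kappa0_pos (rho_pos phi b H1 H2)) as Hp.
assert (1 <= INR n) by (apply (le_INR 1), Hn).
nra.
Qed.

(** The weights [exp (L m - L j)] absorb the conjugation: the integrand becomes R applied to the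
    weighted vector, up to the factor [exp (- Re (L i - L j))], which the choice of the end
    compensates. That choice depends on [(i, j)] alone, so a single limit serves all lines. *)
Lemma increment_operator (j : nat) (u : nat -> C -> C) (W : R) : (j < n)%nat ->
  (forall m, (m < n)%nat -> holo V (u m)) ->
  (forall m phi b t, (m < n)%nat -> c <= phi <= d -> b0 <= b ->
     Cmod (proj (L m (line_curve phi b t) - L j (line_curve phi b t)) * u m (line_curve phi b t))%C <= W) ->
  forall i, (i < n)%nat -> exists q : C -> C,
    (forall p, V p -> Cder q p (csum n (fun m => conjugated i m p * u m p)%C)) /\
    forall phi b t, c <= phi <= d -> b0 <= b ->
      Cmod (proj (L i (line_curve phi b t) - L j (line_curve phi b t)) * q (line_curve phi b t))%C
        <= kappa0 * W * rho phi b.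
Proof.
intros Hj Hu HW i Hi.
assert (HW0 : 0 <= W)
  by (eapply Rle_trans; [apply Cmod_ge_0|apply (HW i c b0 0 Hi); lra]).
set (g := fun p => csum n (fun m => proj (- L i p) * Rm i m p * proj (L m p) * u m p)%C).
assert (Hg : holo V g).
{ apply holo_csum; intros m Hm.
  repeat apply holo_mult; auto using holo_proj, holo_L, holo_proj_comp, holo_opp. }
assert (HG : forall p, V p -> Cder (Prim (fun z => g z * proj z)%C p0) p (g p * proj p)%C).
{ apply Cder_Prim; trivial; apply (holo_mult V g proj Hg holo_proj). }
assert (HF : forall p, V p -> Ccont (fun z => L i z - L j z)%C p).
{ intros p Hp; apply (Cder_cont _ _ _ (Cder_minus _ _ _ _ _ (HL i p Hi Hp) (HL j p Hj Hp))). }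
assert (Hgc : forall p, V p -> Ccont g p)
  by (intros p Hp; destruct (Hg p Hp) as [l Hl]; apply (Cder_cont _ _ _ Hl)).
(* Increments of [Re (L i - L j)] bounded above select the end t = -infinity, reached by reversing
   the line; increments bounded below select t = +infinity. *)
assert (Hsg : exists sg, (sg = 1 \/ sg = -1) /\ forall phi b s t, c <= phi <= d -> b0 <= b -> s <= t ->
  Re (L i (line_curve phi b (sg * s)) - L j (line_curve phi b (sg * s)))%C -
  Re (L i (line_curve phi b (sg * t)) - L j (line_curve phi b (sg * t)))%C <= K).
{ destruct (HK i j Hi Hj) as [H|H].
  - exists (-1); split; [right; trivial|]; intros phi b s t H1 H2 Hst.
    apply H; trivial; lra.
  - exists 1; split; [left; trivial|]; intros phi b s t H1 H2 Hst.
    specialize (H phi b (1 * s) (1 * t) H1 H2 ltac:(lra)); lra. }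
destruct Hsg as [sg [Hsg HKsg]].
assert (Hkk : 0 <= INR n * (kap * W))
  by (apply Rmult_le_pos; [apply pos_INR|apply Rmult_le_pos; trivial]).
destruct (common_line_limit V g (Prim (fun z => g z * proj z)%C p0) (fun z => L i z - L j z)%C
  sg c d b0 eta K (INR n * (kap * W)) (fun phi b t => nu phi b (sg * t)) rho
  Hsg Heta HV HG Hgc HF Hkk) as [l Hl]; trivial.
- intros phi b s t H1 H2 Hst; destruct Hsg as [->| ->].
  + destruct (Hnu phi b s t H1 H2 Hst) as [E1 E2].
    assert (Hext : forall x, nu phi b x = nu phi b (1 * x)) by (intros; rewrite Rmult_1_l; trivial).
    split.
    * apply (ex_RInt_ext (V := R_NormedModule) (nu phi b)); [intros; apply Hext|exact E1].
    * rewrite (RInt_ext (V := R_CompleteNormedModule) _ (nu phi b)); [exact E2|intros; symmetry; apply Hext].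
  + destruct (Hnu phi b (- t) (- s) H1 H2 ltac:(lra)) as [E1 E2].
    destruct (RInt_flip (nu phi b) s t E1) as [E3 E4].
    assert (Hext : forall x, nu phi b (- x) = nu phi b (-1 * x)) by (intros; f_equal; ring).
    split.
    * apply (ex_RInt_ext (V := R_NormedModule) (fun x => nu phi b (- x))); [intros; apply Hext|exact E3].
    * rewrite (RInt_ext (V := R_CompleteNormedModule) _ (fun x => nu phi b (- x)));
        [rewrite E4; exact E2|intros; symmetry; apply Hext].
- intros phi b t H1 H2; set (z := line_curve phi b (sg * t)).
  (* Inserting [exp (- L j) * exp (L j)] isolates the weighted vector, whose entries are bounded by
     W. *)
  assert (E : g z = (proj (- (L i z - L j z)) *
    csum n (fun m => Rm i m z * (proj (L m z - L j z) * u m z)))%C).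
  { unfold g; rewrite <- csum_scal; apply csum_ext; intros m _.
    replace (- (L i z - L j z))%C with (- L i z + L j z)%C by ring.
    replace (L m z - L j z)%C with (L m z + - L j z)%C by ring.
    rewrite !proj_plus.
    replace (proj (- L i z) * proj (L j z) * (Rm i m z * (proj (L m z) * proj (- L j z) * u m z)))%C with
      (proj (- L i z) * Rm i m z * proj (L m z) * u m z * (proj (- L j z) * proj (L j z)))%C by ring.
    rewrite proj_opp_l; ring. }
  rewrite E, Cmod_mult, Cmod_proj.
  replace (Re (- (L i z - L j z))%C) with (- Re (L i z - L j z)%C) by reflexivity.
  apply Rmult_le_compat_l; [apply Rlt_le, exp_pos|].
  replace (INR n * (kap * W) * nu phi b (sg * t)) with (INR n * (kap * nu phi b (sg * t) * W)) by ring.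
  apply Cmod_csum_le; intros m Hm; rewrite Cmod_mult.
  apply Rmult_le_compat; try apply Cmod_ge_0; [apply HRnu|apply HW]; trivial.
(* Subtracting l turns the primitive based at p0 into the one that vanishes at the chosen end of
   every line. *)
- exists (fun p => Prim (fun z => g z * proj z)%C p0 p - l)%C; split.
  + intros p Hp; apply (Cder_eq _ _ (g p * proj p - 0)%C).
    * apply Cder_minus; [apply HG, Hp|apply Cder_const].
    * unfold g, conjugated.
      replace (csum n (fun m => proj (- L i p) * Rm i m p * proj (L m p) * u m p) * proj p - 0)%C with
        (csum n (fun m => proj (- L i p) * Rm i m p * proj (L m p) * u m p) * proj p)%C by ring.
      rewrite <- csum_scal_r; apply csum_ext; intros; ring.
  + intros phi b t H1 H2.
    specialize (Hl phi b (sg * t) H1 H2).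
    replace (sg * (sg * t)) with t in Hl by (destruct Hsg as [->| ->]; ring).
    set (z := line_curve phi b t) in *.
    rewrite Cmod_mult, Cmod_proj.
    apply (Rmult_le_compat_l (exp (Re (L i z - L j z)%C))) in Hl; [|apply Rlt_le, exp_pos].
    eapply Rle_trans; [exact Hl|]; right.
    unfold Rminus at 1; rewrite exp_plus, exp_Ropp; unfold kappa0; field.
    apply Rgt_not_eq, exp_pos.
Qed.

(** Two weighted bounds on the increments are kept: 2^-k, uniform over the lines, which feeds the
    recursion, and [kappa0 * 2^-k * rho], whose sum over k gives the asymptotics. *)
Lemma column_exists (j : nat) : (j < n)%nat ->
  exists v, solves V n conjugated v /\
    forall i phi b t, (i < n)%nat -> c <= phi <= d -> b0 <= b ->
    Cmod (proj (L i (line_curve phi b t) - L j (line_curve phi b t)) * v i (line_curve phi b t) - delta i j)%C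
      <= 2 * kappa0 * rho phi b.
Proof.
intros Hj.
destruct (dependent_choice_indexed
  (fun k (u : nat -> C -> C) => (forall m, (m < n)%nat -> holo V (u m)) /\
    forall m phi b t, (m < n)%nat -> c <= phi <= d -> b0 <= b ->
    Cmod (proj (L m (line_curve phi b t) - L j (line_curve phi b t)) * u m (line_curve phi b t))%C <= (/ 2) ^ k)
  (fun k u u' => forall i, (i < n)%nat ->
    (forall p, V p -> Cder (u' i) p (csum n (fun m => conjugated i m p * u m p)%C)) /\
    forall phi b t, c <= phi <= d -> b0 <= b ->
      Cmod (proj (L i (line_curve phi b t) - L j (line_curve phi b t)) * u' i (line_curve phi b t))%C
        <= kappa0 * (/ 2) ^ k * rho phi b)
  (fun m _ => delta m j)) as [f [Hf0 Hf]].
- split.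
  + intros m Hm p _; exists 0%C; apply Cder_const.
  + intros m phi b t Hm _ _; simpl; unfold delta.
    destruct (Nat.eq_dec m j) as [->|E].
    * replace (L j (line_curve phi b t) - L j (line_curve phi b t))%C with (RtoC 0) by ring.
      rewrite proj_0, Cmult_1_l, Cmod_1; lra.
    * rewrite Cmult_0_r, Cmod_0; lra.
- intros k u [Hu1 Hu2].
  destruct (choice_on (fun _ => RtoC 0) (fun i => (i < n)%nat) (fun i (q : C -> C) =>
    (forall p, V p -> Cder q p (csum n (fun m => conjugated i m p * u m p)%C)) /\
    forall phi b t, c <= phi <= d -> b0 <= b ->
      Cmod (proj (L i (line_curve phi b t) - L j (line_curve phi b t)) * q (line_curve phi b t))%C
        <= kappa0 * (/ 2) ^ k * rho phi b)) as [q Hq].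
  { exact (increment_operator j u ((/ 2) ^ k) Hj Hu1 Hu2). }
  exists q.
  split; [split|exact Hq].
  + intros i Hi p Hp; eexists; apply (Hq i Hi), Hp.
  + intros i phi b t Hi H1 H2; eapply Rle_trans; [apply (Hq i Hi); trivial|].
    pose proof (kappa0_rho phi b H1 H2); pose proof (half_pow_pos k); simpl; nra.
- assert (Lp : forall i phi b t, (i < n)%nat -> c <= phi <= d -> b0 <= b -> forall x M,
    Cmod (proj (L i (line_curve phi b t) - L j (line_curve phi b t)) * x)%C <= M ->
    Cmod x <= exp (- Re (L i (line_curve phi b t) - L j (line_curve phi b t))%C) * M).
  { intros i phi b t Hi H1 H2 x M H; rewrite Cmod_mult, Cmod_proj in H.
    set (e := Re _) in *.
    apply (Rmult_le_compat_l (exp (- e))) in H; [|apply Rlt_le, exp_pos].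
    rewrite <- Rmult_assoc, <- exp_plus, Rplus_opp_l, exp_0, Rmult_1_l in H; exact H. }
  destruct (increments_sum V p0 n conjugated Vopen Vstar holo_conjugated f 1) as [v [Hv Hlim]].
  + lra.
  + intros i p Hi Hp; rewrite Hf0; apply Cder_const.
  + intros k i p Hi Hp; apply (proj2 (Hf k) i Hi), Hp.
  (* All the [L i] vanish at p0, so the weights are 1 there and the weighted bound is one on the
     increments themselves. *)
  + intros k i Hi; rewrite Rmult_1_l.
    pose proof (proj2 (proj1 (Hf k)) i c b0 0 Hi ltac:(lra) (Rle_refl b0)) as H.
    rewrite <- Hp0, !HL0 in H by trivial.
    replace (0 - 0)%C with (RtoC 0) in H by ring; rewrite proj_0, Cmult_1_l in H; exact H.
  + exists v; split; trivial.
    intros i phi b t Hi H1 H2; set (z := line_curve phi b t).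
    assert (Hz : V z) by (apply line_in_V; trivial).
    set (e := (L i z - L j z)%C).
    pose proof (Rmult_le_pos _ _ kappa0_pos (rho_pos phi b H1 H2)) as Hkr.
    assert (B : Cmod (v i z - delta i j)%C <= exp (- Re e) * (2 * kappa0 * rho phi b)).
    { apply (geo_limit_le _ _ _ _ (Hlim i z Hi Hz)); exists 1%nat; intros [|k] Hk; [lia|].
      pose proof (exp_pos (- Re e)) as He.
      (* The term of index 0 is [delta i j] itself; the weighted bounds of the next k terms sum to
         [kappa0 * rho * (1 + 1/2 + ...)], that is [2 * kappa0 * rho * (1 - 2^-k)]. *)
      apply Rle_trans with (exp (- Re e) * (2 * kappa0 * rho phi b) * (1 - (/ 2) ^ k)).
      - clear Hk; induction k as [|k IH].
        + simpl; rewrite Hf0.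
          replace (0 + delta i j - delta i j)%C with (RtoC 0) by ring; rewrite Cmod_0; lra.
        + change (csum (S (S k)) (fun l => f l i z)) with (csum (S k) (fun l => f l i z) + f (S k) i z)%C.
          replace (csum (S k) (fun l => f l i z) + f (S k) i z - delta i j)%C with
            ((csum (S k) (fun l => f l i z) - delta i j) + f (S k) i z)%C by ring.
          eapply Rle_trans; [apply Cmod_triangle|].
          pose proof (Lp i phi b t Hi H1 H2 _ _ (proj2 (proj2 (Hf k) i Hi) phi b t H1 H2)) as H.
          fold z in H; fold e in H.
          replace (exp (- Re e) * (2 * kappa0 * rho phi b) * (1 - (/ 2) ^ S k)) with
            (exp (- Re e) * (2 * kappa0 * rho phi b) * (1 - (/ 2) ^ k) +
             exp (- Re e) * (kappa0 * (/ 2) ^ k * rho phi b)) by (simpl; field).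
          lra.
      - rewrite <- (Rmult_1_r (exp (- Re e) * (2 * kappa0 * rho phi b))) at 2.
        apply Rmult_le_compat_l; [|pose proof (half_pow_pos k); lra].
        apply Rmult_le_pos; lra. }
    replace (proj e * v i z - delta i j)%C with (proj e * (v i z - delta i j))%C.
    * rewrite Cmod_mult, Cmod_proj.
      apply (Rmult_le_compat_l (exp (Re e))) in B; [|apply Rlt_le, exp_pos].
      rewrite <- Rmult_assoc, <- exp_plus, Rplus_opp_r, exp_0, Rmult_1_l in B; exact B.
    * unfold delta; destruct (Nat.eq_dec i j) as [->|E]; [|ring].
      unfold e; replace (L j z - L j z)%C with (RtoC 0) by ring; rewrite proj_0; ring.
Qed.

Lemma conjugated_solution : exists v w : nat -> nat -> C -> C,
  (forall j, (j < n)%nat -> solves V n conjugated (fun i => v i j)) /\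
  (forall i j phi b t, (i < n)%nat -> (j < n)%nat -> c <= phi <= d -> b0 <= b ->
    Cmod (proj (L i (line_curve phi b t) - L j (line_curve phi b t)) * v i j (line_curve phi b t) - delta i j)%C
      <= 2 * kappa0 * rho phi b) /\
  (forall i j, (i < n)%nat -> (j < n)%nat -> forall p, V p ->
     Cder (w i j) p (- csum n (fun m => w i m p * conjugated m j p))%C) /\
  (forall i j, (i < n)%nat -> (j < n)%nat -> forall p, V p ->
     csum n (fun m => w i m p * v m j p)%C = delta i j) /\
  (forall i j, (i < n)%nat -> (j < n)%nat -> forall p, V p ->
     csum n (fun m => v i m p * w m j p)%C = delta i j).
Proof.
destruct (choice_on (fun _ _ => RtoC 0) (fun j => (j < n)%nat) (fun j v => solves V n conjugated v /\
    forall i phi b t, (i < n)%nat -> c <= phi <= d -> b0 <= b ->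
    Cmod (proj (L i (line_curve phi b t) - L j (line_curve phi b t)) * v i (line_curve phi b t) - delta i j)%C
      <= 2 * kappa0 * rho phi b) column_exists) as [v' Hv].
pose (v := fun i j => v' j i).
assert (Vp0 : V p0) by (rewrite Hp0; apply line_in_V; lra).
(* The weights being 1 at p0, the entries of v there are within [2 * kappa0 * rho] of the identity,
   and [Hrho] keeps n times this at most 1/2. *)
destruct (near_identity_inverse n (fun i j => v i j p0 - delta i j)%C (2 * kappa0 * rho c b0))
  with (a := fun i j => v i j p0) as [bb [Hb1 Hb2]].
- intros i j Hi Hj.
  pose proof (proj2 (Hv j Hj) i c b0 0 Hi ltac:(lra) (Rle_refl b0)) as H.
  rewrite <- Hp0, !HL0 in H by trivial.
  replace (0 - 0)%C with (RtoC 0) in H by ring; rewrite proj_0, Cmult_1_l in H; exact H.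
- apply Hrho; lra.
- intros; ring.
- destruct (inverse_solution V p0 n conjugated v bb Vopen Vstar Vp0) as [w [W1 [W2 W3]]]; trivial.
  + apply holo_conjugated.
  + intros j Hj; apply (Hv j Hj).
  + exists v, w; split; [intros j Hj; apply (Hv j Hj)|].
    split; [|split; [|split]]; trivial.
    intros i j phi b t Hi Hj; apply (Hv j Hj); trivial.
Qed.

End Construction.

(** * Exponentials and curve integrals *)

Lemma Cder_pow k p : Cder (fun z => z ^ S k)%C p (INR (S k) * p ^ k)%C.
Proof.
induction k as [|k IH].
- apply (Cder_ext (fun z => z)); [intros; simpl; ring|].
  apply (Cder_eq _ _ 1%C); [apply Cder_id|simpl; ring].
- apply (Cder_ext (fun z => z * z ^ S k)%C); [intros; reflexivity|].
  apply (Cder_eq _ _ (1 * p ^ S k + p * (INR (S k) * p ^ k))%C).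
  + apply Cder_mult; [apply Cder_id|exact IH].
  + rewrite (S_INR (S k)), RtoC_plus; simpl; ring.
Qed.

(** The terms p^k / k! are the successive increments of the scalar equation v' = v, and at 0 all but
    the first vanish. Hence they sum to a solution v with v(0) = 1, and [v z * proj (- z)] is
    constant. *)
Lemma exp_series_limit (p : C) :
  geo_limit (fun k => csum k (fun l => p ^ l / INR (fact l))%C) (proj p).
Proof.
assert (Ho : copen (fun _ => True)) by (intros q _; exists 1; split; [lra|trivial]).
assert (Hs : star_shaped (fun _ => True) 0%C) by (intros q s _ _; trivial).
assert (Hf : forall k, RtoC (INR (fact k)) <> 0%C) by (intros k; apply RtoC_neq_0, INR_fact_neq_0).
destruct (increments_sum (fun _ => True) 0%C 1 (fun _ _ _ => 1%C) Ho Hs)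
  with (d := fun k (_ : nat) (z : C) => (z ^ k / INR (fact k))%C) (c := 1) as [v [Hv Hlim]].
- intros i j _ _ q _; exists 0%C; apply Cder_const.
- lra.
- intros i q _ _; exact (Cder_const (1 / INR (fact 0))%C q).
- intros k i q _ _; simpl csum.
  apply (Cder_ext (fun z => / INR (fact (S k)) * z ^ S k)%C).
  { intros z; unfold Cdiv; ring. }
  apply (Cder_eq _ _ (/ INR (fact (S k)) * (INR (S k) * q ^ k))%C); [apply Cder_scal, Cder_pow|].
  rewrite fact_simpl, mult_INR, RtoC_mult; field; split; [apply Hf|].
  apply RtoC_neq_0, not_0_INR; lia.
- intros [|k] i _.
  + simpl; replace (1 / 1)%C with (RtoC 1) by field; rewrite Cmod_1; lra.
  + replace (0 ^ S k / INR (fact (S k)))%C with (RtoC 0).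
    * rewrite Cmod_0, Rmult_1_l; apply Rlt_le, half_pow_pos.
    * simpl Cpow; field; apply Hf.
- specialize (Hv 0%nat).
  assert (E : forall q, (v 0%nat q * proj (- q))%C = (v 0%nat 0 * proj (- 0))%C).
  { intros q; apply (constant_on_star (fun _ => True) 0%C Hs (fun q => v 0%nat q * proj (- q))%C); trivial.
    intros z _; apply (Cder_eq _ _ ((0 + 1 * v 0%nat z) * proj (- z) + v 0%nat z * (proj (- z) * - (1)))%C).
    - apply (Cder_mult (v 0%nat) (fun q => proj (- q)%C)); [apply Hv; trivial; lia|].
      apply (Cder_comp proj (fun z => - z)%C z (proj (- z)) (- (1))%C); [apply Cder_proj|].
      apply (Cder_opp (fun z => z)), Cder_id.
    - ring. }
  assert (E0 : v 0%nat 0%C = 1%C).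
  { apply (geo_limit_unique _ _ _ (Hlim 0%nat 0%C ltac:(lia) Logic.I)).
    exists 1; intros [|k]; simpl csum.
    - replace (0 - 1)%C with (- (1))%C by ring; rewrite Cmod_opp, Cmod_1; simpl; lra.
    - assert (E1 : forall k, (csum k (fun l => 0 ^ l / INR (fact l)) + 0 ^ k / INR (fact k))%C = 1%C).
      { clear k; induction k as [|k IH]; [simpl; field|].
        simpl csum; rewrite IH; simpl Cpow; field; apply Hf. }
      rewrite E1; rewrite Cmod_sub_diag, Rmult_1_l.
      apply Rlt_le, half_pow_pos. }
  specialize (E p).
  replace (- 0)%C with (RtoC 0) in E by ring; rewrite E0, proj_0, Cmult_1_l in E.
  replace (proj p) with (v 0%nat p); [apply (Hlim 0%nat p); trivial; lia|].
  rewrite <- (Cmult_1_l (proj p)), <- E, <- Cmult_assoc, proj_opp_l; ring.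
Qed.

Lemma is_series_geo (s : nat -> R) (l : R) (c : R) :
  (forall k, Rabs (sum_n s k - l) <= c * (/ 2) ^ k) -> Series s = l.
Proof.
intros H; apply is_series_unique.
intros P [eps HP].
destruct (half_pow_small (Rabs c) eps (cond_pos eps)) as [k0 Hk0].
exists k0; intros k Hk; apply HP.
change (Rabs (sum_n s k - l) < eps).
eapply Rle_lt_trans; [apply H|]; eapply Rle_lt_trans; [|exact Hk0].
apply geo_tail, Hk.
Qed.

Lemma Re_div_RtoC (z : C) (r : R) : r <> 0 -> Re (z / RtoC r)%C = Re z / r.
Proof.
intros Hr; unfold Cdiv; rewrite <- RtoC_inv by trivial.
destruct z as [x y]; unfold Re, RtoC, Cmult; simpl; unfold Rdiv; ring.
Qed.

Lemma Im_div_RtoC (z : C) (r : R) : r <> 0 -> Im (z / RtoC r)%C = Im z / r.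
Proof.
intros Hr; unfold Cdiv; rewrite <- RtoC_inv by trivial.
destruct z as [x y]; unfold Im, RtoC, Cmult; simpl; unfold Rdiv; ring.
Qed.

Lemma exp_series (p : C) :
  (Series (fun k => Re (p ^ k)%C / INR (fact k)), Series (fun k => Im (p ^ k)%C / INR (fact k))) = proj p.
Proof.
destruct (exp_series_limit p) as [c Hc].
assert (ERe : forall k, sum_n (fun k => Re (p ^ k)%C / INR (fact k)) k = Re (csum (S k) (fun l => p ^ l / INR (fact l))%C)).
{ assert (E : forall k, Re (p ^ k / INR (fact k))%C = Re (p ^ k)%C / INR (fact k)).
  { intros k; apply Re_div_RtoC, INR_fact_neq_0. }
  induction k as [|k IH].
  - rewrite sum_O, <- E; change (csum 1 _) with (0 + p ^ 0 / INR (fact 0))%C; rewrite Cplus_0_l; reflexivity.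
  - rewrite sum_Sn, IH, <- E; reflexivity. }
assert (EIm : forall k, sum_n (fun k => Im (p ^ k)%C / INR (fact k)) k = Im (csum (S k) (fun l => p ^ l / INR (fact l))%C)).
{ assert (E : forall k, Im (p ^ k / INR (fact k))%C = Im (p ^ k)%C / INR (fact k)).
  { intros k; apply Im_div_RtoC, INR_fact_neq_0. }
  induction k as [|k IH].
  - rewrite sum_O, <- E; change (csum 1 _) with (0 + p ^ 0 / INR (fact 0))%C; rewrite Cplus_0_l; reflexivity.
  - rewrite sum_Sn, IH, <- E; reflexivity. }
assert (Hb : forall k, Cmod (csum (S k) (fun l => p ^ l / INR (fact l)) - proj p)%C <= Rabs c * (/ 2) ^ k).
{ intros k; eapply Rle_trans; [apply Hc|]; simpl; pose proof (half_pow_pos k); pose proof (Rle_abs c); pose proof (Rabs_pos c); nra. }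
rewrite (surjective_pairing (proj p)); f_equal; apply (is_series_geo _ _ (Rabs c)); intros k;
  (eapply Rle_trans; [|apply (Hb k)]).
- rewrite ERe; change (fst (proj p)) with (Re (proj p)); rewrite <- Re_minus; apply re_le_Cmod.
- rewrite EIm; change (snd (proj p)) with (Im (proj p)); rewrite <- Im_minus; apply im_le_Cmod.
Qed.

Lemma sum_n_csum (f : nat -> C) k : sum_n f k = csum (S k) f.
Proof.
induction k as [|k IH].
- rewrite sum_O; simpl; ring.
- rewrite sum_Sn, IH; reflexivity.
Qed.

Lemma entry_mult {n : nat} (A B : @matrix C n n) i j : (i < n)%nat -> (j < n)%nat ->
  entry (mult A B) i j = csum n (fun m => entry A i m * entry B m j)%C.
Proof.
intros Hi Hj; unfold mult; simpl; unfold Mmult; rewrite entry_mk by trivial.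
rewrite sum_n_csum; replace (S (Init.Nat.pred n)) with n by lia; reflexivity.
Qed.

Lemma entry_one {n : nat} i j : (i < n)%nat -> (j < n)%nat ->
  entry (one : @matrix C n n) i j = delta i j.
Proof.
intros Hi Hj; unfold one; simpl; unfold Mone; rewrite entry_mk by trivial.
unfold delta; destruct (Nat.eq_dec i j) as [->|E].
- clear Hi Hj; induction j as [|j IH]; simpl; [reflexivity|exact IH].
- clear Hi Hj; revert j E; induction i as [|i IH]; intros [|j] E; simpl; try reflexivity; [congruence|].
  apply IH; congruence.
Qed.

Lemma entry_mexp_diagonal {n : nat} (A : @matrix C n n) (z : nat -> C) :
  (forall i j, (i < n)%nat -> (j < n)%nat -> entry A i j = (delta i j * z i)%C) ->
  forall i j, (i < n)%nat -> (j < n)%nat -> entry (mexp A) i j = (delta i j * proj (z i))%C.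
Proof.
intros HA i j Hi Hj.
assert (Hpow : forall k i j, (i < n)%nat -> (j < n)%nat -> entry (pow_n A k) i j = (delta i j * z i ^ k)%C).
{ clear i j Hi Hj; induction k as [|k IH]; intros i j Hi Hj.
  - simpl pow_n; rewrite entry_one by trivial; simpl; ring.
  - simpl pow_n; rewrite entry_mult by trivial.
    rewrite (csum_ext n _ (fun m => delta i m * (z i * (delta m j * z m ^ k)))%C).
    2:{ intros m Hm; rewrite HA, IH by trivial; ring. }
    rewrite csum_delta_l by trivial; simpl; ring. }
unfold mexp; rewrite entry_mk by trivial.
rewrite (Series_ext _ (fun k => Re (delta i j * z i ^ k)%C / INR (fact k)))
  by (intros; rewrite Hpow; trivial).
rewrite (Series_ext (fun k => Im _ / _) (fun k => Im (delta i j * z i ^ k)%C / INR (fact k)))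
  by (intros; rewrite Hpow; trivial).
unfold delta; destruct (Nat.eq_dec i j).
- rewrite <- exp_series, Cmult_1_l; f_equal; apply Series_ext; intros; rewrite Cmult_1_l; trivial.
- rewrite Cmult_0_l.
  rewrite (is_series_geo _ 0 0), (is_series_geo _ 0 0); trivial.
  + intros k; rewrite (sum_n_ext _ (fun _ => 0)), sum_n_const, Rmult_0_r, Rminus_0_r, Rabs_R0; [lra|].
    intros; rewrite Cmult_0_l; unfold Im; simpl; unfold Rdiv; ring.
  + intros k; rewrite (sum_n_ext _ (fun _ => 0)), sum_n_const, Rmult_0_r, Rminus_0_r, Rabs_R0; [lra|].
    intros; rewrite Cmult_0_l; unfold Re; simpl; unfold Rdiv; ring.
Qed.

Lemma velocityE (gamma : R -> C) t l : Rder gamma t l -> velocity gamma t = (proj (gamma t) * l)%C.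
Proof.
intros H; destruct (Rder_proj _ _ _ H) as [H1 H2].
apply injective_projections; apply is_derive_unique; [exact H1|exact H2].
Qed.

Lemma Rcont_mult (f h : R -> C) t : Rcont f t -> Rcont h t -> Rcont (fun u => f u * h u)%C t.
Proof.
intros [H1 H2] [H3 H4]; split.
- apply (continuous_minus (K := R_AbsRing) (V := R_NormedModule)
    (fun u => Re (f u) * Re (h u)) (fun u => Im (f u) * Im (h u)));
    apply (continuous_mult (K := R_AbsRing)); assumption.
- apply (continuous_plus (K := R_AbsRing) (V := R_NormedModule)
    (fun u => Re (f u) * Im (h u)) (fun u => Im (f u) * Re (h u)));
    apply (continuous_mult (K := R_AbsRing)); assumption.
Qed.

(** The velocity is taken in the plane, so it equals [proj (gamma u)] times the derivative of gamma
    in the logarithmic coordinate; the integrand is thus the derivative of [G (gamma u)]. *)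
Lemma curve_int_primitive (f G : C -> C) (gamma : R -> C) (s t : R) :
  s <= t ->
  (forall u, s <= u <= t -> Cder G (gamma u) (f (gamma u) * proj (gamma u))%C) ->
  (forall u, s <= u <= t -> Ccont f (gamma u)) ->
  (forall u, s <= u <= t -> exists l, Rder gamma u l) ->
  (forall u, s <= u <= t -> Rcont (velocity gamma) u) ->
  curve_int f gamma s t = (G (gamma t) - G (gamma s))%C.
Proof.
intros Hst HG Hf Hg Hv.
assert (HD : forall u, s <= u <= t -> Rder (fun u => G (gamma u)) u (f (gamma u) * velocity gamma u)%C).
{ intros u Hu; destruct (Hg u Hu) as [l Hl]; rewrite (velocityE _ _ _ Hl), Cmult_assoc.
  apply (Rder_comp G); [apply HG, Hu|exact Hl]. }
assert (HC : forall u, s <= u <= t -> Rcont (fun u => f (gamma u) * velocity gamma u)%C u).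
{ intros u Hu; apply Rcont_mult; [|apply Hv, Hu].
  destruct (Hg u Hu) as [l Hl]; apply Rcont_comp; [apply Hf, Hu|apply (Rder_Rcont _ _ _ Hl)]. }
unfold curve_int; apply (is_RInt_unique (V := C_R_CompleteNormedModule)).
apply (is_RInt_fct_extend_pair (U := R_NormedModule) (V := R_NormedModule)).
- apply (is_RInt_increment (fun u => Re (G (gamma u)))
    (fun u => Re (f (gamma u) * velocity gamma u)%C)); trivial; intros u Hu; [apply HD, Hu|apply HC, Hu].
- apply (is_RInt_increment (fun u => Im (G (gamma u)))
    (fun u => Im (f (gamma u) * velocity gamma u)%C)); trivial; intros u Hu; [apply HD, Hu|apply HC, Hu].
Qed.

Lemma C1_path_int (S : C -> Prop) (f G : C -> C) p q gamma :
  C1_path S p q gamma ->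
  (forall z, S z -> Cder G z (f z * proj z)%C) ->
  (forall z, S z -> Ccont f z) ->
  curve_int f gamma 0 1 = (G q - G p)%C.
Proof.
intros [<- [<- Hg]] HG Hf.
apply curve_int_primitive; [lra| | | |].
- intros u Hu; apply HG, Hg, Hu.
- intros u Hu; apply Hf, Hg, Hu.
- intros u Hu; destruct (Hg u Hu) as [_ [[x Hx] [[y Hy] _]]].
  exists (x, y); split; assumption.
- intros u Hu; destruct (Hg u Hu) as [_ [_ [_ Hc]]]; split.
  + apply (continuous_comp (V := C_UniformSpace) (velocity gamma) (fun z : C => fst z) u Hc).
    destruct (velocity gamma u); apply continuous_fst.
  + apply (continuous_comp (V := C_UniformSpace) (velocity gamma) (fun z : C => snd z) u Hc).
    destruct (velocity gamma u); apply continuous_snd.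
Qed.

(** Without a path from z0 to z the identity in [has_asymptotics] would be void at z; the segment
    supplies one. *)
Lemma seg_C1_path (S : C -> Prop) p q :
  (forall s, 0 <= s <= 1 -> S (seg p q s)) -> C1_path S p q (seg p q).
Proof.
intros HS; split; [apply seg_0|split; [apply seg_1|]].
intros t Ht; destruct (Rder_seg p q t) as [H1 H2].
split; [apply HS, Ht|split; [eexists; exact H1|split; [eexists; exact H2|]]].
apply (continuous_ext (fun u => (proj (seg p q u) * (q - p))%C)).
{ intros u; symmetry; apply velocityE, Rder_seg. }
destruct (Rder_Rcont _ _ _ (Rder_scal (q - p)%C _ _ _ (Rder_proj _ _ _ (Rder_seg p q t)))) as [K1 K2].
apply (continuous_ext (fun u => (Re ((q - p) * proj (seg p q u))%C, Im ((q - p) * proj (seg p q u))%C))).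
{ intros u; rewrite (Cmult_comm (proj _)); symmetry; apply surjective_pairing. }
intros P [eps HP].
pose proof (K1 (ball (Re ((q - p) * proj (seg p q t))%C) eps) (locally_ball _ eps)) as L1.
pose proof (K2 (ball (Im ((q - p) * proj (seg p q t))%C) eps) (locally_ball _ eps)) as L2.
unfold filtermap in *.
apply (filter_imp _ _ (fun u Hu => HP (_, _) (conj (proj1 Hu) (proj2 Hu))) (filter_and _ _ L1 L2)).
Qed.

Lemma line_curve_int (f G : C -> C) phi b s t : 0 < b -> s <= t ->
  (forall u, Cder G (line_curve phi b u) (f (line_curve phi b u) * proj (line_curve phi b u))%C) ->
  (forall u, Ccont f (line_curve phi b u)) ->
  curve_int f (line_curve phi b) s t = (G (line_curve phi b t) - G (line_curve phi b s))%C.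
Proof.
intros Hb Hst HG Hf.
assert (HD : forall u, exists l, Rder (line_curve phi b) u l /\ (proj (line_curve phi b u) * l)%C = (cis phi * (0, -1)%R)%C).
{ intros u.
  destruct (Rder_line_family (fun _ => phi) (fun _ => b) (fun u => u) u 0 0 1 Hb) as [l [Hl E]].
  - apply is_derive_cst.
  - apply is_derive_cst.
  - apply (is_derive_id (K := R_AbsRing)).
  - exists l; split; [exact Hl|]; rewrite E; f_equal; f_equal; ring. }
apply curve_int_primitive; auto.
- intros u _; destruct (HD u) as [l [Hl _]]; exists l; exact Hl.
- intros u _.
  assert (E : velocity (line_curve phi b) = fun _ => (cis phi * (0, -1)%R)%C).
  { apply functional_extensionality; intros v; destruct (HD v) as [l [Hl <-]]; apply velocityE, Hl. }
  rewrite E; split; apply continuous_const.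
Qed.

(** * Existence and uniqueness *)

Lemma open_itv_convex alpha beta x y z :
  in_open_itv alpha beta x -> in_open_itv alpha beta y -> x <= z <= y -> in_open_itv alpha beta z.
Proof.
intros [H1 _] [_ H2] Hz; split; [destruct alpha|destruct beta]; simpl in *; trivial; lra.
Qed.

Lemma open_itv_open alpha beta x : in_open_itv alpha beta x ->
  exists eta, 0 < eta /\ forall y, Rabs (y - x) < eta -> in_open_itv alpha beta y.
Proof.
intros [H1 H2].
assert (L : exists e, 0 < e /\ forall y, x - e < y -> Rbar_lt alpha y).
{ destruct alpha as [r| |]; simpl in *; [|contradiction|exists 1; split; [lra|trivial]].
  exists (x - r); split; [lra|intros; lra]. }
assert (U : exists e, 0 < e /\ forall y, y < x + e -> Rbar_lt y beta).
{ destruct beta as [r| |]; simpl in *; [|exists 1; split; [lra|trivial]|contradiction].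
  exists (r - x); split; [lra|intros; lra]. }
destruct L as [e [He L]]; destruct U as [e' [He' U]].
exists (Rmin e e'); split; [apply Rmin_glb_lt; trivial|].
intros y Hy; apply Rabs_lt_between in Hy.
pose proof (Rmin_l e e'); pose proof (Rmin_r e e').
split; [apply L|apply U]; lra.
Qed.

Lemma point_on_line phi (z : C) : phi - PI / 2 < arg z < phi + PI / 2 ->
  exists t, z = line_curve phi (modulus z * cos (phi - arg z)) t.
Proof.
intros Hz; set (u := phi - arg z).
assert (Hu : - (PI / 2) < u < PI / 2) by (unfold u; lra).
assert (Hc : 0 < cos u) by (apply cos_gt_0; lra).
assert (Hm : 0 < modulus z) by apply exp_pos.
set (b := modulus z * cos u); assert (Hb : 0 < b) by (apply Rmult_lt_0_compat; trivial).
exists (b * tan u); unfold line_curve.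
replace (b * tan u / b) with (tan u) by (field; lra).
rewrite atan_tan by exact Hu.
replace (b ^ 2 + (b * tan u) ^ 2) with (modulus z ^ 2).
- rewrite sqrt_pow2 by lra; unfold modulus; rewrite ln_exp.
  unfold u, arg; rewrite (surjective_pairing z) at 1; unfold Re, Im; f_equal; ring.
- unfold b, tan; pose proof (sin2_cos2 u) as Hsc; unfold Rsqr in Hsc.
  transitivity (modulus z ^ 2 * (sin u * sin u + cos u * cos u)); [rewrite Hsc; ring|field; lra].
Qed.

Lemma line_in_half_planes (I : R -> Prop) a phi b t :
  0 < a -> a <= b -> I phi -> half_planes I a (line_curve phi b t).
Proof.
intros Ha Hb HI; exists phi; split; trivial.
destruct (line_curve_height phi b t ltac:(lra)) as [H1 H2].
apply half_planeE; split; [exact H1|lra].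
Qed.

(* Turning [phi] towards [arg z] by at most [del] gives a line through [z] whose distance
   to the origin is at least [|z| sin del]. *)
Lemma far_point_on_line c d a del (z : C) : 0 < a -> 0 < del < PI / 2 ->
  half_planes (in_closed_itv c d) a z ->
  exists phi b t, c - del <= phi <= d + del /\ modulus z * sin del <= b /\ z = line_curve phi b t.
Proof.
intros Ha Hdel [phi [[H1 H2] [H3 _]]].
pose proof (exp_pos (Re z)) as Hm; fold (modulus z) in Hm.
set (u := phi - arg z).
assert (Hpsi : exists psi, c - del <= psi <= d + del /\ psi - PI / 2 < arg z < psi + PI / 2 /\
  sin del <= cos (psi - arg z)).
{ destruct (Rle_dec del u) as [C1|C1]; [|destruct (Rle_dec u (- del)) as [C2|C2]].
  - exists (phi - del); split; [lra|]; split; [unfold u in *; lra|].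
    rewrite <- cos_shift; apply cos_decr_1; unfold u in *; lra.
  - exists (phi + del); split; [lra|]; split; [unfold u in *; lra|].
    rewrite <- cos_shift, <- (cos_neg (phi + del - arg z)); apply cos_decr_1; unfold u in *; lra.
  - exists (arg z); unfold u in *; split; [lra|]; split; [lra|].
    rewrite Rminus_diag, cos_0; apply SIN_bound. }
destruct Hpsi as [psi [K1 [K2 K3]]].
destruct (point_on_line psi z K2) as [t Ht].
exists psi, (modulus z * cos (psi - arg z)), t; split; trivial; split; trivial.
apply Rmult_le_compat_l; lra.
Qed.

Section System.
Variables (n : nat) (N : @matrix C n n -> R) (a : R) (alpha beta : Rbar) (Lam Rem : C -> @matrix C n n) (z0 : C).
Hypothesis Hn : (1 <= n)%nat.
Hypothesis HN : is_matrix_norm N.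
Hypothesis Ha : 0 < a.
Let I := in_open_itv alpha beta.
Let H := half_planes I a.
Hypothesis HLam : mx_holomorphic_on H Lam.
Hypothesis Hdiag : forall z, H z -> is_diagonal (Lam z).
Hypothesis HLcond : L_condition Lam a I.
Hypothesis HRem : mx_holomorphic_on H Rem.
Hypothesis Hdecay : good_decay N Rem a I.
Hypothesis Hz0 : H z0.

Let lam i z := entry (Lam z) i i.
Let Rm i j z := entry (Rem z) i j.

Lemma H_segment p q s : H p -> H q -> 0 <= s <= 1 -> H (seg p q s).
Proof.
intros Hp Hq Hs; apply half_planes_convex; trivial.
intros x y z; apply open_itv_convex.
Qed.

Lemma H_star p : H p -> star_shaped H p.
Proof. intros Hp q s Hq Hs; apply H_segment; trivial. Qed.

Lemma coefficients_domain : exists U, copen U /\ (forall p, H p -> U p) /\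
  forall i j, (i < n)%nat -> (j < n)%nat -> holo U (fun z => entry (Lam z) i j) /\ holo U (Rm i j).
Proof.
destruct (common_neighbourhood H (fun i U => forall j, (j < n)%nat ->
  holo U (fun z => entry (Lam z) i j) /\ holo U (Rm i j)) n) as [U [H1 [H2 H3]]].
- intros i U U' HU K j Hj; destruct (K j Hj) as [K1 K2]; split; intros p Hp; auto.
- intros i Hi.
  apply (common_neighbourhood H (fun j U => holo U (fun z => entry (Lam z) i j) /\ holo U (Rm i j))).
  + intros j U U' HU [K1 K2]; split; intros p Hp; auto.
  + intros j Hj.
    destruct (proj1 (holomorphic_onE _ _) (HLam i j Hi Hj)) as [U [O1 [S1 K1]]].
    destruct (proj1 (holomorphic_onE _ _) (HRem i j Hi Hj)) as [U' [O2 [S2 K2]]].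
    (* The two coefficients are numbered 0 and 1, so that the same lemma intersects their
       neighbourhoods. *)
    destruct (common_neighbourhood H (fun k V => match k with
      | O => holo V (fun z => entry (Lam z) i j) | _ => holo V (Rm i j) end) 2) as [V [O3 [S3 K3]]].
    * intros [|k] W W' HW K p Hp; auto.
    * intros [|k] _; [exists U|exists U']; auto.
    * exists V; split; trivial; split; trivial; split; [apply (K3 0%nat)|apply (K3 1%nat)]; lia.
- exists U; split; trivial; split; trivial; intros i j Hi Hj; apply H3; trivial.
Qed.

(** The base point is a parameter because two are used: z0, which normalizes the exponential in the
    asymptotics, and a point of a far line, from which the solution is built. *)
Lemma star_domain p0 : H p0 -> exists V, copen V /\ star_shaped V p0 /\ (forall p, H p -> V p) /\
  forall i j, (i < n)%nat -> (j < n)%nat -> holo V (fun z => entry (Lam z) i j) /\ holo V (Rm i j).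
Proof.
intros Hp0; destruct coefficients_domain as [U [HU [HS HF]]].
destruct (star_core U H p0 HU HS (fun p s Hp Hs => H_segment p0 p s Hp0 Hp Hs)) as [V [V1 [V2 [V3 V4]]]].
exists V; split; trivial; split; trivial; split; trivial.
intros i j Hi Hj; destruct (HF i j Hi Hj) as [K1 K2]; split; intros p Hp; auto.
Qed.

Lemma holo_lam_proj V i : (forall i j, (i < n)%nat -> (j < n)%nat ->
  holo V (fun z => entry (Lam z) i j) /\ holo V (Rm i j)) -> (i < n)%nat ->
  holo V (fun z => lam i z * proj z)%C.
Proof.
intros HF Hi; apply holo_mult; [apply (HF i i Hi Hi)|apply holo_proj].
Qed.

Lemma lam_cont i p : (i < n)%nat -> H p -> Ccont (lam i) p.
Proof.
intros Hi Hp; destruct coefficients_domain as [U [_ [HS HF]]].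
destruct (proj1 (HF i i Hi Hi) p (HS p Hp)) as [l Hl]; apply (Cder_cont _ _ _ Hl).
Qed.

Lemma lam_primitive_exists : exists PL : nat -> C -> C,
  (forall i p, (i < n)%nat -> H p -> Cder (PL i) p (lam i p * proj p)%C) /\
  (forall i, PL i z0 = 0%C).
Proof.
destruct (star_domain z0 Hz0) as [V [V1 [V2 [V3 V4]]]].
exists (fun i => Prim (fun z => lam i z * proj z)%C z0); split.
- intros i p Hi Hp; apply (Cder_Prim V z0 (fun z => lam i z * proj z)%C); auto; apply holo_lam_proj; trivial.
- intros i; apply Prim_base.
Qed.

Variable PL : nat -> C -> C.
Hypothesis HPL : forall i p, (i < n)%nat -> H p -> Cder (PL i) p (lam i p * proj p)%C.
Hypothesis HPL0 : forall i, PL i z0 = 0%C.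

Lemma entry_mexp_path gamma z : C1_path H z0 z gamma ->
  forall i j, (i < n)%nat -> (j < n)%nat ->
  entry (mexp (mx_curve_int Lam gamma 0 1)) i j = (delta i j * proj (PL i z))%C.
Proof.
intros Hg; apply entry_mexp_diagonal; intros i j Hi Hj.
unfold mx_curve_int; rewrite entry_mk by trivial.
unfold delta; destruct (Nat.eq_dec i j) as [<-|E].
- rewrite (C1_path_int H _ (PL i) z0 z gamma Hg).
  + rewrite HPL0; ring.
  + intros p Hp; apply HPL; trivial.
  + intros p Hp; apply lam_cont; trivial.
- rewrite (C1_path_int H _ (fun _ => 0%C) z0 z gamma Hg).
  + ring.
  + intros p Hp; rewrite (Hdiag p Hp i j Hi Hj E); apply (Cder_eq _ _ 0%C); [apply Cder_const|].
    transitivity (0 * proj p)%C; [ring|reflexivity].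
  + intros p Hp; destruct coefficients_domain as [U [_ [HS HF]]].
    destruct (proj1 (HF i j Hi Hj) p (HS p Hp)) as [l Hl]; apply (Cder_cont _ _ _ Hl).
Qed.

(* [exp (- PL j)] is the j-th diagonal entry of [exp (- int_z0^z Lam)]. *)
Definition entry_asymptotics (c d : R) (Y : C -> @matrix C n n) : Prop :=
  forall eps, 0 < eps -> exists M, forall z, half_planes (in_closed_itv c d) a z -> M <= modulus z ->
  forall i j, (i < n)%nat -> (j < n)%nat ->
    Cmod (entry (Y z) i j * proj (- PL j z) - delta i j)%C <= eps.

Lemma sub_half_planes c d z : closed_subitv c d I -> half_planes (in_closed_itv c d) a z -> H z.
Proof. intros [_ Hs] [phi [H1 H2]]; exists phi; split; auto. Qed.

(** The identity determines E as [Y exp (- PL) - 1], and by equivalence of norms its smallness can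
    be read entry by entry. *)
Lemma has_asymptoticsE Y :
  has_asymptotics N Lam a I z0 Y <->
  forall c d, closed_subitv c d I -> entry_asymptotics c d Y.
Proof.
assert (Path : forall z, H z -> C1_path H z0 z (seg z0 z))
  by (intros z Hz; apply seg_C1_path; intros s Hs; apply H_segment; trivial).
assert (Ent : forall (E : @matrix C n n) gamma z, C1_path H z0 z gamma ->
  forall i j, (i < n)%nat -> (j < n)%nat ->
  entry (mult (plus one E) (mexp (mx_curve_int Lam gamma 0 1))) i j =
  ((delta i j + entry E i j) * proj (PL j z))%C).
{ intros E gamma z Hg i j Hi Hj; rewrite entry_mult by trivial.
  rewrite (csum_ext n _ (fun m => (delta i m + entry E i m) * proj (PL m z) * delta m j)%C).
  - rewrite csum_delta_r by trivial; reflexivity.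
  - intros m Hm; rewrite (entry_mexp_path gamma z Hg) by trivial.
    replace (entry (plus one E) i m) with (entry (one : @matrix C n n) i m + entry E i m)%C
      by (symmetry; apply entry_plus; trivial).
    rewrite entry_one by trivial; ring. }
split.
- intros HA c d Hcd eps Heps.
  destruct (HA c d Hcd) as [E [HE HY]].
  destruct (matrix_norm_lower n N HN) as [A [HA0 HAl]].
  assert (He : 0 < eps / (1 + A)) by (apply Rdiv_lt_0_compat; lra).
  destruct (HE (mkposreal _ He)) as [M HM]; exists M; intros z Hz Hmz i j Hi Hj.
  assert (HH := sub_half_planes c d z Hcd Hz).
  rewrite (HY z Hz _ (Path z HH)), (Ent _ _ z) by auto.
  replace ((delta i j + entry (E z) i j) * proj (PL j z) * proj (- PL j z) - delta i j)%C with
    ((delta i j + entry (E z) i j) * (proj (- PL j z) * proj (PL j z)) - delta i j)%C by ring.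
  rewrite proj_opp_l.
  replace ((delta i j + entry (E z) i j) * 1 - delta i j)%C with (entry (E z) i j) by ring.
  specialize (HM z Hz Hmz); simpl in HM.
  eapply Rle_trans; [apply (HAl (E z) i j Hi Hj)|].
  apply Rle_trans with ((1 + A) * (eps / (1 + A))); [|right; field; lra].
  apply Rmult_le_compat; try lra; apply matrix_norm_pos; trivial.
- intros HA c d Hcd.
  exists (fun z => mk_matrix n n (fun i j => entry (Y z) i j * proj (- PL j z) - delta i j)%C); split.
  + intros eps; destruct (matrix_norm_upper n N HN) as [A [HA0 HAu]].
    assert (He : 0 < eps / (2 * (1 + A))) by (apply Rdiv_lt_0_compat; [apply cond_pos|lra]).
    destruct (HA c d Hcd _ He) as [M HM]; exists M; intros z Hz Hmz.
    apply Rle_lt_trans with (A * (eps / (2 * (1 + A)))).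
    * apply HAu; [lra|]; intros i j Hi Hj; rewrite entry_mk by trivial; apply HM; trivial.
    * apply Rle_lt_trans with ((1 + A) * (eps / (2 * (1 + A)))); [apply Rmult_le_compat_r; lra|].
      replace ((1 + A) * (eps / (2 * (1 + A)))) with (eps / 2) by (field; lra).
      pose proof (cond_pos eps); lra.
  + intros z Hz gamma Hg; apply matrix_ext; intros i j Hi Hj.
    rewrite (Ent _ _ z) by trivial; rewrite entry_mk by trivial.
    replace ((delta i j + (entry (Y z) i j * proj (- PL j z) - delta i j)) * proj (PL j z))%C with
      (entry (Y z) i j * (proj (- PL j z) * proj (PL j z)))%C by ring.
    rewrite proj_opp_l; ring.
Qed.

(** The integrals in the L-condition are increments of [PL i - PL j] along lines; the finitely many
    pairs [(i, j)] share one constant. *)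
Lemma L_condition_bound c d : closed_subitv c d I -> exists K, 0 <= K /\
  forall i j, (i < n)%nat -> (j < n)%nat ->
  (forall phi b s t, c <= phi <= d -> a <= b -> s <= t ->
     Re (PL i (line_curve phi b t) - PL j (line_curve phi b t))%C -
     Re (PL i (line_curve phi b s) - PL j (line_curve phi b s))%C <= K) \/
  (forall phi b s t, c <= phi <= d -> a <= b -> s <= t ->
     - K <= Re (PL i (line_curve phi b t) - PL j (line_curve phi b t))%C -
     Re (PL i (line_curve phi b s) - PL j (line_curve phi b s))%C).
Proof.
intros Hcd.
assert (E : forall i j, (i < n)%nat -> (j < n)%nat -> forall phi b s t, c <= phi <= d -> a <= b -> s <= t ->
  line_int_values Lam a c d i j (Re (PL i (line_curve phi b t) - PL j (line_curve phi b t))%C -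
     Re (PL i (line_curve phi b s) - PL j (line_curve phi b s))%C)).
{ intros i j Hi Hj phi b s t Hp Hb Hst; exists phi, b, s, t.
  split; [exact Hp|split; [exact Hb|split; [exact Hst|]]].
  assert (HL : forall u, H (line_curve phi b u))
    by (intros u; apply line_in_half_planes; trivial; apply Hcd; exact Hp).
  rewrite (line_curve_int _ (fun z => PL i z - PL j z)%C); trivial; [lra| |].
  - intros u; apply (Cder_eq _ _ (lam i (line_curve phi b u) * proj (line_curve phi b u) -
      lam j (line_curve phi b u) * proj (line_curve phi b u))%C).
    + apply Cder_minus; apply HPL; trivial.
    + unfold lam; ring.
  - intros u; destruct coefficients_domain as [U [_ [HS HF]]].
    destruct (proj1 (HF i i Hi Hi) _ (HS _ (HL u))) as [l Hl].
    destruct (proj1 (HF j j Hj Hj) _ (HS _ (HL u))) as [l' Hl'].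
    apply (Cder_cont _ _ _ (Cder_minus _ _ _ _ _ Hl Hl')). }
assert (K0 : forall i j, (i < n)%nat -> (j < n)%nat -> exists K,
  (forall x, line_int_values Lam a c d i j x -> x <= K) \/
  (forall x, line_int_values Lam a c d i j x -> - K <= x)).
{ intros i j Hi Hj; destruct (HLcond i j Hi Hj c d Hcd) as [K1 [K2 [[HK _]|HK]]].
  - exists K1; left; intros x Hx.
    destruct (Lub_Rbar_correct (line_int_values Lam a c d i j)) as [Hub _].
    exact (Rbar_le_trans _ _ _ (Hub x Hx) HK).
  - exists (- K2); right; intros x Hx; rewrite Ropp_involutive.
    destruct (Glb_Rbar_correct (line_int_values Lam a c d i j)) as [Hlb _].
    exact (Rbar_le_trans _ _ _ HK (Hlb x Hx)). }
(* The radius is a dummy here; only the common bound is wanted. *)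
destruct (common_radius n (fun i _ K => forall j, (j < n)%nat ->
  (forall x, line_int_values Lam a c d i j x -> x <= K) \/
  (forall x, line_int_values Lam a c d i j x -> - K <= x))) as [_ [K [_ [HK0 HK]]]].
- intros i _ _ M M' _ HM HH j Hj; destruct (HH j Hj) as [HH'|HH']; [left|right]; intros x Hx;
    specialize (HH' x Hx); lra.
- intros i Hi.
  destruct (common_radius n (fun j _ K =>
    (forall x, line_int_values Lam a c d i j x -> x <= K) \/
    (forall x, line_int_values Lam a c d i j x -> - K <= x))) as [_ [K [_ [HK0 HK]]]].
  + intros j _ _ M M' _ HM [HH'|HH']; [left|right]; intros x Hx; specialize (HH' x Hx); lra.
  + intros j Hj; destruct (K0 i j Hi Hj) as [K HK]; exists 1, K; split; [lra|exact HK].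
  + exists 1, K; split; [lra|exact HK].
- exists K; split; trivial; intros i j Hi Hj.
  destruct (HK i Hi j Hj) as [HK'|HK']; [left|right]; intros phi b s t Hp Hb Hst;
    apply HK', E; trivial.
Qed.

Lemma entry_coefficient z i j : H z -> (i < n)%nat -> (j < n)%nat ->
  entry (plus (Lam z) (Rem z)) i j = (delta i j * lam i z + Rm i j z)%C.
Proof.
intros Hz Hi Hj; rewrite entry_plus by trivial; fold (Rm i j z); f_equal.
unfold delta; destruct (Nat.eq_dec i j) as [<-|E]; [unfold lam; ring|].
rewrite (Hdiag z Hz i j Hi Hj E); change (zero : C) with (RtoC 0); ring.
Qed.

(** The inverse comes with its own differential equation, dZ = - Z (Lam + Rem) dz, so that [Z Y']
    can be differentiated for another solution [Y']. *)
Definition has_inverse (Y : C -> @matrix C n n) (Z : nat -> nat -> C -> C) : Prop :=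
  (forall i j z, (i < n)%nat -> (j < n)%nat -> H z ->
     Cder (Z i j) z (- csum n (fun m => Z i m z * entry (plus (Lam z) (Rem z)) m j) * proj z)%C) /\
  (forall i j z, (i < n)%nat -> (j < n)%nat -> H z ->
     csum n (fun m => Z i m z * entry (Y z) m j)%C = delta i j) /\
  (forall i j z, (i < n)%nat -> (j < n)%nat -> H z ->
     csum n (fun m => entry (Y z) i m * Z m j z)%C = delta i j).

Lemma solution_unique phi Y Z Y' : I phi ->
  has_inverse Y Z ->
  fundamental_solution H (fun z => plus (Lam z) (Rem z)) Y' ->
  entry_asymptotics phi phi Y -> entry_asymptotics phi phi Y' ->
  forall z, H z -> Y' z = Y z.
Proof.
intros Hphi [HZ [HZY HYZ]] [_ [_ HY']] HA HA'.
pose (Cst := fun i j z => csum n (fun m => Z i m z * entry (Y' z) m j)%C).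
assert (HC : forall i j z, (i < n)%nat -> (j < n)%nat -> H z -> Cst i j z = Cst i j z0).
{ intros i j z Hi Hj; apply (constant_on_star H z0 (H_star z0 Hz0) (Cst i j)); clear z; intros z Hz.
  apply (Cder_eq _ _ (csum n (fun m =>
    (- csum n (fun l => Z i l z * entry (plus (Lam z) (Rem z)) l m) * proj z) * entry (Y' z) m j +
    Z i m z * (entry (mult (plus (Lam z) (Rem z)) (Y' z)) m j * proj z)))%C).
  - apply Cder_csum; intros m Hm; apply (Cder_mult (Z i m) (fun z => entry (Y' z) m j)).
    + apply HZ; trivial.
    + apply is_derive_Cder, (HY' z Hz m j Hm Hj).
  - rewrite csum_plus.
    rewrite (csum_ext n (fun m => _ * entry (Y' z) m j)%C (fun m => csum n (fun l =>
      - (Z i l z * entry (plus (Lam z) (Rem z)) l m * entry (Y' z) m j * proj z)))%C).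
    2:{ intros m _; rewrite csum_opp, csum_scal_r.
        rewrite csum_scal_r; ring. }
    rewrite (csum_ext n (fun m => Z i m z * _)%C (fun m => csum n (fun l =>
      Z i m z * entry (plus (Lam z) (Rem z)) m l * entry (Y' z) l j * proj z))%C).
    2:{ intros m Hm; rewrite entry_mult by trivial.
        rewrite <- csum_scal_r, <- csum_scal; apply csum_ext; intros; ring. }
    rewrite csum_swap, <- csum_plus; apply csum_0; intros m Hm.
    rewrite <- csum_plus; apply csum_0; intros; ring. }
assert (HY : forall i j z, (i < n)%nat -> (j < n)%nat -> H z ->
  entry (Y' z) i j = csum n (fun m => entry (Y z) i m * Cst m j z0)%C).
{ intros i j z Hi Hj Hz.
  rewrite (csum_ext n _ (fun m => csum n (fun l => entry (Y z) i m * Z m l z * entry (Y' z) l j))%C).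
  - rewrite csum_swap, (csum_ext n _ (fun l => delta i l * entry (Y' z) l j)%C).
    + rewrite csum_delta_l by trivial; reflexivity.
    + intros l Hl; rewrite csum_scal_r, HYZ by trivial; reflexivity.
  - intros m Hm; rewrite <- (HC m j z Hm Hj Hz); unfold Cst; rewrite <- csum_scal.
    apply csum_ext; intros; ring. }
assert (Hcd : closed_subitv phi phi I).
{ split; [lra|]; intros x Hx; replace x with phi; [exact Hphi|unfold in_closed_itv in Hx; lra]. }
destruct (L_condition_bound phi phi Hcd) as [K [HK0 HK]].
assert (HX : forall eps, 0 < eps -> exists M, forall t, M <= Rabs t -> forall i j, (i < n)%nat -> (j < n)%nat ->
  Cmod (proj (PL i (line_curve phi a t) - PL j (line_curve phi a t)) * Cst i j z0 - delta i j)%C <= eps).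
{ intros eps Heps.
  (* [/ (2 n)] is what [near_identity_bound] asks of E; eps / 4 absorbs its factor 2 and the two
     terms of E' - E. *)
  set (e := Rmin (eps / 4) (/ (2 * INR n))).
  assert (Hn1 : 1 <= INR n) by (apply (le_INR 1), Hn).
  assert (He : 0 < e) by (apply Rmin_glb_lt; [lra|apply Rinv_0_lt_compat; lra]).
  destruct (HA e He) as [M HM]; destruct (HA' e He) as [M' HM'].
  exists (Rmax M M'); intros t Ht i j Hi Hj.
  set (z := line_curve phi a t).
  assert (Hz : half_planes (in_closed_itv phi phi) a z)
    by (apply line_in_half_planes; [exact Ha|lra|unfold in_closed_itv; lra]).
  assert (HHz : H z) by (apply (sub_half_planes phi phi); trivial).
  assert (Hmod : Rabs t <= modulus z).
  { unfold z; rewrite modulus_line_curve, <- sqrt_Rsqr_abs by exact Ha; apply sqrt_le_1_alt.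
    unfold Rsqr; pose proof (pow2_ge_0 a); simpl; lra. }
  specialize (HM z Hz ltac:(pose proof (Rmax_l M M'); lra)).
  specialize (HM' z Hz ltac:(pose proof (Rmax_r M M'); lra)).
  set (E := fun i j => (entry (Y z) i j * proj (- PL j z) - delta i j)%C).
  set (E' := fun i j => (entry (Y' z) i j * proj (- PL j z) - delta i j)%C).
  (* With C the constant matrix, Y' = Y C reads (1 + E) exp(PL) C exp(- PL) = 1 + E'. For X =
     exp(PL) C exp(- PL) - 1, here in column j, this is X + E X = E' - E. *)
  set (X := fun m => (proj (PL m z - PL j z) * Cst m j z0 - delta m j)%C).
  replace eps with (2 * (2 * (eps / 4))) by field.
  apply (near_identity_bound n E e) with (x := X) (r := fun i => (E' i j - E i j)%C); trivial.
  - assert (e <= / (2 * INR n)) by apply Rmin_r.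
    apply Rle_trans with (INR n * / (2 * INR n)); [apply Rmult_le_compat_l; lra|].
    right; field; lra.
  - intros k Hk.
    rewrite (csum_ext n _ (fun m => (entry (Y z) k m * Cst m j z0) * proj (- PL j z)
      - delta k m * (X m + delta m j) - E k m * delta m j)%C).
    + rewrite !csum_minus, csum_scal_r, <- (HY k j z Hk Hj HHz).
      rewrite csum_delta_l, csum_delta_r by trivial.
      unfold E'; ring.
    + intros m Hm; unfold X, E.
      replace (PL m z - PL j z)%C with (PL m z + - PL j z)%C by ring; rewrite proj_plus.
      replace (entry (Y z) k m * Cst m j z0 * proj (- PL j z))%C with
        (entry (Y z) k m * (proj (- PL m z) * proj (PL m z)) * Cst m j z0 * proj (- PL j z))%C
        by (rewrite proj_opp_l; ring).
      ring.
  - intros k Hk; eapply Rle_trans; [apply Cmod_triangle|]; rewrite Cmod_opp.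
    assert (e <= eps / 4) by apply Rmin_l.
    pose proof (HM k j Hk Hj) as B1; pose proof (HM' k j Hk Hj) as B2.
    fold (E k j) in B1; fold (E' k j) in B2; lra. }
assert (HCd : forall i j, (i < n)%nat -> (j < n)%nat -> Cst i j z0 = delta i j).
{ intros i j Hi Hj; destruct (Nat.eq_dec i j) as [<-|E].
  - apply Cmod_small_eq; intros e He; destruct (HX e He) as [M HM].
    specialize (HM (Rabs M) ltac:(rewrite Rabs_Rabsolu; apply Rle_abs) i i Hi Hi).
    replace (PL i (line_curve phi a (Rabs M)) - PL i (line_curve phi a (Rabs M)))%C with (RtoC 0) in HM by ring.
    rewrite proj_0, Cmult_1_l in HM; exact HM.
  - assert (D : delta i j = 0%C) by (unfold delta; destruct (Nat.eq_dec i j); [contradiction|trivial]).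
    rewrite D.
    set (F := fun t => Re (PL i (line_curve phi a t) - PL j (line_curve phi a t))%C).
    (* Towards t = -infinity when the increments of F are bounded above, and towards t = +infinity
       when they are bounded below, F stays above [F 0 - K]; there the weight cannot hide a nonzero
       constant. *)
    assert (HF : forall M, exists t, M <= Rabs t /\ F 0 - K <= F t).
    { intros M; destruct (HK i j Hi Hj) as [HK'|HK'].
      - exists (- Rabs M); split; [rewrite Rabs_Ropp, Rabs_Rabsolu; apply Rle_abs|].
        pose proof (HK' phi a (- Rabs M) 0 ltac:(lra) ltac:(lra) ltac:(pose proof (Rabs_pos M); lra)).
        unfold F; lra.
      - exists (Rabs M); split; [rewrite Rabs_Rabsolu; apply Rle_abs|].
        pose proof (HK' phi a 0 (Rabs M) ltac:(lra) ltac:(lra) (Rabs_pos M)).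
        unfold F; lra. }
    apply Cmod_small_eq; intros e He.
    pose proof (exp_pos (F 0 - K)) as Hexp.
    destruct (HX (exp (F 0 - K) * e)) as [M HM]; [apply Rmult_lt_0_compat; trivial|].
    destruct (HF M) as [t [Ht HFt]].
    specialize (HM t Ht i j Hi Hj); rewrite D in HM.
    set (p := (PL i (line_curve phi a t) - PL j (line_curve phi a t))%C) in HM.
    replace (proj p * Cst i j z0 - 0)%C with (proj p * (Cst i j z0 - 0))%C in HM by ring.
    rewrite Cmod_mult, Cmod_proj in HM.
    assert (HE : exp (F 0 - K) <= exp (Re p)).
    { change (Re p) with (F t); destruct HFt as [HFt|HFt]; [apply Rlt_le, exp_increasing, HFt|rewrite HFt; lra]. }
    apply (Rmult_le_reg_l (exp (F 0 - K))); trivial.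
    eapply Rle_trans; [|exact HM]; apply Rmult_le_compat_r; [apply Cmod_ge_0|exact HE]. }
intros z Hz; apply matrix_ext; intros i j Hi Hj.
rewrite HY by trivial.
rewrite (csum_ext n _ (fun m => entry (Y z) i m * delta m j)%C).
- apply csum_delta_r; trivial.
- intros m Hm; rewrite HCd by trivial; reflexivity.
Qed.

Lemma decay_bound c d : closed_subitv c d I -> forall eps, 0 < eps -> exists B, forall phi b,
  c <= phi <= d -> B < b -> L1_norm_on_line N Rem phi b <= eps.
Proof.
intros Hcd eps Heps; destruct (Hdecay c d Hcd) as [_ Hlim].
destruct (Hlim (mkposreal eps Heps)) as [B HB]; exists B; intros phi b Hp Hb.
specialize (HB b Hb); simpl in HB.
destruct (Lub_Rbar_correct (fun x => exists phi, in_closed_itv c d phi /\ x = L1_norm_on_line N Rem phi b)) as [Hub _].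
assert (E : Rbar_le (L1_norm_on_line N Rem phi b) (sup_L1_norm N Rem c d b))
  by (apply Hub; exists phi; split; [exact Hp|reflexivity]).
apply Rlt_le; exact (Rbar_le_lt_trans _ _ _ E HB).
Qed.

Lemma solution_exists_on c d : closed_subitv c d I -> exists Y Z,
  fundamental_solution H (fun z => plus (Lam z) (Rem z)) Y /\ has_inverse Y Z /\ entry_asymptotics c d Y.
Proof.
intros [Hcd Hsub].
destruct (open_itv_open alpha beta c (Hsub c ltac:(split; lra))) as [ec [Hec Ic]].
destruct (open_itv_open alpha beta d (Hsub d ltac:(split; lra))) as [ed [Hed Id]].
(* One [del] is spent on turning the lines, a second on the open range of angles required by
   differentiation, and the third keeps these angles strictly inside I. The cap keeps [del] below PI
   / 2 and below the margin left in b. *)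
set (del := Rmin 1 (Rmin ec ed) / 3).
assert (Hdel : 0 < del) by (apply Rdiv_lt_0_compat; [repeat apply Rmin_glb_lt; lra|lra]).
assert (Hdel1 : 3 * del <= 1) by (unfold del; pose proof (Rmin_l 1 (Rmin ec ed)); lra).
assert (Hdelc : 3 * del <= ec)
  by (unfold del; pose proof (Rmin_r 1 (Rmin ec ed)); pose proof (Rmin_l ec ed); lra).
assert (Hdeld : 3 * del <= ed)
  by (unfold del; pose proof (Rmin_r 1 (Rmin ec ed)); pose proof (Rmin_r ec ed); lra).
assert (HI : forall x, c - 2 * del <= x <= d + 2 * del -> I x).
{ intros x Hx; destruct (Rlt_dec x c); [apply Ic, Rabs_lt_between; lra|].
  destruct (Rlt_dec d x); [apply Id, Rabs_lt_between; lra|apply Hsub; split; lra]. }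
set (c1 := c - del); set (d1 := d + del).
assert (Hcd1 : closed_subitv c1 d1 I).
{ unfold c1, d1; split; [lra|]; intros x [Hx1 Hx2]; apply HI; lra. }
destruct (matrix_norm_lower n N HN) as [kap [Hkap HNl]].
destruct (L_condition_bound c1 d1 Hcd1) as [K [HK0 HK]].
set (kappa0 := exp K * (INR n * kap)).
assert (Hk0 : 0 <= kappa0)
  by (apply Rmult_le_pos; [apply Rlt_le, exp_pos|apply Rmult_le_pos; trivial; apply pos_INR]).
assert (Hnk : 0 <= INR n * kappa0) by (apply Rmult_le_pos; trivial; apply pos_INR).
(* Chosen so that [rho <= eps0] gives [n * (2 * kappa0 * rho) <= 1/2]; adding 1 in the denominator
   covers [kappa0 = 0]. *)
set (eps0 := Rmin 1 (/ (4 * (1 + INR n * kappa0)))).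
assert (Heps0 : 0 < eps0) by (apply Rmin_glb_lt; [lra|apply Rinv_0_lt_compat; lra]).
destruct (decay_bound c1 d1 Hcd1 eps0 Heps0) as [B HB].
(* Lines down to distance [b0 - del] must still lie in H, hence the margin over a; beyond B the L1
   norms are at most [eps0]. *)
set (b0 := Rmax a B + 1).
assert (Hb0a : a + 1 <= b0) by (unfold b0; pose proof (Rmax_l a B); lra).
assert (Hb0B : B < b0) by (unfold b0; pose proof (Rmax_r a B); lra).
assert (Hlines : forall phi b t, c1 - del < phi < d1 + del -> b0 - del < b -> H (line_curve phi b t)).
{ intros phi b t Hp Hb; apply line_in_half_planes; [exact Ha|lra|]; apply HI; unfold c1, d1 in Hp; lra. }
set (p0 := line_curve c1 b0 0).
assert (Hp0 : H p0) by (apply Hlines; unfold c1, d1; lra).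
destruct (star_domain p0 Hp0) as [V [V1 [V2 [V3 V4]]]].
pose (L := fun i => Prim (fun z => lam i z * proj z)%C p0).
assert (HL : forall i p, (i < n)%nat -> V p -> Cder (L i) p (lam i p * proj p)%C).
{ intros i p Hi Hp; apply (Cder_Prim V p0 (fun z => lam i z * proj z)%C); trivial.
  apply holo_lam_proj; trivial. }
(* L vanishes at p0, on a far line, and PL at z0; two primitives differ by a constant. *)
assert (HLP : forall i p, (i < n)%nat -> H p -> L i p = (PL i p + L i z0)%C).
{ intros i p Hi Hp.
  pose proof (constant_on_star H z0 (H_star z0 Hz0) (fun z => L i z - PL i z)%C) as E.
  assert (E1 : (L i p - PL i p)%C = (L i z0 - PL i z0)%C).
  { apply E; trivial; intros q Hq.
    apply (Cder_eq _ _ (lam i q * proj q - lam i q * proj q)%C); [|ring].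
    apply Cder_minus; [apply HL; auto|apply HPL; trivial]. }
  rewrite HPL0 in E1.
  replace (L i p) with (PL i p + (L i p - PL i p))%C by ring; rewrite E1; ring. }
pose (rho := L1_norm_on_line N Rem).
assert (Hrho : forall phi b, c1 <= phi <= d1 -> b0 <= b -> rho phi b <= eps0)
  by (intros phi b Hp Hb; apply HB; trivial; lra).
assert (Hint : forall phi b s t, c1 <= phi <= d1 -> b0 <= b -> s <= t ->
  ex_RInt (fun t => N (Rem (line_curve phi b t))) s t /\
  RInt (fun t => N (Rem (line_curve phi b t))) s t <= rho phi b).
{ intros phi b s t Hp Hb Hst; apply RInt_gen_bound; trivial.
  - intros u; apply matrix_norm_pos; trivial.
  - apply (proj1 (Hdecay c1 d1 Hcd1)); [lra|exact Hp]. }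
destruct (conjugated_solution n V p0 lam L Rm c1 d1 b0 del K kap
  (fun phi b t => N (Rem (line_curve phi b t))) rho) as [v [w [Hv [Hvas [Hw [Hwv Hvw]]]]]]; trivial.
- unfold c1, d1; lra.
- lra.
- intros phi b t Hp Hb; apply V3, Hlines; trivial.
- intros i Hi; exact (Prim_base (fun z => lam i z * proj z)%C p0).
- intros i j Hi Hj; apply V4; trivial.
- intros phi b t; apply matrix_norm_pos; trivial.
- intros i j phi b t Hi Hj _ _; apply HNl; trivial.
- assert (E : forall i j phi b t, (i < n)%nat -> (j < n)%nat -> c1 <= phi <= d1 -> b0 <= b ->
    Re (L i (line_curve phi b t) - L j (line_curve phi b t))%C =
    Re (PL i (line_curve phi b t) - PL j (line_curve phi b t))%C + Re (L i z0 - L j z0)%C).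
  { intros i j phi b t Hi Hj Hp Hb; set (z := line_curve phi b t).
    assert (Hz : H z) by (apply Hlines; lra).
    rewrite (HLP i z Hi Hz), (HLP j z Hj Hz); unfold Re; simpl; ring. }
  intros i j Hi Hj; destruct (HK i j Hi Hj) as [H'|H']; [left|right]; intros phi b s t Hp Hb Hst;
    rewrite !E by trivial; specialize (H' phi b s t Hp ltac:(lra) Hst); lra.
- intros phi b Hp Hb; eapply Rle_trans; [apply Hrho; trivial|apply Rmin_l].
- intros phi b Hp Hb; fold kappa0.
  pose proof (Hrho phi b Hp Hb) as Hr.
  assert (Hr' : rho phi b <= / (4 * (1 + INR n * kappa0)))
    by (eapply Rle_trans; [exact Hr|apply Rmin_r]).
  apply Rle_trans with (2 * (INR n * kappa0) * / (4 * (1 + INR n * kappa0))).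
  + replace (INR n * (2 * kappa0 * rho phi b)) with (2 * (INR n * kappa0) * rho phi b) by ring.
    apply Rmult_le_compat_l; lra.
  + apply (Rmult_le_reg_r (4 * (1 + INR n * kappa0))); [lra|].
    rewrite Rmult_assoc, Rinv_l by lra; lra.
- set (A := fun z => plus (Lam z) (Rem z)).
  (* The constant right factor exp(- L(z0)) replaces the normalization at p0 by that at z0: then Y
     exp(- PL) is exp(L) v exp(- L), the matrix estimated by [conjugated_solution]. *)
  pose (Yf := fun i j z => (proj (L i z) * v i j z * proj (- L j z0))%C).
  pose (Zf := fun i j z => (proj (L i z0) * w i j z * proj (- L j z))%C).
  pose (Y := fun z => mk_matrix n n (fun i j => Yf i j z)).
  assert (EY : forall z i j, (i < n)%nat -> (j < n)%nat -> entry (Y z) i j = Yf i j z)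
    by (intros; unfold Y; rewrite entry_mk; trivial).
  assert (ZY : forall i j z, (i < n)%nat -> (j < n)%nat -> H z ->
    csum n (fun m => Zf i m z * entry (Y z) m j)%C = delta i j).
  { intros i j z Hi Hj Hz.
    rewrite (csum_ext n _ (fun m => (proj (L i z0) * proj (- L j z0)) * (w i m z * v m j z))%C).
    - rewrite csum_scal, Hwv by auto; unfold delta; destruct (Nat.eq_dec i j) as [<-|]; [|ring].
      rewrite Cmult_1_r, Cmult_comm; apply proj_opp_l.
    - intros m Hm; rewrite EY by trivial; unfold Zf, Yf.
      transitivity (proj (L i z0) * proj (- L j z0) * (w i m z * v m j z) * (proj (- L m z) * proj (L m z)))%C;
        [ring|rewrite proj_opp_l; ring]. }
  assert (YZ : forall i j z, (i < n)%nat -> (j < n)%nat -> H z ->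
    csum n (fun m => entry (Y z) i m * Zf m j z)%C = delta i j).
  { intros i j z Hi Hj Hz.
    rewrite (csum_ext n _ (fun m => (proj (L i z) * proj (- L j z)) * (v i m z * w m j z))%C).
    - rewrite csum_scal, Hvw by auto; unfold delta; destruct (Nat.eq_dec i j) as [<-|]; [|ring].
      rewrite Cmult_1_r, Cmult_comm; apply proj_opp_l.
    - intros m Hm; rewrite EY by trivial; unfold Zf, Yf.
      transitivity (proj (L i z) * proj (- L j z) * (v i m z * w m j z) * (proj (- L m z0) * proj (L m z0)))%C;
        [ring|rewrite proj_opp_l; ring]. }
  assert (DY : forall i j z, (i < n)%nat -> (j < n)%nat -> V z ->
    Cder (Yf i j) z ((lam i z * Yf i j z + csum n (fun m => Rm i m z * Yf m j z)) * proj z)%C).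
  { intros i j z Hi Hj Hz.
    apply (Cder_eq _ _ ((proj (L i z) * (lam i z * proj z) * v i j z +
      proj (L i z) * csum n (fun m => conjugated L Rm i m z * v m j z)) * proj (- L j z0) +
      proj (L i z) * v i j z * 0)%C).
    - apply (Cder_mult (fun z => proj (L i z) * v i j z)%C (fun _ => proj (- L j z0)%C)); [|apply Cder_const].
      apply (Cder_mult (fun z => proj (L i z)) (v i j)); [|apply Hv; trivial].
      apply (Cder_comp proj (L i)); [apply Cder_proj|apply HL; trivial].
    - rewrite (csum_ext n (fun m => conjugated L Rm i m z * v m j z)%C
        (fun m => (proj (- L i z) * proj z) * (Rm i m z * (proj (L m z) * v m j z)))%C)
        by (intros; unfold conjugated; ring).
      rewrite csum_scal.
      rewrite (csum_ext n (fun m => Rm i m z * Yf m j z)%C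
        (fun m => (Rm i m z * (proj (L m z) * v m j z)) * proj (- L j z0))%C)
        by (intros; unfold Yf; ring).
      rewrite csum_scal_r; unfold Yf.
      set (S := csum n _).
      transitivity (lam i z * (proj (L i z) * v i j z * proj (- L j z0)) * proj z +
        (proj (- L i z) * proj (L i z)) * (S * proj (- L j z0) * proj z))%C; [ring|].
      rewrite proj_opp_l; ring. }
  assert (Coef : forall i j z, (i < n)%nat -> (j < n)%nat -> H z -> entry (mult (A z) (Y z)) i j =
    (lam i z * Yf i j z + csum n (fun m => Rm i m z * Yf m j z))%C).
  { intros i j z Hi Hj Hz; rewrite entry_mult by trivial.
    rewrite (csum_ext n _ (fun m => delta i m * (lam i z * Yf m j z) + Rm i m z * Yf m j z)%C).
    - rewrite csum_plus, csum_delta_l by trivial; reflexivity.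
    - intros m Hm; unfold A; rewrite entry_coefficient, EY by trivial; ring. }
  exists Y, Zf; split; [|split].
  + split; [|split].
    * intros i j Hi Hj; apply holomorphic_onE; exists V; split; trivial; split; trivial.
      intros z Hz; eexists; apply (Cder_ext (Yf i j)); [intros; rewrite EY; trivial|apply DY; trivial].
    * intros z Hz; exists (mk_matrix n n (fun i j => Zf i j z)); split; apply matrix_ext; intros i j Hi Hj;
        rewrite entry_mult, entry_one by trivial.
      -- rewrite <- (YZ i j z Hi Hj Hz); apply csum_ext; intros m Hm; rewrite entry_mk; trivial.
      -- rewrite <- (ZY i j z Hi Hj Hz); apply csum_ext; intros m Hm; rewrite entry_mk; trivial.
    * intros z Hz i j Hi Hj; apply is_derive_Cder.
      apply (Cder_ext (Yf i j)); [intros; rewrite EY; trivial|].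
      fold (A z); rewrite Coef by trivial; apply DY; auto.
  + split; [|split; trivial].
    intros i j z Hi Hj Hz.
    apply (Cder_eq _ _ ((0 * w i j z + proj (L i z0) * (- csum n (fun m => w i m z * conjugated L Rm m j z)))
      * proj (- L j z) + proj (L i z0) * w i j z * (proj (- L j z) * - (lam j z * proj z)))%C).
    * apply (Cder_mult (fun z => proj (L i z0) * w i j z)%C (fun z => proj (- L j z))%C).
      -- apply (Cder_mult (fun _ => proj (L i z0)) (w i j)); [apply Cder_const|apply Hw; auto].
      -- apply (Cder_comp proj (fun z => - L j z)%C); [apply Cder_proj|apply Cder_opp, HL; auto].
    * rewrite (csum_ext n (fun m => Zf i m z * entry (plus (Lam z) (Rem z)) m j)%C
        (fun m => Zf i m z * lam m z * delta m j + Zf i m z * Rm m j z)%C)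
        by (intros m Hm; rewrite entry_coefficient by trivial; ring).
      rewrite csum_plus, (csum_delta_r n j (fun m => Zf i m z * lam m z)%C) by trivial.
      rewrite (csum_ext n (fun m => w i m z * conjugated L Rm m j z)%C
        (fun m => (w i m z * proj (- L m z) * Rm m j z) * (proj (L j z) * proj z))%C)
        by (intros; unfold conjugated; ring).
      rewrite (csum_ext n (fun m => Zf i m z * Rm m j z)%C
        (fun m => proj (L i z0) * (w i m z * proj (- L m z) * Rm m j z))%C)
        by (intros; unfold Zf; ring).
      rewrite csum_scal, csum_scal_r; unfold Zf; set (S := csum n _).
      transitivity (- (proj (L i z0) * w i j z * proj (- L j z) * lam j z * proj z) -
        (proj (- L j z) * proj (L j z)) * (proj (L i z0) * S * proj z))%C; [ring|].
      rewrite proj_opp_l; ring.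
  + intros eps Heps.
    assert (He : 0 < eps / (2 * kappa0 + 1)) by (apply Rdiv_lt_0_compat; lra).
    destruct (decay_bound c1 d1 Hcd1 _ He) as [B' HB'].
    assert (Hpi : 0 < del < PI / 2) by (pose proof PI2_1; lra).
    assert (Hsin : 0 < sin del) by (apply sin_gt_0; pose proof PI2_1; lra).
    (* A point of at least this modulus lies on a line with angle in the widened interval and at
       distance at least [Rmax b0 B' + 1]. *)
    exists ((Rmax b0 B' + 1) / sin del); intros z Hz Hmz i j Hi Hj.
    destruct (far_point_on_line c d a del z Ha Hpi Hz) as [phi [b [t [Hp [Hb Ez]]]]].
    fold c1 d1 in Hp.
    assert (Hbig : Rmax b0 B' + 1 <= b).
    { eapply Rle_trans; [|exact Hb].
      apply (Rmult_le_compat_r (sin del)) in Hmz; [|lra].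
      replace ((Rmax b0 B' + 1) / sin del * sin del) with (Rmax b0 B' + 1) in Hmz by (field; lra).
      exact Hmz. }
    assert (Hbb0 : b0 <= b) by (pose proof (Rmax_l b0 B'); lra).
    assert (HbB : B' < b) by (pose proof (Rmax_r b0 B'); lra).
    assert (HHz : H z) by (apply (sub_half_planes c d); trivial; split; trivial).
    rewrite EY by trivial; unfold Yf.
    pose proof (Hvas i j phi b t Hi Hj Hp Hbb0) as Has; rewrite <- Ez in Has; fold kappa0 in Has.
    replace (proj (L i z) * v i j z * proj (- L j z0) * proj (- PL j z))%C with
      (proj (L i z - L j z) * v i j z)%C.
    * eapply Rle_trans; [exact Has|].
      apply Rle_trans with ((2 * kappa0 + 1) * (eps / (2 * kappa0 + 1))); [|right; field; lra].
      assert (Hr : rho phi b <= eps / (2 * kappa0 + 1)) by (apply HB'; trivial).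
      apply Rle_trans with (2 * kappa0 * (eps / (2 * kappa0 + 1))); [apply Rmult_le_compat_l; lra|].
      apply Rmult_le_compat_r; lra.
    * replace (L i z - L j z)%C with (L i z + (- L j z0 + - PL j z))%C by (rewrite (HLP j z) by trivial; ring).
      rewrite !proj_plus; ring.
Qed.

End System.

Theorem theorem2p6 :
  forall (n : nat) (hn : (1 <= n)%nat)
    (N : @matrix C n n -> R) (hN : is_matrix_norm N)
    (a : R) (ha : 0 < a)
    (alpha beta : Rbar)
    (Lam Rem : UC -> @matrix C n n),
  let I := in_open_itv alpha beta in
  let H := half_planes I a in
  mx_holomorphic_on H Lam ->
  (forall z, H z -> is_diagonal (Lam z)) ->
  L_condition Lam a I ->
  mx_holomorphic_on H Rem ->
  good_decay N Rem a I ->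
  forall z0 : UC, H z0 ->
  exists Y : UC -> @matrix C n n,
    (fundamental_solution H (fun z => plus (Lam z) (Rem z)) Y /\
     has_asymptotics N Lam a I z0 Y) /\
    forall Y' : UC -> @matrix C n n,
      fundamental_solution H (fun z => plus (Lam z) (Rem z)) Y' ->
      has_asymptotics N Lam a I z0 Y' ->
      forall z, H z -> Y' z = Y z.
Proof.
intros n Hn N HN a Ha alpha beta Lam Rem I H HLam Hdiag HL HRem HD z0 Hz0.
destruct (lam_primitive_exists n a alpha beta Lam Rem z0 Hn Ha HLam HRem Hz0) as [PL [HPL HPL0]].
(* The half-plane containing z0 provides an angle of I, which serves as the common reference for
   comparing solutions. *)
assert (Hphi : exists phi, I phi) by (destruct Hz0 as [phi [Hphi _]]; exists phi; exact Hphi).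
destruct Hphi as [phi Hphi].
assert (Exists : forall c d, closed_subitv c d I -> exists Y Z,
  fundamental_solution H (fun z => plus (Lam z) (Rem z)) Y /\
  has_inverse n a alpha beta Lam Rem Y Z /\ entry_asymptotics n a PL c d Y)
  by (intros c d; apply (solution_exists_on n N a alpha beta Lam Rem z0 Hn HN Ha HLam Hdiag HL HRem HD Hz0 PL HPL HPL0)).
assert (Unique : forall Y Z Y', has_inverse n a alpha beta Lam Rem Y Z ->
  fundamental_solution H (fun z => plus (Lam z) (Rem z)) Y' ->
  entry_asymptotics n a PL phi phi Y -> entry_asymptotics n a PL phi phi Y' ->
  forall z, H z -> Y' z = Y z)
  by (intros Y Z Y'; apply (solution_unique n a alpha beta Lam Rem z0 Hn Ha HLam HL HRem Hz0 PL HPL phi); exact Hphi).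
assert (Hpp : closed_subitv phi phi I).
{ split; [lra|]; intros x Hx; replace x with phi; [exact Hphi|unfold in_closed_itv in Hx; lra]. }
assert (Mono : forall c d c' d' Y, c' <= c -> d <= d' ->
  entry_asymptotics n a PL c' d' Y -> entry_asymptotics n a PL c d Y).
{ intros c d c' d' Y Hc Hd HA eps He; destruct (HA eps He) as [M HM]; exists M.
  intros z [psi [Hpsi Hz]]; apply HM; exists psi; split; trivial; unfold in_closed_itv in *; lra. }
destruct (Exists phi phi Hpp) as [Y [Z [HY [HZ HA]]]].
exists Y; split; [split; trivial|].
- apply (has_asymptoticsE n N a alpha beta Lam Rem z0 Hn HN Ha HLam Hdiag HRem Hz0 PL HPL HPL0 Y).
  intros c d [Hcd Hsub].
  (* The interval [c', d'] contains both [c, d] and phi: its solution has the asymptotics over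
     [c, d] and equals Y by uniqueness at phi. *)
  set (c' := Rmin c phi); set (d' := Rmax d phi).
  assert (Hsub' : closed_subitv c' d' I).
  { pose proof (Rmin_l c phi); pose proof (Rmax_l d phi); split; [unfold c', d'; lra|].
    intros x [Hx1 Hx2]; unfold c', d', Rmin, Rmax in Hx1, Hx2.
    destruct (Rle_dec x phi) as [Hxp|Hxp].
    - destruct (Rle_dec c phi); [|apply (open_itv_convex alpha beta phi phi); trivial; lra].
      apply (open_itv_convex alpha beta c phi); trivial; [apply Hsub; split; lra|lra].
    - destruct (Rle_dec d phi); [apply (open_itv_convex alpha beta phi phi); trivial; lra|].
      apply (open_itv_convex alpha beta phi d); trivial; [apply Hsub; split; lra|lra]. }
  destruct (Exists c' d' Hsub') as [Y1 [Z1 [HY1 [_ HA1]]]].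
  assert (E : forall z, H z -> Y1 z = Y z).
  { apply (Unique Y Z Y1); trivial; apply (Mono _ _ c' d'); trivial; [apply Rmin_r|apply Rmax_r]. }
  apply (Mono c d c' d' Y1 (Rmin_l c phi) (Rmax_l d phi)) in HA1.
  intros eps He; destruct (HA1 eps He) as [M HM]; exists M; intros z Hz.
  rewrite <- E; [apply HM, Hz|].
  destruct Hz as [psi [H1 H2]]; exists psi; split; [apply Hsub; exact H1|exact H2].
- intros Y' HY' HA'; apply (Unique Y Z Y'); trivial.
  apply (proj1 (has_asymptoticsE n N a alpha beta Lam Rem z0 Hn HN Ha HLam Hdiag HRem Hz0 PL HPL HPL0 Y') HA' phi phi Hpp).
Qed.
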